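(* $(\mathsf{FLCAb}, \otimes, \mathrm{Hom})$ is a closed symmetric monoidal category; i.e. $\otimes$ is the tensor product of a symmetric monoidal structure on $\mathsf{FLCAb}$, with internal Hom given by $\mathrm{Hom}(A,B)$ with the compact-open topology.
   Context: LCA group means locally compact (Hausdorff) abelian group; $\mathrm{Hom}(A,B)$ denotes the group of continuous homomorphisms with the compact-open topology and $A^{\vee} := \mathrm{Hom}(A, \mathbb{R}/\mathbb{Z})$ the Pontryagin dual. A morphism $f: A\to B$ of LCA groups is strict if the induced map $A/\ker(f) \to B$ is a closed embedding. An LCA group $A$ has finite ranks if the real vector spaces $\mathrm{Hom}(A, \mathbb{R})$ and $\mathrm{Hom}(\mathbb{R}, A)$ are finite-dimensional and, for every prime $p$, multiplication $p: A \to A$ is strict with finite kernel and cokernel. $\mathsf{FLCAb}$ is the category of LCA groups having finite ranks and continuous homomorphisms. For $A, B \in \mathsf{FLCAb}$ one has $\mathrm{Hom}(A,B) \in \mathsf{FLCAb}$, and the tensor product is defined as $A \otimes B := \mathrm{Hom}(A, B^{\vee})^{\vee} \in \mathsf{FLCAb}$. *)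

(* Defs.v *)
From HB Require Import structures.
From mathcomp Require Import all_boot all_order all_algebra generic_quotient.
From mathcomp Require Import ring_quotient archimedean.
From mathcomp Require Import all_classical all_reals all_analysis.

Set Implicit Arguments.
Unset Strict Implicit.
Unset Printing Implicit Defensive.

Import Order.TTheory GRing.Theory Num.Theory.
Import numFieldNormedType.Exports.

Local Open Scope classical_set_scope.
Local Open Scope ring_scope.
Local Open Scope quotient_scope.

Section TopologicalZmodule.
Variable B : topologicalZmodType.

Lemma continuousB_at (X : topologicalType) (f g : X -> B) x :
  {for x, continuous f} -> {for x, continuous g} ->
  {for x, continuous (fun y => f y - g y)}.
Proof.
move=> fx gx.
apply: (@continuous_comp _ _ _ (fun y => (f y, g y)) (fun z : B * B => z.1 - z.2)).
  exact: cvg_pair.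
exact: sub_continuous.
Qed.

Lemma topologicalZmod_regular : regular_space B.
Proof.
move=> a U Ua.
have : nbhs (a, 0 : B) [set z : B * B | U (z.1 - z.2)].
  by have := @sub_continuous B (a, 0); apply; rewrite /= subr0.
case=> -[V W] /= [Va W0] VWU.
exists V => // y clVy.
have /clVy[v [Vv /= Wv]] : nbhs y [set z | W (z - y)].
  have : {for y, continuous (fun z : B => z - y)}.
    by apply: continuousB_at; [exact: cvg_id | exact: cvg_cst].
  by apply; rewrite subrr.
by have := VWU (v, v - y) (conj Vv Wv); rewrite /= subKr.
Qed.

End TopologicalZmodule.

Section Hom.
Variables A B : topologicalZmodType.

Definition conthom : {pred A -> B} :=
  fun f => `[< zmod_morphism f /\ continuous f >].

Lemma conthom_zmod_closed : zmod_closed conthom.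
Proof.
split=> [|f g /asboolP[fB fC] /asboolP[gB gC]].
  by apply/asboolP; split=> [x y|]; [rewrite subr0 | exact: cst_continuous].
apply/asboolP; split=> [x y|x]; last by apply: continuousB_at; [exact: fC|exact: gC].
have subE z : (f - g) z = f z - g z by [].
by rewrite !subE fB gB !opprD addrACA.
Qed.
HB.instance Definition _ := GRing.isZmodClosed.Build (A -> B) conthom
  conthom_zmod_closed.

Record chom := CHom { hom_fun :> A -> B; hom_funP : hom_fun \in conthom }.

HB.instance Definition _ := [isSub for hom_fun].
HB.instance Definition _ := [Choice of chom by <:].
HB.instance Definition _ := [SubChoice_isSubZmodule of chom by <:].

HB.instance Definition _ := Topological.copy chom
  (initial_topology (hom_fun : chom -> {compact-open, A -> B})).

Lemma homP (f g : chom) : (forall x, f x = g x) -> f = g.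
Proof. by move=> fg; apply: val_inj; apply/funext. Qed.

Lemma homB (f : chom) : zmod_morphism f.
Proof. by have /asboolP[] := hom_funP f. Qed.

Lemma hom_continuous (f : chom) : continuous f.
Proof. by have /asboolP[] := hom_funP f. Qed.

HB.instance Definition _ (f : chom) := GRing.isZmodMorphism.Build A B f (homB f).

Definition mkhom (f : A -> B) (fB : zmod_morphism f) (fC : continuous f) : chom :=
  CHom (introT (asboolP _) (conj fB fC)).

Lemma hom_open (K : set A) (O : set B) : compact K -> open O ->
  open [set f : chom | f @` K `<=` O].
Proof. by move=> cK oO; exists [set f | f @` K `<=` O] => //; exact: compact_open_open. Qed.

Lemma continuous_to_hom (X : topologicalType) (h : X -> chom) :
  (forall x K O, compact K -> open O -> h x @` K `<=` O ->
    \forall y \near x, h y @` K `<=` O) -> continuous h.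
Proof.
move=> hP; apply: continuous_comp_initial => x.
by apply/compact_open_cvgP => K O cK oO; exact: hP.
Qed.

(* Joint continuity of evaluation, restricted to a compact set of arguments. *)
Lemma near_eval (f : chom) (K : set A) x (U : set B) :
  compact K -> K x -> nbhs (f x) U ->
  nbhs (x, f) [set z : A * chom | K z.1 -> U (z.2 z.1)].
Proof.
move=> cK Kx Ufx.
have Uofx : nbhs (f x) U° by exact: nbhs_interior.
have [V Vfx VU] := topologicalZmod_regular Uofx.
pose L := K `&` closure (f @^-1` V).
have cL : compact L by apply: compact_closedI => //; exact: closed_closure.
have fL : f @` L `<=` U°.
  move=> _ [y [_ clVy] <-]; apply: VU => W /(hom_continuous (f := f)) Wy.
  by have [z [Vz Wz]] := clVy _ Wy; exists (f z).
exists (f @^-1` V, [set g : chom | g @` L `<=` U°]).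
  split; first exact: hom_continuous.
  by apply: open_nbhs_nbhs; split=> //; apply: hom_open => //; exact: open_interior.
case=> y g /= [Vy gL] Ky; apply: interior_subset; apply: gL; exists y => //.
by split=> //; exact: subset_closure.
Qed.

Lemma hom_sub_continuous : continuous (fun fg : chom * chom => fg.1 - fg.2).
Proof.
apply: continuous_to_hom => -[f g] K O cK oO /= fgK.
suff : nbhs (f, g) [set fg : chom * chom |
    K `<=` [set x | O (fg.1 x - fg.2 x)]].
  by apply: filterS => fg fgO _ [x Kx <-]; exact: fgO.
move/compact_near_coveringP/near_covering_withinP : (cK).
move=> /(_ _ (nbhs (f, g)) (fun fg x => O (fg.1 x - fg.2 x))); apply=> x Kx.
have [[U V] /= [Ufx Vgx] UVO] : nbhs (f x, g x) [set z : B * B | O (z.1 - z.2)].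
  have := @sub_continuous B (f x, g x); apply; apply: open_nbhs_nbhs.
  by split=> //; apply: fgK; exists x.
have [[P Q] /= [Px Qf] PQ] := near_eval cK Kx Ufx.
have [[P' Q'] /= [Px' Qg] PQ'] := near_eval cK Kx Vgx.
exists (P `&` P', Q `*` Q').
  by split; [exact: filterI | exists (Q, Q')].
case=> y -[f' g'] /= [[Py Py'] [Qf' Qg']] Ky; apply: (UVO (f' y, g' y)); split.
  exact: (PQ (y, f')).
exact: (PQ' (y, g')).
Qed.

HB.instance Definition _ :=
  PreTopologicalNmodule_isTopologicalZmodule.Build chom hom_sub_continuous.

End Hom.

Section Composition.
Variables A B C : topologicalZmodType.

Definition idhom : chom A A := 
  @mkhom A A id (fun _ _ => erefl) (fun x => @cvg_id _ (nbhs x)).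

Variables (g : chom B C) (f : chom A B).

Lemma comphomB : zmod_morphism (g \o f).
Proof. by move=> x y; rewrite /= !raddfB. Qed.

Lemma comphom_continuous : continuous (g \o f).
Proof. by move=> x; apply: continuous_comp; exact: hom_continuous. Qed.

Definition comphom : chom A C := mkhom comphomB comphom_continuous.

End Composition.

Section HomMap.
Variables (A A' B B' : topologicalZmodType) (f : chom A' A) (g : chom B B').

Definition hommap_fun (phi : chom A B) : chom A' B' := comphom g (comphom phi f).

Lemma hommapB : zmod_morphism hommap_fun.
Proof.
move=> phi psi; apply: homP => x; exact: (raddfB g (phi (f x)) (psi (f x))).
Qed.

Lemma hommap_continuous : continuous hommap_fun.
Proof.
apply: continuous_to_hom => phi K O cK oO phiO.
have : nbhs phi [set psi : chom A B | psi @` (f @` K) `<=` g @^-1` O].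
  apply: open_nbhs_nbhs; split.
    apply: hom_open; last by move/continuousP : (hom_continuous (f := g)); exact.
    apply: continuous_compact => //; apply: continuous_subspaceT.
    exact: hom_continuous.
  by move=> _ [_ [x Kx <-] <-]; apply: phiO; exists x.
apply: filterS => psi psiO _ [x Kx <-]; apply: psiO.
by exists (f x) => //; exists x.
Qed.

Definition hommap : chom (chom A B) (chom A' B') := mkhom hommapB hommap_continuous.

End HomMap.

Section Quotient.
Variables (A : topologicalZmodType) (I : zmodClosed A).

Definition tquot : Type := quotient_topology (Quotient.quot I).

HB.instance Definition _ := Topological.on tquot.
HB.instance Definition _ := Quotient.on tquot.
HB.instance Definition _ := GRing.isZmodule.Build tquot
  (@Quotient.addqA A I) (@Quotient.addqC A I)
  (@Quotient.add0q A I) (@Quotient.addNq A I).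

Lemma tquot_pi_continuous : continuous (\pi_tquot : A -> tquot).
Proof. exact: pi_continuous. Qed.

Lemma tquot_eqP (x y : A) : \pi_tquot x = \pi_tquot y <-> x - y \in I.
Proof. rewrite (Quotient.idealrBE I x y); split=> [e|/eqP//]; exact/eqP. Qed.

Lemma tquot_piB : zmod_morphism (\pi_tquot : A -> tquot).
Proof. exact: (raddfB (\pi_(Quotient.quot I))). Qed.

Lemma tquot_pi_nbhs (x : A) (U : set A) :
  nbhs x U -> nbhs (\pi_tquot x) [set \pi_tquot y | y in U].
Proof.
rewrite nbhsE => -[V [oV Vx] VU].
apply: (@filterS _ _ _ [set \pi_tquot y | y in V]).
  by move=> _ [y Vy <-]; exists y => //; exact: VU.
apply: open_nbhs_nbhs; split; last by exists x.
rewrite /open/= /quotient_open.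
have -> : \pi_tquot @^-1` [set \pi_tquot y | y in V] =
    \bigcup_(h in [set h | h \in I]) ((fun y => y - h) @^-1` V).
  apply/seteqP; split=> [y [v Vv vy]|y [h /= hI Vyh]].
    exists (y - v); first by apply/tquot_eqP.
    by rewrite /= subKr.
  exists (y - h) => //; apply/tquot_eqP.
  by rewrite addrAC subrr sub0r rpredN.
apply: bigcup_open => h _; apply: open_comp => // y _.
by apply: continuousB_at; [exact: cvg_id | exact: cvg_cst].
Qed.

Lemma tquot_sub_continuous :
  continuous (fun xy : tquot * tquot => xy.1 - xy.2).
Proof.
case=> p q W /=; rewrite -[p]reprK -[q]reprK -tquot_piB => Wpq.
set a := repr p; set b := repr q.
have [[U V] /= [Ua Vb] UVW] :
    nbhs (a, b) [set z : A * A | W (\pi_tquot (z.1 - z.2))].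
  have /(_ [set x | W (\pi_tquot x)]) := @sub_continuous A (a, b); apply.
  exact: tquot_pi_continuous.
exists ([set \pi_tquot y | y in U], [set \pi_tquot y | y in V]).
  by split; exact: tquot_pi_nbhs.
case=> _ _ /= [[u Uu <-] [v Vv <-]]; rewrite /= -tquot_piB.
exact: (UVW (u, v)).
Qed.

HB.instance Definition _ :=
  PreTopologicalNmodule_isTopologicalZmodule.Build tquot tquot_sub_continuous.

End Quotient.

Section KernelImage.
Variables (A B : topologicalZmodType) (f : chom A B).

Definition homker : {pred A} := fun x => f x == 0.

Lemma homker_zmod_closed : zmod_closed homker.
Proof.
split=> [|x y /eqP x0 /eqP y0]; first by apply/eqP; exact: raddf0.
by apply/eqP; rewrite homB x0 y0 subr0.
Qed.
HB.instance Definition _ := GRing.isZmodClosed.Build A homker homker_zmod_closed.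

Definition homim : {pred B} := fun y => `[< range f y >].

Lemma homim_zmod_closed : zmod_closed homim.
Proof.
split=> [|_ _ /asboolP[x _ <-] /asboolP[y _ <-]]; apply/asboolP.
  by exists 0 => //; exact: raddf0.
by exists (x - y) => //; exact: raddfB.
Qed.
HB.instance Definition _ := GRing.isZmodClosed.Build B homim homim_zmod_closed.

(* The map [A / ker f -> B] induced by [f], see [coim_map_pi]. *)
Definition coim_map (q : tquot homker) : B := f (repr q).

Lemma coim_map_pi x : coim_map (\pi_(tquot homker) x) = f x.
Proof.
apply/eqP; rewrite -subr_eq0 -raddfB; apply/(tquot_eqP homker).
by rewrite reprK.
Qed.

End KernelImage.

Definition closed_embedding (X Y : topologicalType) (f : X -> Y) : Prop :=
  [/\ injective f,
      forall U : set X, open U <-> exists2 V : set Y, open V & U = f @^-1` V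
    & closed (range f)].

Definition strict (A B : topologicalZmodType) (f : chom A B) : Prop :=
  closed_embedding (coim_map (f := f)).

Section MulNat.
Variables (A : topologicalZmodType) (n : nat).

Lemma mulrnB : zmod_morphism (fun x : A => x *+ n).
Proof. by move=> x y; rewrite mulrnBl. Qed.

Lemma mulrn_continuous : continuous (fun x : A => x *+ n).
Proof.
elim: n => [|m IHm].
  by under eq_fun do rewrite mulr0n; exact: cst_continuous.
have -> : (fun x : A => x *+ m.+1) = (fun x => x - (- x) *+ m).
  by apply/funext => x; rewrite mulrS mulNrn opprK.
move=> x; apply: (@continuousB_at A A id (fun x => (- x) *+ m)).
  exact: cvg_id.
apply: (@continuous_comp _ _ _ -%R (fun x : A => x *+ m)); last exact: IHm.
exact: opp_continuous.
Qed.

Definition mulnhom : chom A A := mkhom mulrnB mulrn_continuous.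

End MulNat.

Section RealHom.
Variables (R : realType) (A : topologicalZmodType).

(* [Hom(A, R)], with the real vector space structure [(c *: f) x = c * f x]. *)
Definition homto : Type := chom A R.
HB.instance Definition _ := GRing.Zmodule.on homto.

Lemma homto_scaleB (c : R) (f : homto) : zmod_morphism (fun x => c * f x).
Proof. by move=> x y; rewrite raddfB mulrBr. Qed.

Lemma homto_scale_continuous (c : R) (f : homto) :
  continuous (fun x => c * f x : R).
Proof. by move=> x; apply: cvgM; [exact: cvg_cst | exact: hom_continuous]. Qed.

Definition homto_scale (c : R) (f : homto) : homto :=
  mkhom (@homto_scaleB c f) (@homto_scale_continuous c f).

Fact homto_scaleA a b f :
  homto_scale a (homto_scale b f) = homto_scale (a * b) f.
Proof. by apply: homP => x /=; rewrite mulrA. Qed.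
Fact homto_scale1 : left_id 1 homto_scale.
Proof. by move=> f; apply: homP => x /=; rewrite mul1r. Qed.
Fact homto_scaleDr : right_distributive homto_scale +%R.
Proof. by move=> c f g; apply: homP => x; exact: mulrDr. Qed.
Fact homto_scaleDl f : {morph homto_scale^~ f : a b / a + b}.
Proof. by move=> a b; apply: homP => x; exact: mulrDl. Qed.
HB.instance Definition _ := GRing.Zmodule_isLmodule.Build R homto
  homto_scaleA homto_scale1 homto_scaleDr homto_scaleDl.

(* [Hom(R, A)], with the real vector space structure [(c *: f) x = f (c * x)]. *)
Definition homfrom : Type := chom R A.
HB.instance Definition _ := GRing.Zmodule.on homfrom.

Lemma homfrom_scaleB (c : R) (f : homfrom) : zmod_morphism (fun x => f (c * x)).
Proof. by move=> x y; rewrite mulrBr raddfB. Qed.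

Lemma homfrom_scale_continuous (c : R) (f : homfrom) :
  continuous (fun x => f (c * x)).
Proof.
move=> x; apply: (@continuous_comp _ _ _ (fun x : R => c * x) f).
  by apply: cvgM; [exact: cvg_cst | exact: cvg_id].
exact: hom_continuous.
Qed.

Definition homfrom_scale (c : R) (f : homfrom) : homfrom :=
  mkhom (@homfrom_scaleB c f) (@homfrom_scale_continuous c f).

Fact homfrom_scaleA a b f :
  homfrom_scale a (homfrom_scale b f) = homfrom_scale (a * b) f.
Proof. by apply: homP => x /=; rewrite mulrA [b * a]mulrC. Qed.
Fact homfrom_scale1 : left_id 1 homfrom_scale.
Proof. by move=> f; apply: homP => x /=; rewrite mul1r. Qed.
Fact homfrom_scaleDr : right_distributive homfrom_scale +%R.
Proof. by move=> c f g; apply: homP. Qed.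
Fact homfrom_scaleDl f : {morph homfrom_scale^~ f : a b / a + b}.
Proof. by move=> a b; apply: homP => x /=; rewrite mulrDl; exact: raddfD. Qed.
HB.instance Definition _ := GRing.Zmodule_isLmodule.Build R homfrom
  homfrom_scaleA homfrom_scale1 homfrom_scaleDr homfrom_scaleDl.

End RealHom.

Definition finite_dim (K : nzRingType) (V : lmodType K) : Prop :=
  exists n (e : 'I_n -> V), forall v, exists c : 'I_n -> K,
    v = \sum_(i < n) c i *: e i.

Definition LCA (A : topologicalZmodType) : Prop :=
  hausdorff_space A /\ locally_compact [set: A].

Definition finite_ranks (R : realType) (A : topologicalZmodType) : Prop :=
  [/\ finite_dim (homto R A), finite_dim (homfrom R A)
    & forall p, prime p ->
      [/\ strict (mulnhom A p), finite_set [set x | x \in homker (mulnhom A p)]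
        & finite_set [set: tquot (homim (mulnhom A p))]]].

Record category := Category {
  obj :> Type;
  mor : obj -> obj -> Type;
  idm : forall X, mor X X;
  cmp : forall X Y Z, mor Y Z -> mor X Y -> mor X Z;
  cmp1m : forall X Y (f : mor X Y), cmp (idm Y) f = f;
  cmpm1 : forall X Y (f : mor X Y), cmp f (idm X) = f;
  cmpA : forall X Y Z W (h : mor Z W) (g : mor Y Z) (f : mor X Y),
    cmp h (cmp g f) = cmp (cmp h g) f }.

Arguments mor {_}.
Arguments idm {_}.

Declare Scope cat_scope.
Delimit Scope cat_scope with cat.
Local Open Scope cat_scope.
Notation "g ∘ f" := (cmp g f) (at level 40, left associativity) : cat_scope.

Definition opcat (C : category) : category :=
  @Category C (fun X Y => mor Y X) (@idm C) (fun X Y Z g f => cmp f g)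
    (fun X Y f => cmpm1 f) (fun X Y f => cmp1m f)
    (fun X Y Z W h g f => esym (cmpA f g h)).

Record isomorphism (C : category) (X Y : C) := Isomorphism {
  iso_mor :> mor X Y;
  iso_inv : mor Y X;
  iso_invK : iso_inv ∘ iso_mor = idm X;
  iso_morK : iso_mor ∘ iso_inv = idm Y }.

Record bifunctor (C D E : category) := Bifunctor {
  bif_obj :> C -> D -> E;
  bif_mor : forall X X' Y Y',
    mor X X' -> mor Y Y' -> mor (bif_obj X Y) (bif_obj X' Y');
  bif_id : forall X Y, bif_mor (idm X) (idm Y) = idm (bif_obj X Y);
  bif_cmp : forall X X' X'' Y Y' Y''
      (f' : mor X' X'') (f : mor X X') (g' : mor Y' Y'') (g : mor Y Y'),
    bif_mor (f' ∘ f) (g' ∘ g) = bif_mor f' g' ∘ bif_mor f g }.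

Record symmetric_monoidal (C : category) (T : bifunctor C C C) := SymMonoidal {
  munit : C;
  massoc : forall X Y Z, isomorphism (T (T X Y) Z) (T X (T Y Z));
  mlunit : forall X, isomorphism (T munit X) X;
  mrunit : forall X, isomorphism (T X munit) X;
  mbraid : forall X Y, isomorphism (T X Y) (T Y X);
  massoc_nat : forall X X' Y Y' Z Z'
      (f : mor X X') (g : mor Y Y') (h : mor Z Z'),
    massoc X' Y' Z' ∘ bif_mor T (bif_mor T f g) h =
    bif_mor T f (bif_mor T g h) ∘ massoc X Y Z;
  mlunit_nat : forall X X' (f : mor X X'),
    mlunit X' ∘ bif_mor T (idm munit) f = f ∘ mlunit X;
  mrunit_nat : forall X X' (f : mor X X'),
    mrunit X' ∘ bif_mor T f (idm munit) = f ∘ mrunit X;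
  mbraid_nat : forall X X' Y Y' (f : mor X X') (g : mor Y Y'),
    mbraid X' Y' ∘ bif_mor T f g = bif_mor T g f ∘ mbraid X Y;
  mpentagon : forall X Y Z W,
    massoc X Y (T Z W) ∘ massoc (T X Y) Z W =
    bif_mor T (idm X) (massoc Y Z W) ∘ massoc X (T Y Z) W
      ∘ bif_mor T (massoc X Y Z) (idm W);
  mtriangle : forall X Y,
    bif_mor T (idm X) (mlunit Y) ∘ massoc X munit Y =
    bif_mor T (mrunit X) (idm Y);
  mhexagon : forall X Y Z,
    massoc Y Z X ∘ mbraid X (T Y Z) ∘ massoc X Y Z =
    bif_mor T (idm Y) (mbraid X Z) ∘ massoc Y X Z
      ∘ bif_mor T (mbraid X Y) (idm Z);
  msymmetry : forall X Y, mbraid Y X ∘ mbraid X Y = idm (T X Y) }.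

(* [H] is an internal Hom for [T]: the functors [T - Y] are left adjoint to
   [H Y -], naturally in the parameter [Y]. *)
Record closed_structure (C : category) (T : bifunctor C C C)
    (H : bifunctor (opcat C) C C) := ClosedStructure {
  ccurry : forall X Y Z, mor (T X Y) Z -> mor X (H Y Z);
  ccurry_bij : forall X Y Z, bijective (@ccurry X Y Z);
  ccurry_nat : forall (X X' Y Y' Z Z' : C)
      (f : mor X' X) (g : mor Y' Y) (h : mor Z Z') (k : mor (T X Y) Z),
    ccurry (h ∘ k ∘ bif_mor T f g) =
    bif_mor H (g : @mor (opcat C) Y Y') h ∘ ccurry k ∘ f }.

Record closed_symmetric_monoidal (C : category) (T : bifunctor C C C)
    (H : bifunctor (opcat C) C C) := ClosedSymMonoidal {
  csm_monoidal : symmetric_monoidal T;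
  csm_closed : closed_structure T H }.

Section FLCAb.
Variable R : realType.

Definition Zreal : {pred R} := fun x => x \is a Num.int.

Lemma Zreal_zmod_closed : zmod_closed Zreal.
Proof. by split=> [|x y xZ yZ]; [exact: int_num0 | exact: rpredB]. Qed.
HB.instance Definition _ := GRing.isZmodClosed.Build R Zreal Zreal_zmod_closed.

Definition circle : topologicalZmodType := tquot Zreal.

Definition pdual (A : topologicalZmodType) : topologicalZmodType := chom A circle.

Definition dualmap (A B : topologicalZmodType) (f : chom A B) :
  chom (pdual B) (pdual A) := hommap f (idhom circle).

Definition tensor (A B : topologicalZmodType) : topologicalZmodType :=
  pdual (chom A (pdual B)).

Definition tensormap (A A' B B' : topologicalZmodType)
    (f : chom A A') (g : chom B B') : chom (tensor A B) (tensor A' B') :=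
  dualmap (hommap f (dualmap g)).

Definition is_FLCA (A : topologicalZmodType) : Prop := LCA A /\ finite_ranks R A.

Record FLCA := MkFLCA {
  flca_sort :> topologicalZmodType;
  flcaP : is_FLCA flca_sort }.

Fact FLCA_cmp1m (A B : FLCA) (f : chom A B) : comphom (idhom B) f = f.
Proof. exact: homP. Qed.
Fact FLCA_cmpm1 (A B : FLCA) (f : chom A B) : comphom f (idhom A) = f.
Proof. exact: homP. Qed.
Fact FLCA_cmpA (A B C D : FLCA) (h : chom C D) (g : chom B C) (f : chom A B) :
  comphom h (comphom g f) = comphom (comphom h g) f.
Proof. exact: homP. Qed.

Definition FLCAb : category := @Category FLCA (fun A B => chom A B)
  (fun A => idhom A) (fun A B C g f => comphom g f)
  FLCA_cmp1m FLCA_cmpm1 FLCA_cmpA.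

(* The closure of FLCAb under [chom] and [tensor] is a parameter of the two
   bifunctors; it only serves to place their values in FLCAb. *)
Section HomFunctor.
Variable homFLCA : forall A B : FLCA, is_FLCA (chom A B).

Let homobj (A : opcat FLCAb) (B : FLCAb) : FLCAb := MkFLCA (homFLCA A B).
Let hommor (A A' : opcat FLCAb) (B B' : FLCAb)
  (f : mor A A') (g : mor B B') : mor (homobj A B) (homobj A' B') := hommap f g.

Fact homfunctor_id A B : @hommor A A B B (idm A) (idm B) = idm (homobj A B).
Proof. by apply: homP => phi; exact: homP. Qed.
Fact homfunctor_cmp A A' A'' B B' B'' (f' : mor A' A'') (f : mor A A')
    (g' : mor B' B'') (g : mor B B') :
  hommor (f' ∘ f) (g' ∘ g) = hommor f' g' ∘ hommor f g.
Proof. by apply: homP => phi; exact: homP. Qed.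

Definition homfunctor : bifunctor (opcat FLCAb) FLCAb FLCAb :=
  Bifunctor homfunctor_id homfunctor_cmp.
End HomFunctor.

Section TensorFunctor.
Variable tensorFLCA : forall A B : FLCA, is_FLCA (tensor A B).

Let tensorobj (A B : FLCAb) : FLCAb := MkFLCA (tensorFLCA A B).
Let tensormor (A A' B B' : FLCAb) (f : mor A A') (g : mor B B') :
  mor (tensorobj A B) (tensorobj A' B') := tensormap f g.

Fact tensorfunctor_id A B :
  @tensormor A A B B (idm A) (idm B) = idm (tensorobj A B).
Proof.
apply: homP => phi; apply: homP => psi /=; congr (phi _).
by apply: homP => x; exact: homP.
Qed.
Fact tensorfunctor_cmp A A' A'' B B' B'' (f' : mor A' A'') (f : mor A A')
    (g' : mor B' B'') (g : mor B B') :
  tensormor (f' ∘ f) (g' ∘ g) = tensormor f' g' ∘ tensormor f g.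
Proof.
apply: homP => phi; apply: homP => psi /=; congr (phi _).
by apply: homP => x; exact: homP.
Qed.

Definition tensorfunctor : bifunctor FLCAb FLCAb FLCAb :=
  Bifunctor tensorfunctor_id tensorfunctor_cmp.
End TensorFunctor.

End FLCAb.

(* Main.v *)
From HB Require Import structures.
From mathcomp Require Import all_boot all_order all_algebra generic_quotient.
From mathcomp Require Import complex.
From mathcomp Require Import all_classical all_reals all_analysis.
From mathcomp Require Import lra zify ring.
Require Import Defs.

(** The tensor product is controlled by its pure tensors. For [a] in [A] and
    [b] in [B], the evaluation [phi |-> phi a b] is an element [pure a b] of
    [A ⊗ B = Hom(A, B^)^]. By Pontryagin duality a character of [A ⊗ B] is
    the evaluation at some [phi] in [Hom(A, B^)], which is read off from pure
    tensors; hence a homomorphism from [A ⊗ B] to a locally compact group is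
    determined by its values there ([pure_ext]). Conversely every continuous
    [psi : A -> Hom(B, C)] comes from a homomorphism on [A ⊗ B]: dualize
    [chi |-> chi \o psi], from [C^] to [Hom(A, B^)], and identify [C] with
    [C^^] ([tlift_ex]). This is the adjunction between tensor product and Hom;
    it also provides the symmetry, the associator and the unit isomorphisms,
    and every coherence diagram is checked on pure tensors. The unit is
    [Hom(T, T)] for the circle [T], that is, the integers.

    Two facts carry this argument: Pontryagin duality for all locally compact
    abelian groups, and the stability of finite ranks under [Hom].

    Duality rests on an invariant mean instead of Haar measure: an ultralimit
    of averages over boxes, which exists on every abelian group ([mean_ex]),
    is positive on compact groups ([mean_nbhs_gt0]) and commutes with itself on
    continuous kernels ([fubini]). With it, convolution by an even function on
    a compact group has an eigenvector, its eigenspaces are finite-dimensional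
    and contain characters, and a suitable kernel shows that characters
    separate points ([peter_weyl]). The mean also proves Kronecker's theorem:
    an abstract homomorphism on the characters of a compact group is evaluation
    at a point ([kronecker]). Finally it shows that a compactly generated group
    either is compact modulo a given subgroup or has a real homomorphism that
    kills the subgroup ([cocompact_or_real_hom]). So every locally compact
    group [A] has an open subgroup [G] and a lattice [N] in [G] with [G / N]
    compact and with coordinates given by real homomorphisms on [A]
    ([lattice_LCA]). Duality is then proved on the three layers: the discrete
    [A / G], the compact [G / N] and the lattice
    ([lattice_enough_chars], [lattice_alpha_open], [lattice_alpha_surj]).

    For the stability under [Hom], finite dimension of [Hom(A, R)] means that
    finitely many points of [A] detect real homomorphisms, and it implies that
    [A] is torsion modulo a compactly generated open subgroup
    ([torsion_mod_ex]); finite dimension of [Hom(R, B)] gives the same for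
    the dual of [B]. Then homomorphisms that send a compact generating set of
    [A] into the polar of one of [B^] form a compact neighbourhood of zero
    ([smallhoms_compact]); the theorem of Ascoli applies because multiplication
    by an integer is open on [A] and proper on [B]. Division of a homomorphism
    by a prime reduces to finitely many conditions, on the torsion of [A] and
    on generators of [A] modulo the prime ([lift_mul]). A real line in
    [Hom(A, B)] is determined by its slopes at finitely many pairs
    ([homfrom_hom_finite]). For a real homomorphism on [Hom(A, B)], those
    killing the rank-one homomorphisms built from the lattices kill every [b]
    that is small along the lattices ([kills_small]), and a recurrence argument
    turns any long enough family into an integral relation modulo such [b]
    ([relations]); hence they have finite rank as well. *)

Set Implicit Arguments.
Unset Strict Implicit.
Unset Printing Implicit Defensive.

Import Order.TTheory GRing.Theory Num.Theory.
Import numFieldNormedType.Exports.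

Local Open Scope classical_set_scope.
Local Open Scope ring_scope.

(** * Topological abelian groups *)

(** Finite subcovers given by a sequence of centres, so that sums over the
    centres make sense. The filter of finite sequences, ordered by inclusion,
    derives this from the near-covering form of compactness. *)
Lemma compact_cover_seq (T : topologicalType) (K : set T) (U : T -> set T) :
  compact K -> (forall x, K x -> nbhs x (U x)) ->
  exists s : seq T, (forall y, y \in s -> K y) /\
    forall x, K x -> exists2 y, y \in s & U y x.
Proof.
move=> /compact_near_coveringP/near_covering_withinP cK KU.
pose F : set_system (seq T) :=
  filter_from [set: seq T] (fun s => [set t : seq T | {subset s <= t}]).
have FF : Filter F.
  apply: filter_from_filter; first by exists [::].
  move=> s t _ _; exists (s ++ t) => // u su; split=> x xs; apply: su;
    by rewrite mem_cat xs ?orbT.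
have [|s _ sP] := cK _ F (fun t x => exists y, [/\ y \in t, K y & U y x]) FF.
  move=> x Kx; exists (U x, [set t : seq T | x \in t]); first split=> /=.
  - exact: KU.
  - by exists [:: x] => // t; apply; rewrite inE.
  by move=> [y t] /= [Uxy xt] Ky; exists x.
exists [seq y <- s | `[< K y >]]; split=> [y|x /(sP s (fun=> id))[y [ys Ky Uyx]]].
  by rewrite mem_filter => /andP[/asboolP].
by exists y => //; rewrite mem_filter ys andbT; apply/asboolP.
Qed.

Lemma ultra_fmap (T U : Type) (f : T -> U) (F : set_system T) :
  UltraFilter F -> UltraFilter (f @ F).
Proof.
move=> FU; split; first exact: fmap_proper_filter.
move=> G PG FG; apply/seteqP; split=> // X GX /=.
have [//|FnX] := in_ultra_setVsetC (f @^-1` X) FU.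
have /FG GnX : (f @ F) (~` X) by [].
by exfalso; apply: (@filter_not_empty _ G); rewrite -(setICr X); exact: filterI.
Qed.

Section ZmodMorphism.
Variables (A B : zmodType) (f : A -> B).
Hypothesis fB : zmod_morphism f.

Lemma zmorph0 : f 0 = 0.
Proof. by rewrite -[X in f X](subrr 0) fB subrr. Qed.

Lemma zmorphN x : f (- x) = - f x.
Proof. by rewrite -[- x]add0r fB zmorph0 sub0r. Qed.

Lemma zmorphD x y : f (x + y) = f x + f y.
Proof. by rewrite -[y in LHS]opprK fB zmorphN opprK. Qed.

Lemma zmorphMn x n : f (x *+ n) = f x *+ n.
Proof. by elim: n => [|n IHn]; [exact: zmorph0|rewrite !mulrS zmorphD IHn]. Qed.

End ZmodMorphism.

Section TopGroup.
Variable A : topologicalZmodType.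
Implicit Types (x y : A) (U V : set A).

Lemma nbhs_shift x y U : nbhs y (fun z => U (x + z)) <-> nbhs (x + y) U.
Proof.
have shift (a b : A) (W : set A) : nbhs (a + b) W -> nbhs b (fun z => W (a + z)).
  move=> Wab; have : {for b, continuous (fun z => a - (- z))}.
    apply: continuousB_at; [exact: cvg_cst | exact: opp_continuous].
  by move/(_ W); rewrite opprK => /(_ Wab); under eq_fun do rewrite opprK.
split=> [h|]; last exact: shift.
have := @shift (- x) (x + y) (fun z => U (x + z)); rewrite addKr => /(_ h).
by under eq_fun do rewrite addNKr.
Qed.

Lemma nbhs_shift0 x U : nbhs 0 (fun z => U (x + z)) <-> nbhs x U.
Proof. by rewrite nbhs_shift addr0. Qed.

Lemma nbhs0N U : nbhs 0 U -> nbhs 0 (fun z => U (- z)).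
Proof. by have := @opp_continuous A 0; move/(_ U); rewrite oppr0. Qed.

Lemma nbhs0_halve U : nbhs 0 U -> exists V, [/\ nbhs 0 V,
  forall x, V x -> V (- x) & forall x y, V x -> V y -> U (x + y)].
Proof.
move=> U0; have : nbhs (0, 0 : A) [set z : A * A | U (z.1 + z.2)].
  by have := @add_continuous A (0, 0); apply; rewrite /= addr0.
case=> -[V W] /= [V0 W0] VW.
pose X := V `&` W; exists (X `&` (fun x => X (- x))); split.
- by apply: filterI; [|apply: nbhs0N]; apply: filterI.
- by move=> x [Xx XNx]; split=> //; rewrite opprK.
by move=> x y [[Vx _] _] [[_ Wy] _]; exact: (VW (x, y)).
Qed.

Lemma nbhs0_sums k U : nbhs 0 U -> exists V, [/\ nbhs 0 V,
  forall x, V x -> V (- x) &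
  forall s : seq A, (size s <= k)%N -> (forall x, x \in s -> V x) ->
    U (\sum_(x <- s) x)].
Proof.
elim: k U => [|k IHk] U U0.
  have [V [V0 VN _]] := nbhs0_halve U0; exists V; split=> // -[|//] _ _.
  by rewrite big_nil; exact: nbhs_singleton.
have [V [V0 VN VU]] := nbhs0_halve U0; have [W [W0 WN WV]] := IHk V V0.
exists (V `&` W); split; first exact: filterI.
  by move=> x [Vx Wx]; split; [exact: VN | exact: WN].
case=> [_ _|x s /= sk sVW]; first by rewrite big_nil; exact: nbhs_singleton.
rewrite big_cons; apply: VU; first by have [] := sVW x (mem_head _ _).
apply: WV => // y ys; by have [] := sVW y; rewrite ?inE ?ys ?orbT.
Qed.

Lemma nbhs0_closed U : nbhs 0 U -> exists V, [/\ nbhs 0 V, closed V & V `<=` U].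
Proof.
move=> /topologicalZmod_regular[V V0 VU]; exists (closure V); split=> //.
  by apply: filterS V0; exact: subset_closure.
exact: closed_closure.
Qed.

Lemma compact_addset (P Q : set A) : compact P -> compact Q ->
  compact [set z.1 + z.2 | z in P `*` Q].
Proof.
move=> cP cQ; apply: continuous_compact; last exact: compact_setX.
by apply: continuous_subspaceT => z; exact: add_continuous.
Qed.

Lemma compact_oppset (P : set A) : compact P -> compact [set - z | z in P].
Proof.
move=> cP; apply: continuous_compact => //.
by apply: continuous_subspaceT => z; exact: opp_continuous.
Qed.

Lemma compact_shiftset x (P : set A) : compact P -> compact [set x + z | z in P].
Proof.
move=> cP; apply: continuous_compact => //; apply: continuous_subspaceT => z.
by move=> W /=; rewrite -nbhs_shift.
Qed.

Lemma subgroup_open_closed (G : zmodClosed A) :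
  nbhs 0 (fun x => x \in G) -> open (fun x => x \in G) /\ closed (fun x => x \in G).
Proof.
move=> G0; split.
  rewrite openE => x xG; rewrite /interior -nbhs_shift0.
  by apply: filterS G0 => z zG; rewrite rpredD.
move=> x /(_ (fun z => z - x \in G)).
have /[swap]/[apply] : nbhs x (fun z => z - x \in G).
  by rewrite -nbhs_shift0; apply: filterS G0 => z zG; rewrite addrAC subrr add0r.
by move=> [z [zG zxG]]; rewrite -(subKr z x) rpredB.
Qed.

Lemma LCA_nbhs : LCA A -> exists C : set A, [/\ nbhs 0 C, compact C, closed C &
  forall x, C x -> C (- x)].
Proof.
case=> hA lA; have [U] := lA 0 I; rewrite withinET => U0 [cU clU].
have cUN : compact (U `|` [set - z | z in U]).
  by apply: compactU => //; exact: compact_oppset.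
exists (U `|` [set - z | z in U]); split=> //.
- by apply: filterS U0 => x; left.
- exact: compact_closed.
by move=> x [Ux|[y Uy <-]]; [right; exists x|left; rewrite opprK].
Qed.

Lemma nbhs_LCA (C : set A) : hausdorff_space A -> nbhs 0 C -> compact C -> LCA A.
Proof.
move=> hA C0 cC; split=> // x _; rewrite withinET.
have cxC := @compact_shiftset x _ cC.
exists [set x + z | z in C]; last by split=> //; exact: compact_closed.
by rewrite -nbhs_shift0; apply: filterS C0 => z Cz; exists z.
Qed.

Lemma LCA_nbhs_in x U : LCA A -> nbhs x U ->
  exists V : set A, [/\ nbhs x V, compact V & V `<=` U].
Proof.
move=> lA; rewrite -nbhs_shift0 => U0; have [C [C0 cC _ _]] := LCA_nbhs lA.
have [V [V0 clV VU]] := nbhs0_closed U0.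
exists [set x + z | z in C `&` V]; split.
- by rewrite -nbhs_shift0; apply: filterS (filterI C0 V0) => z ?; exists z.
- by apply: compact_shiftset; exact: compact_closedI.
by move=> _ [z [_ Vz] <-]; exact: VU.
Qed.

Lemma hausdorff_nbhs0 : (forall x, x != 0 -> exists2 U, nbhs 0 U & ~ U x) ->
  hausdorff_space A.
Proof.
move=> h x y clxy; apply/eqP/negP => /negP; rewrite -subr_eq0 => /h[U U0 nU].
have [V [V0 VN VU]] := nbhs0_halve U0.
have xV : nbhs x (fun z => V (z - x)).
  by rewrite -nbhs_shift0; apply: filterS V0 => z; rewrite addrAC subrr add0r.
have yV : nbhs y (fun z => V (z - y)).
  by rewrite -nbhs_shift0; apply: filterS V0 => z; rewrite addrAC subrr add0r.
have [z [Vzx Vzy]] := clxy _ _ xV yV.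
by apply: nU; rewrite -[x - y](subrKA z); apply: VU => //; rewrite -opprB; apply: VN.
Qed.

Lemma hausdorff_nbhs0P x : hausdorff_space A -> x != 0 ->
  exists2 U, nbhs 0 U & ~ U x.
Proof.
move=> hA x0; have := compact_closed hA (@compact_set1 _ x).
move=> cl; exists (~` [set x]); last by apply.
apply: open_nbhs_nbhs; split; first exact: closed_openC.
by move=> /= e; rewrite e eqxx in x0.
Qed.

End TopGroup.

Lemma additive_continuous (A B : topologicalZmodType) (f : A -> B) :
  zmod_morphism f -> (forall V : set B, nbhs 0 V -> nbhs 0 (f @^-1` V)) -> continuous f.
Proof.
move=> fB f0 x V Vx; have h := f0 _ ((nbhs_shift0 _ _).2 Vx).
have fD := zmorphD fB.
by apply/nbhs_shift0; apply: filterS h => z /=; rewrite fD.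
Qed.

Lemma hom_nbhs (A B : topologicalZmodType) (f : chom A B) x U :
  nbhs (f x) U -> nbhs x (f @^-1` U).
Proof. exact: hom_continuous. Qed.

Lemma hom_nbhs0 (A B : topologicalZmodType) (f : chom A B) U :
  nbhs 0 U -> nbhs 0 (f @^-1` U).
Proof. by move=> U0; apply: hom_nbhs; rewrite raddf0. Qed.

Section HomLemmas.
Variables (A B : topologicalZmodType) (f : chom A B).

Lemma hom0 : f 0 = 0. Proof. exact: zmorph0 (homB f). Qed.
Lemma homN x : f (- x) = - f x. Proof. exact: zmorphN (homB f) x. Qed.
Lemma homD x y : f (x + y) = f x + f y. Proof. exact: zmorphD (homB f) x y. Qed.
Lemma homMn x n : f (x *+ n) = f x *+ n. Proof. exact: zmorphMn (homB f) x n. Qed.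
Lemma homMz x k : f (x *~ k) = f x *~ k. Proof. exact: raddfMz. Qed.

Lemma hom_sum I (s : seq I) (P : pred I) (F : I -> A) :
  f (\sum_(i <- s | P i) F i) = \sum_(i <- s | P i) f (F i).
Proof. exact: raddf_sum. Qed.

End HomLemmas.

Section Sumset.
Variable A : zmodType.
Implicit Types C : set A.

Fixpoint sumset (n : nat) C : set A :=
  if n is m.+1 then [set x | exists y z, [/\ C y, sumset m C z & x = y + z]]
  else [set 0].

Lemma sumsetD m n C x y : sumset m C x -> sumset n C y -> sumset (m + n) C (x + y).
Proof.
elim: m x => [x /= ->|m IHm x [u [v [Cu Cv ->]]]] Sy; first by rewrite add0r.
by exists u, (v + y); split; [|exact: IHm|rewrite addrA].
Qed.

Lemma sumset1 C x : C x -> sumset 1 C x.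
Proof. by move=> Cx; exists x, 0; rewrite addr0. Qed.

Lemma sumset_le m n C x : C 0 -> (m <= n)%N -> sumset m C x -> sumset n C x.
Proof.
move=> C0; elim: n => [|n IHn]; first by case: m.
rewrite leq_eqVlt => /orP[/eqP-> //|mn Sx].
by exists 0, x; rewrite add0r; split=> //; exact: IHn.
Qed.

Lemma sumsetN n C x : (forall y, C y -> C (- y)) -> sumset n C x -> sumset n C (- x).
Proof.
move=> CN; elim: n x => [x /= ->|n IHn x [u [v [Cu Sv ->]]]]; first exact: oppr0.
by exists (- u), (- v); rewrite opprD; split; auto.
Qed.

Lemma sumset_muln n C x k : sumset n C x -> sumset (k * n) C (x *+ k).
Proof.
move=> Sx; elim: k => [|k IHk]; first by rewrite mulr0n.
by rewrite mulrS mulSn; exact: sumsetD.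
Qed.

End Sumset.

Lemma sumset_morph (A B : zmodType) (f : A -> B) n (C : set A) (D : set B) x :
  zmod_morphism f -> (forall y, C y -> D (f y)) ->
  sumset n C x -> sumset n D (f x).
Proof.
move=> fB CD; have fD := zmorphD fB.
elim: n x => [x /= ->|n IHn x [u [v [Cu Sv ->]]]]; first exact: zmorph0.
by exists (f u), (f v); rewrite fD; split; auto.
Qed.

Lemma compact_sumset (A : topologicalZmodType) n (C : set A) :
  compact C -> compact (sumset n C).
Proof.
move=> cC; elim: n => [|n IHn] /=; first exact: compact_set1.
have -> : [set x | exists y z, [/\ C y, sumset n C z & x = y + z]] =
    [set z.1 + z.2 | z in C `*` sumset n C].
  apply/seteqP; split=> [x [y [z [Cy Sz ->]]]|_ [[y z] /= [Cy Sz] <-]].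
    by exists (y, z).
  by exists y, z.
exact: compact_addset.
Qed.

Definition zmc (A : zmodType) (S : {pred A}) (h : zmod_closed S) : zmodClosed A :=
  HB.pack S (GRing.isZmodClosed.Build A S h).

Lemma zmcE (A : zmodType) (S : {pred A}) (h : zmod_closed S) x :
  (x \in zmc h) = (x \in S).
Proof. by []. Qed.

Lemma gen_exists (A : zmodType) (C : set A) :
  C 0 -> (forall y, C y -> C (- y)) ->
  exists G : zmodClosed A, forall x, x \in G <-> exists n, sumset n C x.
Proof.
move=> C0 CN; pose S : {pred A} := fun x => `[< exists n, sumset n C x >].
have h : zmod_closed S.
  split=> [|x y /asboolP[m Sx] /asboolP[n Sy]]; apply/asboolP; first by exists 0%N.
  by exists (m + n)%N; apply: sumsetD => //; exact: sumsetN.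
by exists (zmc h) => x; rewrite zmcE; split=> [/asboolP|?]//; apply/asboolP.
Qed.

Section SubGroup.
Variables (A : topologicalZmodType) (G : zmodClosed A).

Record sgrp := SGrp { sg_val :> A; sg_valP : sg_val \in G }.

HB.instance Definition _ := [isSub for sg_val].
HB.instance Definition _ := [Choice of sgrp by <:].
HB.instance Definition _ := [SubChoice_isSubZmodule of sgrp by <:].
HB.instance Definition _ := Topological.copy sgrp (initial_topology sg_val).

Lemma sg_val_continuous : continuous (sg_val : sgrp -> A).
Proof. exact: initial_continuous. Qed.

Lemma continuous_to_sgrp (X : topologicalType) (h : X -> sgrp) :
  continuous (sg_val \o h) -> continuous h.
Proof. exact: continuous_comp_initial. Qed.

Lemma sg_sub_continuous : continuous (fun z : sgrp * sgrp => z.1 - z.2).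
Proof.
apply: continuous_to_sgrp => -[x y].
apply: (@continuousB_at A _ (fun z : sgrp * sgrp => sg_val z.1)
  (fun z : sgrp * sgrp => sg_val z.2)).
  apply: (@continuous_comp _ _ _ fst sg_val); first exact: cvg_fst.
  exact: sg_val_continuous.
apply: (@continuous_comp _ _ _ snd sg_val); first exact: cvg_snd.
exact: sg_val_continuous.
Qed.

HB.instance Definition _ :=
  PreTopologicalNmodule_isTopologicalZmodule.Build sgrp sg_sub_continuous.

Lemma sg_valB : zmod_morphism sg_val.
Proof. by []. Qed.

Lemma sg_val_inj : injective sg_val.
Proof. exact: val_inj. Qed.

Definition sg_incl : chom sgrp A := mkhom sg_valB sg_val_continuous.

Lemma sg_nbhs (x : sgrp) (U : set sgrp) :
  nbhs x U <-> exists2 V : set A, nbhs (sg_val x) V & forall y : sgrp, V y -> U y.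
Proof.
split; last by case=> V Vx VU; apply: filterS VU _; exact: sg_val_continuous.
rewrite nbhsE => -[W [[V oV <-] Wx] WU].
by exists V => //; exact: open_nbhs_nbhs.
Qed.

Lemma sg_compact (K : set A) : compact K -> (forall x, K x -> x \in G) ->
  compact (sg_val @^-1` K).
Proof.
move=> cK KG; rewrite compact_ultra => F FF FK.
have FA : UltraFilter (sg_val @ F) by exact: ultra_fmap.
move: cK; rewrite compact_ultra => /(_ (sg_val @ F) FA FK)[x [Kx Fx]].
exists (SGrp (KG x Kx)); split=> //= U /sg_nbhs[V Vx VU].
by apply: filterS VU _; exact: Fx.
Qed.

Lemma sg_hausdorff : hausdorff_space A -> hausdorff_space sgrp.
Proof.
move=> hA; apply: hausdorff_nbhs0 => x x0.
have [|U U0 nU] := hausdorff_nbhs0P (x := sg_val x) hA.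
  by apply: contra x0 => /eqP e; apply/eqP; exact: sg_val_inj.
by exists (sg_val @^-1` U) => //; exact: sg_val_continuous.
Qed.

End SubGroup.

Section Quotients.
Variables (A : topologicalZmodType) (I : zmodClosed A).
Local Notation Q := (tquot I).

Definition tpi : chom A Q := mkhom (tquot_piB I) (@tquot_pi_continuous A I).

Lemma tpi_repr q : tpi (repr q) = q.
Proof. exact: reprK. Qed.

Lemma tpi_eqP x y : tpi x = tpi y <-> x - y \in I.
Proof. exact: tquot_eqP. Qed.

Lemma tpi_eq0 x : tpi x = 0 <-> x \in I.
Proof. by rewrite -(raddf0 tpi) tpi_eqP subr0. Qed.

Lemma tpi_surj (q : Q) : exists x, tpi x = q.
Proof. by exists (repr q); exact: tpi_repr. Qed.

Lemma tpi_nbhs x U : nbhs x U -> nbhs (tpi x) [set tpi y | y in U].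
Proof. exact: tquot_pi_nbhs. Qed.

#[global] Opaque tpi.

Lemma tpi_factor_continuous (X : topologicalType) (f : Q -> X) :
  continuous (f \o tpi) -> continuous f.
Proof.
move=> fC q V; have [x <-] := tpi_surj q => /(fC x)/tpi_nbhs h.
by apply: filterS h => _ [y Vy <-].
Qed.

Lemma tquot_hausdorff : closed (fun x => x \in I) -> hausdorff_space Q.
Proof.
move=> cI; apply: hausdorff_nbhs0 => q; have [x <-] := tpi_surj q => x0.
have xI : ~ x \in I by move=> /tpi_eq0 e; rewrite e eqxx in x0.
have : nbhs x (~` (fun x => x \in I)).
  by apply: open_nbhs_nbhs; split=> //; exact: closed_openC.
rewrite -nbhs_shift0 => /nbhs0N/tpi_nbhs; rewrite raddf0 => h.
exists [set tpi y | y in (fun z => ~ (x - z \in I))] => //.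
by move=> [y yI /tpi_eqP]; rewrite -opprB rpredN.
Qed.

Lemma tquot_lift (B : topologicalZmodType) (f : chom A B) :
  (forall x, x \in I -> f x = 0) -> exists g : chom Q B, forall x, g (tpi x) = f x.
Proof.
move=> f0; pose g (q : Q) := f (repr q).
have gE x : g (tpi x) = f x.
  apply/eqP; rewrite -subr_eq0 -raddfB; apply/eqP/f0/tpi_eqP.
  exact: tpi_repr.
have gB : zmod_morphism g.
  move=> p q; have [x <-] := tpi_surj p; have [y <-] := tpi_surj q.
  by rewrite -raddfB !gE raddfB.
have gC : continuous g.
  apply: tpi_factor_continuous => x /=.
  rewrite (_ : g \o _ = f); first exact: hom_continuous.
  by apply/funext => y; exact: gE.
by exists (mkhom gB gC) => x; exact: gE.
Qed.

End Quotients.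

Definition divisible (D : zmodType) :=
  forall (x : D) n, exists y, y *+ n.+1 = x.

Lemma pairMn (M D : zmodType) (a : M) (b : D) n : (a, b) *+ n = (a *+ n, b *+ n).
Proof. by elim: n => [//|n IHn]; rewrite !mulrS IHn. Qed.

(** Divisible groups are injective. A maximal graph of a partial additive map
    that extends [f], in the sense of Zorn, is the graph of a total one. *)
Lemma extend_hom (M D : zmodType) (G : zmodClosed M) (f : M -> D) :
  divisible D -> (forall x y, x \in G -> y \in G -> f (x - y) = f x - f y) ->
  exists g : M -> D, zmod_morphism g /\ forall x, x \in G -> g x = f x.
Proof.
move=> dD fB.
pose P (S : set (M * D)) := (forall u v, S u -> S v -> S (u - v)) /\
  (forall d, S (0, d) -> d = 0).
pose Gf : set (M * D) := [set u | u.1 \in G /\ u.2 = f u.1].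
have f0 : f 0 = 0 by rewrite -[X in f X](subrr 0) fB ?rpred0// subrr.
have PGf : P Gf.
  split=> [u v [uG uE] [vG vE]|d [_ /= ->]//].
  by split; rewrite /= ?rpredB// uE vE fB.
have [S [[PS P0] [GS Smax]]] : exists S, P S /\ Gf `<=` S /\ forall T, S `<` T -> ~ P T.
  have [|S [[PS0 SG] Smax]] := @Zorn_bigcup _ [set S | P (Gf `|` S)].
    move=> F FP tF; split=> [u v|d].
      have sub X w : F X -> X w -> (Gf `|` \bigcup_(X in F) X) w.
        by move=> FX Xw; right; exists X.
      have case2 X u' v' : F X -> (Gf `|` X) u' -> (Gf `|` X) v' ->
          (Gf `|` \bigcup_(X in F) X) (u' - v').
        move=> FX Xu Xv; have [PX _] := FP X FX.
        by have [?|?] := PX u' v' Xu Xv; [left | exact: sub FX _].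
      move=> [Gu|[X FX Xu]] [Gv|[Y FY Yv]].
      - by left; exact: PGf.1.
      - by apply: (case2 Y) => //; [left|right].
      - by apply: (case2 X) => //; [right|left].
      have [XY|YX] := tF X Y FX FY.
        by apply: (case2 Y) => //; right => //; exact: XY.
      by apply: (case2 X) => //; right => //; exact: YX.
    move=> [?|[X FX Xd]]; first exact: PGf.2.
    by have [_] := FP X FX; apply; right.
  exists (Gf `|` S); split=> //; split; first by move=> u; left.
  move=> T [ST TS] PT; apply: (Smax T).
    split; first by move=> u Su; apply: ST; right.
    by move=> TS'; apply: TS => u /TS'; right.
  rewrite /= (_ : Gf `|` T = T)//; apply/seteqP; split=> [u [?|//]|u]; last by right.
  by apply: ST; left.
have S0 : S (0, 0) by apply: GS; split=> //=; rewrite rpred0.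
have SN u : S u -> S (- u) by move=> Su; rewrite -sub0r; apply: PS.
have SD u v : S u -> S v -> S (u + v).
  by move=> Su Sv; rewrite -[v]opprK; apply: PS => //; exact: SN.
have SM u n : S u -> S (u *+ n).
  by move=> Su; elim: n => [//|n IHn]; rewrite mulrS; exact: SD.
have tot x : exists d, S (x, d).
  case: (pselect (exists d, S (x, d))) => // nx; exfalso.
  (* If a positive multiple of [x] lies in the domain, let [x *+ n.+1] be the
     least one and divide its image by [n.+1]: any other multiple in the
     domain is a multiple of it, by division with remainder. Otherwise any
     value is compatible. *)
  have [c cP] : exists c, forall n d, S (x *+ n, d) -> d = c *+ n.
    case: (pselect (exists n d, S (x *+ n.+1, d))) => [ex|nex].
      have exb : exists n, `[< exists d, S (x *+ n.+1, d) >].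
        by case: ex => n h; exists n; apply/asboolP.
      pose n := ex_minn exb.
      have [d Sd] : exists d, S (x *+ n.+1, d).
        by rewrite /n; case: ex_minnP => m /asboolP.
      have nmin m : (exists d, S (x *+ m.+1, d)) -> (n <= m)%N.
        by rewrite /n; case: ex_minnP => k _ h hm; apply: h; apply/asboolP.
      have [c cE] := dD d n; exists c => m e Se.
      have Sr : S (x *+ (m %% n.+1), e - d *+ (m %/ n.+1)).
        rewrite (_ : (_, _) = (x *+ m, e) - (x *+ n.+1, d) *+ (m %/ n.+1)); last first.
          rewrite pairMn; congr (_, _) => /=.
          rewrite [X in _ = _ *+ X - _](divn_eq m n.+1).
          by rewrite mulrnDr [(_ %/ _ * _)%N]mulnC mulrnA addrC addKr.
        by apply: PS => //; exact: SM.
      case rE : (m %% n.+1)%N Sr => [|r] Sr.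
        have /eqP := P0 _ Sr; rewrite subr_eq0 => /eqP->.
        by rewrite -cE -mulrnA {2}(divn_eq m n.+1) rE addn0 mulnC.
      have /nmin : exists d, S (x *+ r.+1, d) by eexists; exact: Sr.
      by rewrite leqNgt -[(r < n)%N]/(r.+1 <= n)%N -rE -ltnS ltn_pmod.
    exists 0 => -[|n] d Sd; first by rewrite (P0 d Sd) mulr0n.
    by exfalso; apply: nex; exists n, d.
  have cPz k d : S (x *~ k, d) -> d = c *~ k.
    case: k => n; first exact: cP.
    rewrite !NegzE !mulrNz => /SN; rewrite [- _](_ : _ = (x *+ n.+1, - d)); last first.
      by congr (_, _); rewrite /= opprK.
    by move/cP => e; rewrite -[d]opprK e.
  (* The graph extended by [x |-> c] contradicts maximality. *)
  pose T : set (M * D) := [set u | exists v k, S v /\ u = v + (x *~ k, c *~ k)].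
  apply: (Smax T).
    split=> [u Su|TS]; first by exists u, 0; rewrite !mulr0z addr0.
    apply: nx; exists c; apply: TS; exists 0, 1.
    by split=> //; rewrite add0r.
  split=> [_ _ [u [k [Su ->]]] [v [l [Sv ->]]]|d [v [k [Sv]]]].
    exists (u - v), (k - l); split; first exact: PS.
    rewrite opprD addrACA; congr (_ + _); rewrite !mulrzBr; congr (_, _).
  case: v Sv => v e Sv [vE dE].
  have ve : v = - (x *~ k) by apply/eqP; rewrite -addr_eq0 -vE.
  have := SN _ Sv; rewrite ve [- _](_ : _ = (x *~ k, - e)); last first.
    by congr (_, _); rewrite /= opprK.
  by move=> /cPz eE; rewrite dE /= -eE addrN.
have [g gP] := choice tot.
have uniq x d e : S (x, d) -> S (x, e) -> d = e.
  move=> Sd Se; apply/eqP; rewrite -subr_eq0; apply/eqP/P0.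
  have := PS _ _ Sd Se; rewrite (_ : _ - _ = (0, d - e))//.
  by congr (_, _); rewrite /= subrr.
exists g; split=> [x y|x xG]; last by apply: (uniq x) => //; apply: GS.
by apply: (uniq (x - y)) => //; exact: (PS _ _ (gP x) (gP y)).
Qed.

(** * The real line and the circle *)

Section RealTools.
Variable R : realType.

Lemma nbhs0_normP (U : set R) : nbhs 0 U <-> exists2 e : R, 0 < e &
  forall r, `|r| < e -> U r.
Proof.
split=> [/nbhs_norm0P[e e0 eU]|[e e0 eU]]; first by exists e.
apply/nbhs_ballP; exists e => // r; rewrite /ball/= sub0r normrN; exact: eU.
Qed.

Lemma nbhs0_norm_lt (e : R) : 0 < e -> nbhs (0 : R) (fun r => `|r| < e).
Proof. by move=> e0; apply/nbhs0_normP; exists e. Qed.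

Lemma natmul_large (M e : R) : 0 < e -> exists n : nat, (0 < n)%N /\ M < n%:R * e.
Proof.
move=> e0; exists (Num.Def.archi_bound (M / e)).+1; split=> //.
rewrite -ltr_pdivrMr//; apply: lt_trans (unstable.ltr_bound (M / e)) _.
by rewrite ltr_nat.
Qed.

(** A bound [M] for [h] at [x *+ n] is a bound [M / n] at [x], so a bound near
    zero is enough. *)
Lemma real_hom_continuous (A : topologicalZmodType) (h : A -> R) (M : R) :
  zmod_morphism h -> nbhs 0 (fun x => `|h x| <= M) -> continuous h.
Proof.
move=> hB hM; apply: additive_continuous => // V /nbhs0_normP[e e0 eV].
have [n [n0 nM]] := natmul_large M e0.
have : nbhs (0 : A) (fun x => `|h (x *+ n)| <= M).
  have := @mulrn_continuous A n 0.
  by move/(_ (fun x => `|h x| <= M)); rewrite /= mul0rn; apply.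
apply: filterS => x; rewrite (zmorphMn hB) normrMn => hx; apply: eV.
rewrite -(ltr_pM2l (x := n%:R)) ?ltr0n//; apply: le_lt_trans nM.
by rewrite mulr_natl.
Qed.

Lemma bounded_multiples0 (r M : R) : (forall n : nat, `|r *+ n| <= M) -> r = 0.
Proof.
move=> h; apply/eqP; rewrite -normr_eq0 eq_le normr_ge0 andbT leNgt; apply/negP => r0.
have [n [_ nM]] := natmul_large M r0.
by have := h n; rewrite normrMn -mulr_natl leNgt nM.
Qed.

Lemma divisibleR : divisible R.
Proof. by move=> x n; exists (x / n.+1%:R); rewrite -[LHS]mulr_natr divfK// pnatr_eq0. Qed.

Lemma dense_subgroupR (S : set R) : closed S -> (forall x y, S x -> S y -> S (x - y)) ->
  S 0 -> (forall e, 0 < e -> exists2 x, S x & 0 < x < e) -> forall x, S x.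
Proof.
move=> cS SB S0 Sd x; apply: cS => U; rewrite -nbhs_shift0 => /nbhs0_normP[e e0 eU].
have SN y : S y -> S (- y) by move=> Sy; rewrite -sub0r; apply: SB.
have SM y n : S y -> S (y *+ n).
  move=> Sy; elim: n => // n IHn; rewrite mulrS -[y *+ n]opprK; apply: SB => //.
  exact: SN.
have SZ y k : S y -> S (y *~ k).
  by case: k => n Sy; [exact: SM|rewrite NegzE mulrNz; apply/SN/SM].
have [d Sdd /andP[d0 de]] := Sd e e0.
exists (d *~ Num.floor (x / d)); split; first exact: SZ.
rewrite -[_ *~ _](subrK x) addrC; apply: eU.
have /andP[h1 h2] := floor_itv (x / d); rewrite -mulrzl.
rewrite ler_pdivlMr// in h1; rewrite ltr_pdivrMr// intrD mulrDl mul1r in h2.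
by rewrite ltr_norml; apply/andP; split; lra.
Qed.

End RealTools.

Definition scalehom (R : realType) (r : R) : chom R R :=
  mkhom (homto_scaleB r (idhom R)) (@homto_scale_continuous R R r (idhom R)).

Section Circle.
Variable R : realType.
Local Notation T := (circle R).

Definition cpi : chom R T := tpi (@Zreal R).

Lemma cpi_eq0 r : cpi r = 0 <-> r \is a Num.int.
Proof. exact: tpi_eq0. Qed.

Lemma cpi_small r : `|r| < 1 -> cpi r = 0 -> r = 0.
Proof.
move=> r1 /cpi_eq0 ri; apply/eqP/negPn/negP => /(norm_intr_ge1 ri).
by rewrite leNgt r1.
Qed.

Lemma cpi_surj (x : T) : exists2 r, `|r| <= 2^-1 & cpi r = x.
Proof.
have [s <-] := tpi_surj x; pose n : int := Num.floor (s + 2^-1); exists (s - n%:~R).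
  have /andP[h1 h2] := floor_itv (s + 2^-1); rewrite -/n in h1 h2.
  by rewrite intrD in h2; rewrite ler_norml; apply/andP; split; lra.
apply/eqP; rewrite -subr_eq0 -raddfB; apply/eqP/cpi_eq0.
by rewrite addrAC subrr add0r rpredN intr_int.
Qed.

(** The image of the interval from [- e] to [e]: a closed arc, and the whole
    circle as soon as [e] is at least 1/2. *)
Definition cball (e : R) : set T := [set cpi r | r in [set r | `|r| <= e]].

Lemma cball_le d e x : d <= e -> cball d x -> cball e x.
Proof. by move=> de [r rd <-]; exists r => //=; exact: le_trans de. Qed.

Lemma cball_cpi e r : `|r| <= e -> cball e (cpi r).
Proof. by move=> re; exists r. Qed.

Lemma cball0 e : 0 <= e -> cball e 0.
Proof. by move=> e0; exists 0; rewrite /= ?normr0// raddf0. Qed.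

Lemma cballN e x : cball e x -> cball e (- x).
Proof. by move=> [r re <-]; exists (- r); rewrite /= ?normrN// raddfN. Qed.

Lemma cballD d e x y : cball d x -> cball e y -> cball (d + e) (x + y).
Proof.
move=> [r rd <-] [s se <-]; exists (r + s); last by rewrite raddfD.
exact: le_trans (ler_normD _ _) (lerD rd se).
Qed.

Lemma cball_half x : cball 2^-1 x.
Proof. by have [r rh <-] := cpi_surj x; exists r. Qed.

Lemma cball_sumset e n x : sumset n (cball e) x -> cball (n%:R * e) x.
Proof.
elim: n x => [x ->|n IHn x [y [z [ye zs ->]]]]; first by apply: cball0; rewrite mul0r.
by rewrite -addn1 natrD mulrDl mul1r addrC; apply: cballD => //; exact: IHn.
Qed.

Lemma cball_compact e : compact (cball e).
Proof.
rewrite /cball (_ : [set r | _] = `[- e, e]%classic); last first.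
  by apply/seteqP; split=> r /=; rewrite in_itv/= ler_norml.
apply: continuous_compact; last exact: segment_compact.
by apply: continuous_subspaceT; exact: hom_continuous.
Qed.

Lemma circle_compact : compact [set: T].
Proof.
rewrite (_ : [set: T] = cball 2^-1); first exact: cball_compact.
by apply/seteqP; split=> // x _; exact: cball_half.
Qed.

Lemma cball_nbhs e : 0 < e -> nbhs 0 (cball e).
Proof.
move=> e0; rewrite -(raddf0 cpi).
have := @tpi_nbhs _ (@Zreal R) _ _ (nbhs0_norm_lt e0); apply: filterS => _ [r re <-].
by exists r => //; exact: ltW.
Qed.

Lemma cball_basis U : nbhs (0 : T) U -> exists2 e : R, 0 < e & cball e `<=` U.
Proof.
move=> U0; have : nbhs (0 : R) (cpi @^-1` U) by exact: hom_nbhs0.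
move=> /nbhs0_normP[e e0 eU]; exists (e / 2); first by rewrite divr_gt0.
by move=> _ [r re <-]; apply: eU; rewrite /= in re; lra.
Qed.

#[global] Opaque cpi.

Lemma cpi_cball_lift e r : cball e (cpi r) -> e + `|r| < 1 -> `|r| <= e.
Proof.
move=> [s /= se sr] er1; suff -> : r = s by [].
apply/eqP; rewrite -subr_eq0; apply/eqP/cpi_small; last by rewrite raddfB /= sr subrr.
by have := ler_normB r s; lra.
Qed.

Lemma circle_hausdorff : hausdorff_space T.
Proof.
apply: hausdorff_nbhs0 => x x0; have [r rh rx] := cpi_surj x.
have r0 : 0 < `|r| by rewrite normr_gt0; apply: contra_neq x0 => r0; rewrite -rx r0 raddf0.
exists (cball (`|r| / 2)); first by apply: cball_nbhs; lra.
by rewrite -rx => /cpi_cball_lift h; have := h ltac:(lra); lra.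
Qed.

Lemma circle_LCA : LCA T.
Proof.
by apply: (nbhs_LCA circle_hausdorff _ circle_compact); exact: filterT.
Qed.

Lemma cball_closed e : closed (cball e).
Proof. by apply: compact_closed; [exact: circle_hausdorff|exact: cball_compact]. Qed.

(** An element whose first [M] multiples stay within 1/4 of zero has not
    wrapped around the circle, so its small real representative is really
    divided by [M]. This is the source of all equicontinuity statements for
    characters. *)
Lemma cball_multiples (M : nat) x :
  (forall j, (0 < j <= M)%N -> cball 4^-1 (x *+ j)) -> (0 < M)%N ->
  cball (4^-1 / M%:R) x.
Proof.
move=> h M0; have [r /= r4 rx] := h 1%N M0; rewrite mulr1n in rx.
exists r => //=; suff : `|r *+ M| <= 4^-1.
  by rewrite normrMn -[_ *+ M]mulr_natr ler_pdivlMr// ltr0n.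
move: h; elim: M M0 => [//|[|M] IHM] _ h; first by rewrite mulr1n.
have rM : `|r *+ M.+1| <= 4^-1.
  by apply: IHM => // j /andP[j0 jM]; apply: h; rewrite j0 (leq_trans jM).
apply: cpi_cball_lift; first by rewrite raddfMn /= rx; apply: h; rewrite /= leqnn.
have := ler_normD r (r *+ M.+1); rewrite -mulrS.
by move: `|r *+ M.+2| `|r *+ M.+1| rM => a b; lra.
Qed.

Lemma cball_subgroup x : (forall j, cball 4^-1 (x *+ j)) -> x = 0.
Proof.
move=> h; apply/eqP/negP => /negP x0.
have [U U0 nU] := hausdorff_nbhs0P circle_hausdorff x0.
have [e e0 eU] := cball_basis U0; apply/nU/eU.
have [n [n0 ne]] := natmul_large 4^-1 e0.
apply: cball_le (cball_multiples (fun j _ => h j) n0).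
by rewrite ler_pdivrMr ?ltr0n// mulrC ltW.
Qed.

Lemma divisible_circle : divisible T.
Proof.
move=> x n; have [r _ <-] := cpi_surj x; have [s <-] := divisibleR r n.
by exists (cpi s); rewrite raddfMn.
Qed.

(** As for real homomorphisms, one ball is enough, by [cball_multiples]. *)
Lemma hom_circle_continuous (A : topologicalZmodType) (h : A -> T) :
  zmod_morphism h -> nbhs 0 (fun x => cball 4^-1 (h x)) -> continuous h.
Proof.
move=> hB hM; apply: additive_continuous => // V /cball_basis[e e0 eV].
have [n [n0 nM]] := natmul_large 4^-1 e0.
have [W [W0 WN WM]] := nbhs0_sums n hM.
apply: filterS W0 => x Wx; apply: eV.
apply: cball_le (@cball_multiples n _ _ n0).
  by rewrite ler_pdivrMr ?ltr0n// mulrC ltW.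
move=> j /andP[j0 jn]; rewrite -(zmorphMn hB).
have -> : x *+ j = \sum_(y <- nseq j x) y.
  by elim: {jn j0} j => [|j IHj]; rewrite ?big_nil//= big_cons mulrS IHj.
by apply: WM => [|y]; rewrite ?size_nseq// mem_nseq => /andP[_ /eqP->].
Qed.

(** Choose [s] such that the character is small between [- s] and [s], and let
    [r * s] be the small representative of its value at [s]. The difference
    with [t |-> r * t] vanishes at every [s / 2 ^ n], since halving has only
    one small solution, and these points generate a dense subgroup. *)
Lemma char_real (phi : chom R T) : exists r, forall t, phi t = cpi (r * t).
Proof.
have : nbhs (0 : R) (phi @^-1` cball 8^-1).
  by apply: hom_nbhs0; exact: cball_nbhs.
move=> /nbhs0_normP[e e0 eP]; pose s := e / 2.
have s0 : 0 < s by rewrite /s; lra.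
have [r0 r08 r0E] : cball 8^-1 (phi s) by apply: eP; rewrite gtr0_norm /s; lra.
pose r := r0 / s; exists r => t; rewrite /= in r08.
have [psi psiE] : exists psi : chom R T, forall x, psi x = phi x - cpi (r * x).
  by exists (phi - hommap (scalehom r) (idhom T) cpi).
suff : psi t = 0 by rewrite psiE => /eqP; rewrite subr_eq0 => /eqP.
have psis n : psi (s / (2 ^ n)%:R) = 0.
  elim: n => [|n IHn].
    by rewrite expn0 divr1 psiE -r0E /r mulfVK ?gt_eqF// subrr.
  set u := s / _; have u0 : 0 < u by rewrite divr_gt0// ltr0n expn_gt0.
  have us : u <= s by rewrite ler_pdivrMr ?ltr0n ?expn_gt0// ler_peMr ?(ltW s0)// -[1]/(1%:R) ler_nat expn_gt0.
  have u2 : u *+ 2 = s / (2 ^ n)%:R.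
    by rewrite /u expnS natrM; field; rewrite pnatr_eq0 expn_eq0.
  have : cball (4^-1) (psi u).
    rewrite (_ : 4^-1 = 8^-1 + 8^-1 :> R); last by lra.
    rewrite psiE; apply: cballD; first by apply: eP; rewrite gtr0_norm //; move: us; rewrite /s; lra.
    apply/cballN/cball_cpi; apply: le_trans r08; rewrite /r normrM normrM normfV (gtr0_norm u0) (gtr0_norm s0).
    by rewrite -mulrA ler_piMr// mulrC ler_pdivrMr// mul1r.
  move=> [v v4 vE]; rewrite -vE /= in v4 *.
  have : cpi (v *+ 2) = 0 by rewrite raddfMn /= vE -raddfMn u2.
  move=> /cpi_small h; suff -> : v = 0 by rewrite raddf0.
  by have : v *+ 2 = 0 by [apply: h; rewrite normrMn; lra]; lra.
have cS : closed [set x | psi x = 0].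
  rewrite (_ : [set x | _] = psi @^-1` [set 0])//; apply: closed_comp.
    by move=> *; exact: hom_continuous.
  apply: compact_closed; [exact: circle_hausdorff|exact: compact_set1].
apply: (dense_subgroupR cS) => [x y /= x0 y0||e' e'0].
- by rewrite homB x0 y0 subrr.
- by rewrite /= raddf0.
have [n [n0 ne]] := natmul_large s e'0.
exists (s / (2 ^ n)%:R); first exact: psis.
rewrite divr_gt0 ?ltr0n ?expn_gt0//= ltr_pdivrMr ?ltr0n ?expn_gt0//.
apply: lt_le_trans ne _; rewrite mulrC ler_pM2l// ler_nat; exact/ltnW/ltn_expl.
Qed.

End Circle.

(** * Invariant means *)

Section UltraLimit.
Variables (R : realType) (I : Type) (w : set_system I).
Hypothesis uw : UltraFilter w.
Implicit Types u v : I -> R.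

Definition ulim u : R := lim (u @ w).

Definition bounded (X : Type) (f : X -> R) := exists M : R, forall x, `|f x| <= M.

Lemma ulim_cvg u : bounded u -> u @ w --> ulim u.
Proof.
move=> [M uM]; have := @segment_compact R (- M) M; rewrite compact_ultra.
have /[swap]/[apply] := ultra_fmap u uw.
have /[swap]/[apply] : (u @ w) `[- M, M]%classic.
  change (w (fun i => u i \in `[- M, M])); apply: filterE => i.
  by rewrite in_itv/= -ler_norml; exact: uM.
by case=> l [_ ul]; apply/cvg_ex; exists l.
Qed.

Lemma ulim_eq u l : u @ w --> l -> ulim u = l.
Proof. by move=> ul; apply: (cvg_lim _ ul); exact: Rhausdorff. Qed.

Lemma ulim_cst c : ulim (fun=> c) = c.
Proof. by apply: ulim_eq; exact: cvg_cst. Qed.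

Lemma ulimD u v : bounded u -> bounded v ->
  ulim (fun i => u i + v i) = ulim u + ulim v.
Proof. by move=> bu bv; apply: ulim_eq; apply: cvgD; exact: ulim_cvg. Qed.

Lemma ulimZ a u : bounded u -> ulim (fun i => a * u i) = a * ulim u.
Proof. by move=> bu; apply: ulim_eq; apply: cvgM; [exact: cvg_cst|exact: ulim_cvg]. Qed.

Lemma ulim_near u (e : R) : bounded u -> 0 < e -> w (fun i => `|ulim u - u i| < e).
Proof. by move=> /ulim_cvg/cvgrPdist_lt; apply. Qed.

Lemma ulim_dist u l : (forall e : R, 0 < e -> w (fun i => `|l - u i| < e)) -> ulim u = l.
Proof. by move=> h; apply: ulim_eq; apply/cvgrPdist_lt. Qed.

Lemma ulim_le u v : bounded u -> bounded v -> w (fun i => u i <= v i) ->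
  ulim u <= ulim v.
Proof.
move=> bu bv uv; rewrite leNgt; apply/negP => lt.
pose e := (ulim u - ulim v) / 2; have e0 : 0 < e by rewrite /e; lra.
have [i [[h1 h2] h3]] := filter_ex (filterI (filterI (ulim_near bu e0) (ulim_near bv e0)) uv).
by move: h1 h2; rewrite /e !ltr_norml => /andP[_ h1] /andP[h2 _]; lra.
Qed.

End UltraLimit.

Lemma ultra_ex (I : Type) (J : Type) (D : set J) (B : J -> set I) :
  ProperFilter (filter_from D B) ->
  exists w : set_system I, UltraFilter w /\ forall j, D j -> w (B j).
Proof.
move=> /ultraFilterLemma[w [uw Fw]]; exists w; split=> // j Dj.
by apply: Fw; exists j.
Qed.

Section Mean.
Variables (R : realType) (G : zmodType).
Implicit Types (f g : G -> R) (s : seq G).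

Definition avg s f : R := (\sum_(y <- s) f y) / (size s)%:R.

(** All combinations of the elements of [s] with coefficients below [N], with
    repetitions. Under a shift by an element of [s] sums over a box telescope,
    which leaves only a fraction [1 / N] of the terms. *)
Fixpoint box s (N : nat) : seq G :=
  if s is x :: t then [seq z + x *+ j | j <- iota 0 N, z <- box t N] else [:: 0].

Lemma size_box s N : size (box s N) = (N ^ size s)%N.
Proof. by elim: s => //= x s IHs; rewrite size_allpairs size_iota IHs expnS. Qed.

Lemma box_shift s N x f (M : R) c : x \in s -> (forall y, `|f y| <= M) ->
  `|\sum_(y <- box s N) (f (y + x + c) - f (y + c))| * N%:R <= 2 * M * (size (box s N))%:R.
Proof.
move=> + fM; elim: s c => //= t s IHs c; rewrite inE => /predU1P[->|xs].
  rewrite size_allpairs size_iota natrM.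
  rewrite big_allpairs_dep exchange_big/=.
  have h z : `|\sum_(j <- iota 0 N) (f (z + t *+ j + t + c) - f (z + t *+ j + c))| <= 2 * M.
    have -> : \sum_(j <- iota 0 N) (f (z + t *+ j + t + c) - f (z + t *+ j + c)) =
        f (z + t *+ N + c) - f (z + t *+ 0 + c).
      rewrite -[N in LHS]subn0 -/(index_iota 0 N).
      rewrite -(telescope_sumr (fun j => f (z + t *+ j + c)) (leq0n N)).
      by apply: eq_bigr => j _; rewrite mulrSr addrA.
    by apply: le_trans (ler_normB _ _) _; rewrite mulr_natl mulr2n lerD.
  rewrite mulrCA mulrC ler_wpM2l//; apply: le_trans (ler_norm_sum _ _ _) _.
  apply: le_trans (ler_sum _ (fun z _ => h z)) _.
  by rewrite big_const_seq count_predT iter_addr_0 mulr_natr.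
rewrite size_allpairs size_iota natrM big_allpairs_dep/=.
apply: (@le_trans _ _ ((\sum_(j <- iota 0 N) `|\sum_(z <- box s N)
    (f (z + x + (t *+ j + c)) - f (z + (t *+ j + c)))|) * N%:R)).
  rewrite ler_wpM2r//; apply: le_trans (ler_norm_sum _ _ _) _.
  apply: ler_sum => j _; rewrite le_eqVlt; apply/orP; left; apply/eqP; congr Num.norm.
  by apply: eq_bigr => z _; rewrite [z + _ + x]addrAC -!addrA.
rewrite mulr_suml; apply: le_trans (ler_sum _ (fun j _ => IHs _ xs)) _.
by rewrite big_const_seq count_predT iter_addr_0 size_iota -[_ *+ N]mulr_natl mulrCA.
Qed.

(** Abelian groups are amenable. Averages over a box are almost invariant
    under the elements that span it, and an ultrafilter that contains all
    large boxes makes the limit invariant. *)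
Lemma mean_ex : exists (I : Type) (w : set_system I) (s : I -> seq G),
  [/\ UltraFilter w, forall i, (0 < size (s i))%N &
  forall f a, bounded f ->
    ulim w (fun i => avg (s i) (fun y => f (y + a) - f y)) = 0].
Proof.
pose B (j : nat * seq G) : set (nat * seq G) := [set i : nat * seq G | (j.1 <= i.1)%N /\ {subset j.2 <= i.2}].
have [w [uw wB]] : exists w, UltraFilter w /\ forall j, setT j -> w (B j).
  apply: ultra_ex; apply: filter_from_proper; last first.
    by move=> j _; exists j; split.
  apply: filter_from_filter; first by exists (0%N, [::]).
  move=> [k s] [l t] _ _; exists (maxn k l, s ++ t) => // -[N u] [/= kN su].
  rewrite geq_max in kN; case/andP: kN => kN lN.
  by split; split=> //= x xs; apply: su; rewrite mem_cat xs ?orbT.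
exists (nat * seq G)%type, w, (fun i => box i.2 i.1.+1); split=> //.
  by move=> i; rewrite size_box expn_gt0.
move=> f a [M fM]; apply: ulim_dist => e e0.
have [n [n0 nM]] := natmul_large (2 * M) e0.
apply: filterS (wB (n, [:: a]) I) => -[N s] [/= nN /(_ a (mem_head _ _)) as_].
rewrite sub0r normrN /avg normrM normfV normr_nat.
have := @box_shift s N.+1 a f M 0 as_ fM.
under eq_bigr do rewrite !addr0; move=> h.
have sz : 0 < (size (box s N.+1))%:R :> R by rewrite ltr0n size_box expn_gt0.
rewrite ltr_pdivrMr//; rewrite -(ltr_pM2r (x := N.+1%:R))//.
apply: le_lt_trans h _; rewrite [X in _ < X]mulrAC ltr_pM2r// [e * _]mulrC.
by apply: lt_le_trans nM _; rewrite ler_pM2r// ler_nat ltnW.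
Qed.

Lemma avg_bounded s f M : (0 < size s)%N -> (forall x, `|f x| <= M) -> `|avg s f| <= M.
Proof.
move=> s0 fM; rewrite /avg normrM normfV normr_nat ler_pdivrMr ?ltr0n//.
apply: le_trans (ler_norm_sum _ _ _) _; apply: le_trans (ler_sum _ (fun x _ => fM x)) _.
by rewrite big_const_seq count_predT iter_addr_0 mulr_natr.
Qed.

Lemma avgD s f g : avg s (fun x => f x + g x) = avg s f + avg s g.
Proof. by rewrite /avg big_split mulrDl. Qed.

Lemma avgZ s a f : avg s (fun x => a * f x) = a * avg s f.
Proof. by rewrite /avg -mulr_sumr mulrA. Qed.

Lemma avg_le s f g : (forall x, f x <= g x) -> avg s f <= avg s g.
Proof. by move=> fg; rewrite /avg ler_wpM2r// ler_sum. Qed.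

Lemma avg_cst s c : (0 < size s)%N -> avg s (fun=> c) = c.
Proof.
move=> s0; rewrite /avg big_const_seq count_predT iter_addr_0 -[c *+ _]mulr_natr mulfK//.
by rewrite pnatr_eq0 -lt0n.
Qed.

End Mean.

Lemma boundedD (R : realType) X (f g : X -> R) : bounded f -> bounded g ->
  bounded (fun x => f x + g x).
Proof.
move=> [M fM] [N gN]; exists (M + N) => x.
exact: le_trans (ler_normD _ _) (lerD (fM x) (gN x)).
Qed.

Lemma boundedM (R : realType) X (f g : X -> R) : bounded f -> bounded g ->
  bounded (fun x => f x * g x).
Proof. by move=> [M fM] [N gN]; exists (M * N) => x; rewrite normrM ler_pM. Qed.

Lemma bounded_cst (R : realType) X (c : R) : bounded (fun _ : X => c).
Proof. by exists `|c|. Qed.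

Lemma boundedZ (R : realType) X (f : X -> R) a : bounded f -> bounded (fun x => a * f x).
Proof. by move=> bf; apply: boundedM => //; exact: bounded_cst. Qed.

Lemma boundedN (R : realType) X (f : X -> R) : bounded f -> bounded (fun x => - f x).
Proof. by move=> [M fM]; exists M => x; rewrite normrN. Qed.

Lemma boundedB (R : realType) X (f g : X -> R) : bounded f -> bounded g ->
  bounded (fun x => f x - g x).
Proof. by move=> bf bg; apply: boundedD => //; exact: boundedN. Qed.

Lemma bounded_comp (R : realType) X Y (f : X -> R) (h : Y -> X) : bounded f ->
  bounded (fun x => f (h x)).
Proof. by move=> [M fM]; exists M. Qed.

(** The mean is kept as an ultralimit of finite averages, rather than as a
    functional, because [fubini] approximates it by finite averages. *)
Record mean (R : realType) (G : zmodType) := Mean {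
  mean_I : Type;
  mean_w : set_system mean_I;
  mean_s : mean_I -> seq G;
  mean_ultra : UltraFilter mean_w;
  mean_size : forall i, (0 < size (mean_s i))%N;
  mean_inv : forall (f : G -> R) a, bounded f ->
    ulim mean_w (fun i => avg (mean_s i) (fun y => f (y + a) - f y)) = 0 }.

Arguments mean_I {R G} m.
Arguments mean_w {R G} m.
Arguments mean_s {R G} m.
#[global] Existing Instance mean_ultra.

Section MeanTheory.
Variables (R : realType) (G : zmodType) (mm : mean R G).
Implicit Types f g : G -> R.

Definition mval f : R := ulim (mean_w mm) (fun i => avg (mean_s mm i) f).

Lemma bounded_avg f : bounded f -> bounded (fun i => avg (mean_s mm i) f).
Proof. by move=> [K fK]; exists K => i; apply: avg_bounded => //; exact: mean_size. Qed.

Let uw := mean_ultra mm.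

Lemma meanD f g : bounded f -> bounded g -> mval (fun x => f x + g x) = mval f + mval g.
Proof.
move=> bf bg; rewrite /mval -ulimD; [|exact: bounded_avg..].
by congr ulim; apply/funext => i; exact: avgD.
Qed.

Lemma meanZ a f : bounded f -> mval (fun x => a * f x) = a * mval f.
Proof.
move=> bf; rewrite /mval -ulimZ; [|exact: bounded_avg].
by congr ulim; apply/funext => i; exact: avgZ.
Qed.

Lemma meanN f : bounded f -> mval (fun x => - f x) = - mval f.
Proof.
move=> bf; rewrite -mulN1r -meanZ//; congr mval; apply/funext => x; by rewrite mulN1r.
Qed.

Lemma meanB f g : bounded f -> bounded g -> mval (fun x => f x - g x) = mval f - mval g.
Proof. by move=> bf bg; rewrite meanD ?meanN//; exact: boundedN. Qed.

Lemma mean_cst c : mval (fun=> c) = c.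
Proof.
rewrite /mval (_ : (fun i => _) = (fun=> c)); first exact: (ulim_cst uw).
by apply/funext => i; apply: avg_cst; exact: mean_size.
Qed.

Lemma mean_le f g : bounded f -> bounded g -> (forall x, f x <= g x) -> mval f <= mval g.
Proof.
move=> bf bg fg; apply: (ulim_le uw); [exact: bounded_avg..|].
by apply: filterE => i; exact: avg_le.
Qed.

Lemma mean_ge0 f : bounded f -> (forall x, 0 <= f x) -> 0 <= mval f.
Proof. by move=> bf f0; rewrite -(mean_cst 0); apply: mean_le => //; exact: bounded_cst. Qed.

Lemma mean_norm f c : (forall x, `|f x| <= c) -> `|mval f| <= c.
Proof.
move=> fc; have bf : bounded f by exists c.
rewrite ler_norml -{1}(mean_cst (- c)) -{2}(mean_cst c); apply/andP; split;
  (apply: mean_le => //; first exact: bounded_cst) => x;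
  by have := fc x; rewrite ler_norml => /andP[].
Qed.

Lemma mean_shift f a : bounded f -> mval (fun x => f (x + a)) = mval f.
Proof.
move=> bf; apply/eqP; rewrite -subr_eq0 -meanB//; last exact: bounded_comp.
by apply/eqP; exact: mean_inv.
Qed.

Lemma mean_sum (J : Type) (r : seq J) (F : J -> G -> R) :
  (forall j, bounded (F j)) -> mval (fun x => \sum_(j <- r) F j x) = \sum_(j <- r) mval (F j).
Proof.
move=> bF; elim: r => [|j r IHr].
  by rewrite big_nil -[RHS]mean_cst; congr mval; apply/funext => x; rewrite big_nil.
rewrite big_cons -IHr -meanD//.
  by congr mval; apply/funext => x; rewrite big_cons.
elim: r {IHr} => [|k r IHr].
  by exists 0 => x; rewrite big_nil normr0.
have [c h] := boundedD (bF k) IHr; exists c => x; rewrite big_cons; exact: h.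
Qed.

End MeanTheory.

Lemma has_mean (R : realType) (G : zmodType) : inhabited (mean R G).
Proof.
by have [I [w [s [uw s0 inv]]]] := mean_ex R G; split; exact: (Mean uw s0 inv).
Qed.

(** * Real homomorphisms on compactly generated groups *)

Lemma open_extension (A B : topologicalZmodType) (S : zmodClosed A)
    (f : chom (sgrp S) B) : divisible B -> nbhs 0 (fun x => x \in S) ->
  exists g : chom A B, forall x : sgrp S, g (sg_val x) = f x.
Proof.
move=> dB S0; pose f' x := if pselect (x \in S) is left h then f (SGrp h) else 0.
have f'E (x : sgrp S) : f' (sg_val x) = f x.
  rewrite /f'; case: pselect => [h|]; last by case; exact: sg_valP.
  by congr (f _); exact: sg_val_inj.
have [|g [gB gf]] := @extend_hom A B S f' dB.
  move=> x y xS yS; pose x' := SGrp xS; pose y' := SGrp yS.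
  by rewrite -[x]/(sg_val x') -[y]/(sg_val y') -sg_valB !f'E homB.
have gE (x : sgrp S) : g (sg_val x) = f x by rewrite gf ?f'E//; exact: sg_valP.
have gC : continuous g.
  apply: additive_continuous => // V V0.
  have /sg_nbhs[W W0 WV] : nbhs 0 (f @^-1` V) by exact: hom_nbhs0.
  apply: filterS (filterI S0 W0) => x [xS Wx].
  by have := WV (SGrp xS) Wx; rewrite /= -gE.
by exists (mkhom gB gC).
Qed.

Lemma nat_ultra : exists w : set_system nat, UltraFilter w /\
  forall k, w (fun n => (k <= n)%N).
Proof.
have [w [uw wB]] : exists w, UltraFilter w /\
    forall k : nat, setT k -> w [set n | (k <= n)%N].
  exact: ultra_ex.
by exists w; split=> // k; exact: wB.
Qed.

Section CompactlyGenerated.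
Variables (R : realType) (G : topologicalZmodType) (C : set G).
Hypotheses (cC : compact C) (C0 : nbhs 0 C) (CN : forall x, C x -> C (- x)).
Hypothesis Cgen : forall x, exists n, sumset n C x.

Let C00 : C 0. Proof. exact: nbhs_singleton. Qed.

Lemma doubling_set : exists F : seq G,
  forall x y, C x -> C y -> exists2 f, f \in F & C (x + y - f).
Proof.
have [||F [_ FP]] := @compact_cover_seq _ (sumset 2 C) (fun y x => C (x - y)).
- exact: compact_sumset.
- by move=> x _; rewrite -nbhs_shift0; apply: filterS C0 => z; rewrite addrAC subrr add0r.
exists F => x y Cx Cy; have [|f fF Cf] := FP (x + y); last by exists f.
by apply: (@sumsetD _ 1 1); exact: sumset1.
Qed.

Section RealHom.
Variable N : zmodClosed G.

Let inn n x := exists2 c, sumset n C c & x - c \in N.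

Let innD m n x y : inn m x -> inn n y -> inn (m + n) (x + y).
Proof.
move=> [c Sc xc] [d Sd yd]; exists (c + d); first exact: sumsetD.
by rewrite opprD addrACA rpredD.
Qed.

Let innN n x : inn n x -> inn n (- x).
Proof.
move=> [c Sc xc]; exists (- c); first exact: sumsetN.
by rewrite -opprD rpredN.
Qed.

Let len_ex : exists l : G -> nat, (forall x, inn (l x) x) /\
  forall n x, inn n x -> (l x <= n)%N.
Proof.
have /choice[l lP] x : exists n, inn n x /\ forall m, inn m x -> (n <= m)%N.
  have ex : exists n, `[< inn n x >].
    by have [n Sn] := Cgen x; exists n; apply/asboolP; exists x; rewrite ?subrr ?rpred0.
  exists (ex_minn ex); case: ex_minnP => n /asboolP nx nmin; split=> // m mx.
  by apply: nmin; apply/asboolP.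
exists l; split=> [x|n x nx]; first by have [] := lP x.
by have [_] := lP x; apply.
Qed.

(** Let [l x] be the least [n] such that [x] is in [sumset n C] modulo [N]; it
    is subadditive and invariant under [N]. If [l (x0 *+ J) / J] does not tend
    to zero for some [x0], then averaging the increments [l (x + y) - l y],
    first for [y] along the multiples of [x0] and then over the group by an
    invariant mean, yields an additive map bounded by [l]; it kills [N], and
    its value at [x0] is the limit. If all these limits vanish, [l] is
    bounded: an element of [sumset n.+1 C] is, up to [C], a sum of [n]
    elements of a fixed finite set, and [l] grows with slope at most 1/2 along
    the multiples of each element of that set. *)
Lemma cocompact_or_real_hom :
  (exists n, forall x, exists c, sumset n C c /\ x - c \in N) \/
  (exists rho : chom G R, (forall y, y \in N -> rho y = 0) /\ exists x, rho x != 0).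
Proof.
have [l [lP lmin]] := len_ex.
have lD x y : (l (x + y)%R <= l x + l y)%N by apply/lmin/innD.
have lN x : l (- x) = l x.
  by apply/eqP; rewrite eqn_leq -{3}[x]opprK; apply/andP; split; apply/lmin/innN.
have lNe x y : y \in N -> l (x + y) = l x.
  move=> yN; apply/eqP; rewrite eqn_leq; apply/andP; split; apply: lmin.
    by have [c Sc cN] := lP x; exists c => //; rewrite addrAC rpredD.
  have [c Sc cN] := lP (x + y); exists c => //.
  by rewrite -[x](addrK y) addrAC rpredB.
have l0 : l 0 = 0%N.
  by apply/eqP; rewrite -leqn0; apply: lmin; exists 0; rewrite ?subr0 ?rpred0.
pose d x y : R := (l (x + y))%:R - (l y)%:R.
have dP x y : `|d x y| <= (l x)%:R.
  have a : (l y <= l (x + y)%R + l x)%N.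
    by rewrite -{1}[y](addKr x) addrC (leq_trans (lD _ _))// lN.
  have := lD x y; move: a; rewrite -!(ler_nat R) !natrD /d ler_norml.
  by move: (l _)%:R (l _)%:R (l _)%:R => u v t a b; apply/andP; split; lra.
have bd x : bounded (d x) by exists (l x)%:R.
have [w [uw wge]] := nat_ultra; have [mm] := has_mean R G.
pose q x0 J : R := (l (x0 *+ J))%:R / J%:R.
have lM x n : (l (x *+ n) <= n * l x)%N.
  by elim: n => [|n IHn]; rewrite ?mulr0n ?l0// mulrS mulSn (leq_trans (lD _ _))// leq_add2l.
have bq x0 : bounded (q x0).
  exists (l x0)%:R => -[|J]; first by rewrite /q invr0 mulr0 normr0.
  by rewrite ger0_norm ?divr_ge0// ler_pdivrMr ?ltr0n// -natrM ler_nat mulnC.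
have [[x0 tau0]|tau0] := pselect (exists x0, ulim w (q x0) != 0).
  right; set tau := ulim w (q x0) in tau0.
  (* The average along the multiples of [x0]; for the increments by [x0] the
     sum telescopes. *)
  pose P (f : G -> R) y := ulim w (fun J => (\sum_(0 <= j < J) f (y + x0 *+ j)) / J%:R).
  have bP0 (f : G -> R) (K : R) y : (forall z, `|f z| <= K) -> forall J,
      `|(\sum_(0 <= j < J) f (y + x0 *+ j)) / J%:R| <= K.
    move=> fK [|J].
      by rewrite invr0 mulr0 normr0; apply: le_trans (fK 0).
    rewrite normrM normfV normr_nat ler_pdivrMr ?ltr0n//.
    apply: le_trans (ler_norm_sum _ _ _) _; apply: le_trans (ler_sum _ (fun j _ => fK _)) _.
    by rewrite big_const_nat iter_addr_0 subn0 mulr_natr.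
  have PK (f : G -> R) (K : R) : (forall z, `|f z| <= K) -> forall y, `|P f y| <= K.
    move=> fK y; have b : bounded (fun J => (\sum_(0 <= j < J) f (y + x0 *+ j)) / J%:R).
      by exists K => J; exact: bP0.
    rewrite ler_norml -{1}(ulim_cst uw (- K)) -{2}(ulim_cst uw K); apply/andP; split;
      (apply: ulim_le; [try exact: bounded_cst|try exact: bounded_cst|]) => //;
      by apply: filterE => J; have := bP0 f K y fK J; rewrite ler_norml => /andP[].
  have PD (f g : G -> R) y : bounded f -> bounded g ->
      P (fun z => f z + g z) y = P f y + P g y.
    move=> [K fK] [L gL]; rewrite /P -ulimD; first last.
    - by exists L => J; exact: bP0.
    - by exists K => J; exact: bP0.
    by congr ulim; apply/funext => J; rewrite big_split mulrDl.
  pose h x := mval mm (P (d x)).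
  have bPd x : bounded (P (d x)) by exists (l x)%:R; apply: PK.
  have hD x y : h (x + y) = h x + h y.
    rewrite /h -[mval mm (P (d x))](mean_shift mm y)// -meanD//; last exact: bounded_comp.
    congr mval; apply/funext => z; rewrite {1}(_ : d (x + y) = fun z => d x (z + y) + d y z).
      by rewrite PD//; [congr (_ + _); rewrite /P; congr ulim; apply/funext => J;
        congr (_ / _); apply: eq_bigr => j _; rewrite addrAC | exact: bounded_comp].
    by apply/funext => u; rewrite /d [y + u]addrC subrKA -addrA [y + u]addrC.
  have h0 : h 0 = 0 by apply: (addrI (h 0)); rewrite -hD !addr0.
  have hB : zmod_morphism h.
    by move=> x y; apply: (addIr (h y)); rewrite -hD !subrK.
  have hl x : `|h x| <= (l x)%:R by apply: mean_norm; apply: PK.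
  have hC : continuous h.
    apply: (@real_hom_continuous _ _ _ 1) => //; apply: filterS C0 => x Cx.
    apply: le_trans (hl x) _; rewrite -[1]/(1%:R) ler_nat; apply: lmin.
    by exists x; [exact: sumset1|rewrite subrr rpred0].
  exists (mkhom hB hC); split=> [y yN|].
    apply/eqP; rewrite -normr_le0; apply: le_trans (hl y) _.
    by rewrite -[y]add0r lNe// l0.
  exists x0; rewrite /= (_ : h x0 = tau)// /h (_ : P _ = fun=> tau) ?mean_cst//.
  apply/funext => y; apply: ulim_dist => e e0.
  have [n [n0 ne]] := natmul_large (2 * (l y)%:R) (divr_gt0 e0 (ltr0n R 2)).
  have e20 : 0 < e / 2 by lra.
  apply: filterS (filterI (wge n) (ulim_near uw (bq x0) e20)) => J [nJ].
  have J0 : (0 < J)%N by exact: leq_trans nJ.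
  have JR : 0 < J%:R :> R by rewrite ltr0n.
  have -> : \sum_(0 <= j < J) d x0 (y + x0 *+ j) = (l (y + x0 *+ J))%:R - (l y)%:R.
    rewrite -[X in _ = _ - (l X)%:R]addr0 -[X in _ - (l (_ + X))%:R](mulr0n x0).
    rewrite -(telescope_sumr (fun j => (l (y + x0 *+ j))%:R) (leq0n J)).
    by apply: eq_bigr => j _; rewrite /d mulrS addrCA.
  rewrite -/tau => h1.
  have h2 : `|q x0 J - ((l (y + x0 *+ J))%:R - (l y)%:R) / J%:R| <= e / 2.
    rewrite /q -mulrBl normrM normfV (gtr0_norm JR) ler_pdivrMr//.
    apply: le_trans (_ : 2 * (l y)%:R <= _); last first.
      by apply: le_trans (ltW ne) _; rewrite mulrC ler_pM2l// ler_nat.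
    have a1 : (l (x0 *+ J)%R <= l (y + x0 *+ J)%R + l y)%N.
      by rewrite -{1}[x0 *+ J](addKr y) addrC (leq_trans (lD _ _))// lN.
    have a2 : (l (y + x0 *+ J)%R <= l y + l (x0 *+ J))%N by exact: lD.
    move: a1 a2; rewrite -!(ler_nat R) !natrD.
    move: (l _)%:R (l _)%:R (l _)%:R (ler0n R (l y)) => a b c c0 a1 a2.
    by rewrite ler_norml; apply/andP; split; lra.
  rewrite -(subrKA (q x0 J)); apply: le_lt_trans (ler_normD _ _) _.
  by rewrite [e in _ < e](splitr e) ltr_leD.
left.
have {}tau0 x : ulim w (q x) = 0 by apply/eqP/negPn/negP => h; apply: tau0; exists x.
have half0 : 0 < 2^-1 :> R by rewrite invr_gt0.
(* The length of [f *+ J] is at most [J / 2] for some [J]; along the other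
   multiples of [f] the remainder modulo [J] only adds a constant. *)
have /choice[J JP] f : exists J, (0 < J)%N /\ (2 * l (f *+ J) <= J)%N.
  have [n [qn n0]] := filter_ex (filterI (ulim_near uw (bq f) half0) (wge 1%N)).
  exists n; split=> //; move: qn; rewrite tau0 sub0r normrN /q ger0_norm ?divr_ge0//.
  rewrite ltr_pdivrMr ?ltr0n// => qn; rewrite -(ler_nat R) natrM; move: qn.
  by move: (l _)%:R (n%:R) => a b; lra.
have lmul f n : (2 * l (f *+ n) <= n + 2 * (J f * l f))%N.
  have [Jf0 JfP] := JP f; rewrite {1}(divn_eq n (J f)) mulrnDr [(n %/ _ * _)%N]mulnC mulrnA.
  set k := (n %/ _)%N; set r := (n %% _)%N.
  apply: (@leq_trans (2 * (k * l (f *+ J f) + r * l f))).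
    by rewrite leq_mul2l/= (leq_trans (lD _ _))// leq_add.
  rewrite mulnDr leq_add//; last by rewrite leq_mul2l/= leq_mul2r (ltnW (ltn_pmod _ _))// orbT.
  rewrite mulnCA (leq_trans _ (leq_divM n (J f)))//.
  by rewrite leq_mul2l JfP orbT.
have sum_bound (F : seq G) : exists K, forall t : seq G, {subset t <= F} ->
    (2 * l (\sum_(x <- t) x)%R <= size t + K)%N.
  elim: F => [|f F [K IHF]].
    by exists 0%N => -[|x t] h; [rewrite big_nil l0|have := h x (mem_head _ _)].
  exists (2 * (J f * l f) + K)%N => t tF.
  rewrite -(perm_big _ (permEl (perm_filterC (pred1 f) t)))/= big_cat/=.
  apply: (@leq_trans (2 * (l (\sum_(x <- [seq x <- t | x == f]) x)%R + l (\sum_(x <- [seq x <- t | x != f]) x)%R))).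
    by rewrite leq_mul2l lD.
  rewrite -(count_predC (pred1 f) t) mulnDr addnACA leq_add//.
    apply: leq_trans (lmul f (count (pred1 f) t)).
    rewrite leq_mul2l/= (_ : \sum_(x <- _) x = f *+ count (pred1 f) t)//.
    rewrite -size_filter; elim: (t) => [|x s IHs]; first by rewrite big_nil.
    rewrite /=; case: eqP => [->|_] //=; by rewrite big_cons IHs mulrS.
  rewrite -(size_filter (predC _)); apply: IHF => x; rewrite mem_filter => /andP[xf /tF].
  by rewrite inE (negPf xf).
have [F FP] := doubling_set; have [K KP] := sum_bound F.
(* Since every sum of two elements of [C] is in [C] up to an element of [F],
   one element of [F] splits off for each summand. *)
have decomp n x : sumset n.+1 C x -> exists t : seq G,
    [/\ size t = n, {subset t <= F} & C (x - \sum_(y <- t) y)].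
  elim: n x => [x [u [v [Cu -> ->]]]|n IHn x [u [v [Cu Sv ->]]]].
    by exists [::]; rewrite big_nil subr0 addr0.
  have [t [st tF Ct]] := IHn v Sv; have [f fF Cf] := FP _ _ Cu Ct.
  exists (f :: t); split=> //=; first by rewrite st.
    by move=> x'; rewrite inE => /predU1P[->//|/tF].
  by rewrite big_cons opprD addrA [_ - f - _]addrAC -[u + v - _]addrA.
exists K.+1 => x; have [c Sc cN] := lP x.
(* For [l x = L.+1] the decomposition gives [l x <= 1 + (L + K) / 2]. *)
have lxK : (l x <= K.+1)%N.
  have lxc : l c = l x by rewrite -(lNe c _ cN) addrC subrK.
  case E: (l x) Sc lxc => [//|L] Sc lxc; have [t [st tF Ct]] := decomp L c Sc.
  have h1 : (l c <= 1 + l (\sum_(y <- t) y)%R)%N.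
    rewrite -{1}[c](subrK (\sum_(y <- t) y)) (leq_trans (lD _ _))// leq_add2r.
    by apply: lmin; exists (c - \sum_(y <- t) y); [exact: sumset1|rewrite subrr rpred0].
  have := KP t tF; rewrite st; lia.
by exists c; split=> //; exact: sumset_le Sc.
Qed.

End RealHom.

(** A real homomorphism that kills a finite set [F] as in [doubling_set] can
    be doubled inside [C] for ever: the doubles of its values on [C] are again
    values on [C], hence bounded. *)
Lemma real_hom_finite : exists F : seq G, forall rho : chom G R,
  (forall f, f \in F -> rho f = 0) -> forall x, rho x = 0.
Proof.
have [F FP] := doubling_set; exists F => rho rhoF.
have [K KP] : exists K : R, forall x, C x -> `|rho x| <= K.
  have /compact_bounded[K [_ KP]] : compact (rho @` C).
    by apply: continuous_compact => //; apply: continuous_subspaceT; exact: hom_continuous.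
  by exists (K + 1) => x Cx; apply: KP; [rewrite ltrDl | exists x].
have half n x : C x -> `|rho x *+ 2 ^ n| <= K.
  elim: n x => [|n IHn] x Cx; first by rewrite expn0 mulr1n; exact: KP.
  have [f fF Cf] := FP x x Cx Cx; rewrite expnS mulrnA.
  rewrite (_ : rho x *+ 2 = rho (x + x - f)); first exact: IHn.
  by rewrite homB homD (rhoF f fF) subr0 mulr2n.
have rhoC x : C x -> rho x = 0.
  move=> Cx; apply: (@bounded_multiples0 _ _ K) => n; apply: le_trans (half n x Cx).
  by rewrite !normrMn -(mulr_natr _ n) -(mulr_natr _ (2 ^ n)) ler_wpM2l// ler_nat ltnW// ltn_expl.
move=> x; have [n] := Cgen x; elim: n x => [x ->|n IHn x [u [v [Cu Sv ->]]]].
  exact: hom0.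
by rewrite homD rhoC// add0r IHn.
Qed.

Definition dual_system k (e : 'I_k -> G) (rho : 'I_k -> chom G R) :=
  forall i j, rho i (e j) = (i == j)%:R.

Lemma homto_sumE k (c : 'I_k -> R) (rho : 'I_k -> homto R G) x :
  (\sum_i c i *: rho i : homto R G) x = \sum_i c i * rho i x.
Proof.
pose ev (f : homto R G) := f x.
have evD : {morph ev : f g / f + g} by [].
by rewrite -[LHS]/(ev _) (big_morph ev evD (erefl _)).
Qed.

Lemma lattice_subgroup k (e : 'I_k -> G) : exists N : zmodClosed G,
  forall x, x \in N <-> exists z : 'I_k -> int, x = \sum_i e i *~ z i.
Proof.
pose S : {pred G} := fun x => `[< exists z : 'I_k -> int, x = \sum_i e i *~ z i >].
have h : zmod_closed S.
  split=> [|x y /asboolP[z ->] /asboolP[t ->]]; apply/asboolP.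
    by exists (fun=> 0); rewrite big1.
  by exists (fun i => z i - t i); rewrite -sumrB; apply: eq_bigr => i _; rewrite mulrzBr.
by exists (zmc h) => x; rewrite zmcE; split=> [/asboolP|?]//; apply/asboolP.
Qed.

(** Apply [cocompact_or_real_hom] to the subgroup spanned by the [e i]. A real
    homomorphism that kills it is the new member of the dual family, once the
    [rho i] are corrected at the new point. *)
Lemma dual_system_extend k (e : 'I_k -> G) (rho : 'I_k -> chom G R) :
  dual_system e rho ->
  (exists n, forall x, exists c z, sumset n C c /\ x = c + \sum_i e i *~ z i) \/
  exists (e' : 'I_k.+1 -> G) (rho' : 'I_k.+1 -> chom G R), dual_system e' rho'.
Proof.
move=> er; have [N NP] := lattice_subgroup e.
case: (cocompact_or_real_hom N) => [[n nP]|[s [sN [x sx]]]]; [left|right].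
  exists n => x; have [c [Sc /NP[z zE]]] := nP x; exists c, z; split=> //.
  by rewrite -zE addrC subrK.
pose s' : homto R G := (s x)^-1 *: (s : homto R G).
have s'x : s' x = 1 by rewrite /= mulVf.
have s'e i : s' (e i) = 0.
  suff eiN : e i \in N by rewrite /= (sN _ eiN) mulr0.
  apply/NP; exists (fun j => (j == i)%:Z).
  rewrite (bigD1 i)//= eqxx mulr1z big1 ?addr0// => j /negPf ->; exact: mulr0z.
pose r' i : homto R G := (rho i : homto R G) - rho i x *: s'.
have r'E i y : r' i y = rho i y - rho i x * s' y by [].
exists (fun i => if unlift ord_max i is Some j then e j else x).
exists (fun i => if unlift ord_max i is Some j then r' j else s').
move=> i j; case: (unliftP ord_max i) => [i'|] ->; case: (unliftP ord_max j) => [j'|] ->.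
- by rewrite r'E er s'e mulr0 subr0 (inj_eq (@lift_inj _ _)).
- by rewrite r'E s'x mulr1 subrr eq_sym (negPf (neq_lift _ _)).
- by rewrite s'e (negPf (neq_lift _ _)).
- by rewrite s'x eqxx.
Qed.

(** The [rho i] are linearly independent, and stay so on the finite set given
    by [real_hom_finite]. *)
Lemma dual_system_bound : exists m : nat, forall k (e : 'I_k -> G) (rho : 'I_k -> chom G R),
  dual_system e rho -> (k <= m)%N.
Proof.
have [F FP] := real_hom_finite; exists (size F) => k e rho er; rewrite leqNgt; apply/negP => lt.
pose A : 'M[R]_(k, size F) := \matrix_(i, j) rho i (tnth (in_tuple F) j).
have : kermx A != 0.
  by rewrite kermx_eq0 -row_leq_rank -ltnNge (leq_ltn_trans (rank_leq_col A)).
case/rowV0Pn => v /sub_kermxP vA v0.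
pose s : homto R G := \sum_i v 0 i *: (rho i : homto R G).
have s0 x : s x = 0.
  apply: FP => f /(nthP 0)[j jF <-]; rewrite homto_sumE.
  transitivity ((v *m A) 0 (Ordinal jF)); last by rewrite vA mxE.
  rewrite mxE.
  by apply: eq_bigr => i _; rewrite mxE (tnth_nth 0).
case/eqP: v0; apply/rowP => j; have := s0 (e j); rewrite homto_sumE mxE.
rewrite (bigD1 j)//= er eqxx mulr1 big1 ?addr0// => i /negPf ij.
by rewrite er ij mulr0.
Qed.

(** A dual system of maximal length has a cocompact lattice, by
    [dual_system_extend]. *)
Lemma lattice_ex : exists k (e : 'I_k -> G) (rho : 'I_k -> chom G R) n,
  dual_system e rho /\
  forall x, exists c z, sumset n C c /\ x = c + \sum_i e i *~ z i.
Proof.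
have [m mP] := dual_system_bound.
suff : forall d k (e : 'I_k -> G) (rho : 'I_k -> chom G R), (m < k + d)%N ->
    dual_system e rho -> exists k (e : 'I_k -> G) (rho : 'I_k -> chom G R) n,
    dual_system e rho /\
    forall x, exists c z, sumset n C c /\ x = c + \sum_i e i *~ z i.
  by move=> /(_ m.+1 0%N (fun=> 0) (fun=> 0)); apply=> // -[].
elim=> [|d IHd] k e rho; first by rewrite addn0 ltnNge => /negP h /mP.
rewrite addnS -addSn => md er.
case: (dual_system_extend er) => [[n nP]|[e' [rho' er']]]; last exact: IHd er'.
by exists k, e, rho, n.
Qed.

End CompactlyGenerated.

(** This is [lattice_ex] for the open subgroup [G]; the real homomorphisms
    extend to [A] since the group of reals is divisible. *)
Lemma lattice_LCA (R : realType) (A : topologicalZmodType) (C : set A)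
    (G : zmodClosed A) :
  compact C -> nbhs 0 C -> (forall x, C x -> C (- x)) ->
  (forall x, x \in G <-> exists n, sumset n C x) ->
  exists k (e : 'I_k -> A) (rho : 'I_k -> chom A R) n,
  [/\ forall i, e i \in G, forall i j, rho i (e j) = (i == j)%:R &
  forall x, x \in G -> exists c z, sumset n C c /\ x = c + \sum_i e i *~ z i].
Proof.
move=> cC C0 CN GP.
have CG x : C x -> x \in G by move=> Cx; apply/GP; exists 1%N; exact: sumset1.
have G0 : nbhs 0 (fun x => x \in G) by apply: filterS C0.
pose D : set (sgrp G) := @sg_val _ G @^-1` C.
have Dsum n (x : sgrp G) : sumset n C (sg_val x) -> sumset n D x.
  elim: n x => [x /= x0|n IHn x [u [v [Cu Sv xE]]]]; first exact: sg_val_inj.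
  have vG : v \in G by apply/GP; exists n.
  exists (SGrp (CG u Cu)), (SGrp vG); split=> //; first exact: IHn.
  exact: sg_val_inj.
have [|||x|k [e [rho [n [er nP]]]]] := @lattice_ex R (sgrp G) D.
- exact: sg_compact.
- exact: sg_val_continuous.
- by move=> x; exact: CN.
- by have [n Sn] := (GP _).1 (sg_valP x); exists n; exact: Dsum.
have /choice[r rP] i : exists r : chom A R, forall x : sgrp G, r (sg_val x) = rho i x.
  by apply: open_extension G0; exact: divisibleR.
exists k, (fun i => sg_val (e i)), r, n; split.
- by move=> i; exact: sg_valP.
- by move=> i j; rewrite rP er.
move=> x xG; have [c [z [Sc xE]]] := nP (SGrp xG).
exists (sg_val c), z; split.
  by apply: (sumset_morph (f := @sg_val _ G) (C := D)).
have := congr1 (sg_incl G) xE; rewrite homD hom_sum /= => ->; congr (_ + _).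
by apply: eq_bigr => i _; rewrite -[LHS]/(sg_incl G _) homMz.
Qed.

(** * Kronecker approximation on compact groups *)

Section CosineCircle.
Variable R : realType.
Local Notation T := (circle R).

(** The real part of the embedding of the circle in the complex plane. The
    identity [cosT_sum] replaces multiplicativity, which keeps all averages
    real. *)
Definition cosT (x : T) : R := cos (2 * pi * xget 0 [set r | cpi R r = x]).

Lemma cos_int (r s : R) : r - s \is a Num.int -> cos (2 * pi * r) = cos (2 * pi * s).
Proof.
case/intrP => n rs; have -> : r = s + n%:~R by rewrite -rs addrC subrK.
have E m : 2 * pi * m%:R = (pi *+ 2) *+ m :> R.
  by rewrite -(mulr_natr (pi *+ 2) m) -(mulr_natl pi 2).
case: n rs => n _; rewrite mulrDr.
  by rewrite -pmulrn E (periodicn (@cosD2pi R)).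
by rewrite NegzE mulrNz -pmulrn mulrN E -[in RHS](subrK ((pi *+ 2) *+ n.+1) (2 * pi * s))
  (periodicn (@cosD2pi R)).
Qed.

Lemma cosT_cpi r : cosT (cpi R r) = cos (2 * pi * r).
Proof.
rewrite /cosT; case: xgetP => [s _ /= sr|/(_ r)/=]; last by case.
apply: cos_int; apply/cpi_eq0.
by rewrite homB sr subrr.
Qed.

Lemma cosT0 : cosT 0 = 1.
Proof. by rewrite -(hom0 (cpi R)) cosT_cpi mulr0 cos0. Qed.

Lemma cosT_le1 x : `|cosT x| <= 1.
Proof.
by have [r _ <-] := cpi_surj x; rewrite cosT_cpi ler_norml cos_geN1 cos_le1.
Qed.

Lemma cosT_sum x y : cosT (x + y) + cosT (x - y) = 2 * cosT x * cosT y.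
Proof.
have [r _ <-] := cpi_surj x; have [s _ <-] := cpi_surj y.
by rewrite -homD -homB !cosT_cpi !(mulrDr, mulrN) cosD cosB; ring.
Qed.

Lemma cosT_eq1 x : cosT x = 1 -> x = 0.
Proof.
have [r r2 <-] := cpi_surj x; rewrite cosT_cpi => c1.
have pi0 := pi_gt0 R.
suff : 2 * pi * `|r| = 0.
  move/eqP; rewrite mulf_eq0 normr_eq0 gt_eqF ?mulr_gt0// => /eqP->.
  exact: hom0.
apply: cos_inj.
- by rewrite in_itv/= !mulr_ge0 ?(ltW pi0)//=; nra.
- by rewrite in_itv/= lexx (ltW pi0).
rewrite cos0 -[RHS]c1; have [r0|r0] := lerP 0 r; first by rewrite ger0_norm.
by rewrite ltr0_norm// mulrN cosN.
Qed.

Lemma cosT_continuous : continuous cosT.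
Proof.
apply: (@tpi_factor_continuous R (@Zreal R)) => r.
have -> : cosT \o tpi (@Zreal R) = cos \o (fun r => 2 * pi * r).
  by apply/funext => s; exact: cosT_cpi.
apply: continuous_comp; last exact: continuous_cos.
by apply: cvgM; [exact: cvg_cst | exact: cvg_id].
Qed.

Lemma bounded_cosT X (f : X -> T) : bounded (fun x => cosT (f x)).
Proof. by exists 1 => x; exact: cosT_le1. Qed.

End CosineCircle.

Section MeanCompact.
Variables (R : realType) (K : topologicalZmodType) (mm : mean R K).
Hypothesis cK : compact [set: K].
Local Notation M := (mval mm).

Lemma continuous_bounded (f : K -> R) : continuous f -> bounded f.
Proof.
move=> fC; have /compact_bounded[c [_ cP]] : compact (f @` [set: K]).
  by apply: continuous_compact => //; exact: continuous_subspaceT.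
by exists (c + 1) => x; apply: cP; [rewrite ltrDl|exists x].
Qed.

(** Finitely many translates of [U] cover the compact group, so finitely many
    translates of [f], all with the same mean, have a sum that is at least
    [c]. *)
Lemma mean_nbhs_gt0 (U : set K) (x0 : K) (f : K -> R) (c : R) : nbhs x0 U -> bounded f ->
  (forall x, 0 <= f x) -> 0 < c -> (forall x, U x -> c <= f x) -> 0 < M f.
Proof.
move=> Ux bf f0 c0 Uf.
have [|s [_ sP]] := @compact_cover_seq _ _ (fun y x => U (x0 + (x - y))) cK.
  move=> y _; apply/nbhs_shift0; move/nbhs_shift0 : Ux; apply: filterS => z.
  by rewrite addrAC subrr add0r.
have : c <= M (fun x => \sum_(y <- s) f (x + (x0 - y))).
  rewrite -{1}(mean_cst mm c); apply: mean_le; first exact: bounded_cst.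
    elim: s {sP} => [|y s IHs].
      by exists 0 => x; rewrite big_nil normr0.
    have [k kP] := boundedD (bounded_comp (fun x => x + (x0 - y)) bf) IHs.
    by exists k => x; rewrite big_cons.
  move=> x; have [y ys Uy] := sP x I; apply: le_trans (Uf _ Uy) _.
  rewrite (big_rem y)//= [_ + (x - y)]addrCA lerDl.
  by rewrite big_seq sumr_ge0.
rewrite mean_sum; last by move=> y; exact: bounded_comp.
rewrite (eq_bigr (fun=> M f)); last by move=> y _; exact: (mean_shift mm (x0 - y) bf).
rewrite big_const_seq count_predT iter_addr_0 => h.
rewrite lt_neqAle mean_ge0// andbT eq_sym; apply/eqP => Mf0.
by move: h; rewrite Mf0 mul0rn leNgt c0.
Qed.

(** Orthogonality of characters. With [c t] the mean of [cosT (chi + t)] and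
    [s] a nonzero value of [chi], invariance gives [c (t + s) = c t], and the
    addition formula gives [c (t + s) + c (t - s) = 2 * cosT s * c t]. *)
Lemma mean_char0 (chi : chom K (circle R)) t : chi != 0 ->
  M (fun y => cosT (chi y + t)) = 0.
Proof.
move=> chi0; have [a s0] : exists a, chi a != 0.
  have [//|na] := pselect (exists a, chi a != 0); case/eqP: chi0; apply: homP => a.
  by apply/eqP/negPn/negP => ha; apply: na; exists a.
set s := chi a in s0; pose c t := M (fun y => cosT (chi y + t)).
have cs u : c (u + s) = c u.
  rewrite /c -[RHS](mean_shift mm a); last exact: bounded_cosT.
  by congr mval; apply/funext => y; rewrite homD -addrA [s + u]addrC.
have h : c (t + s) + c (t - s) = 2 * cosT s * c t.
  rewrite /c -meanD -?meanZ; try exact: bounded_cosT.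
  congr mval; apply/funext => y; rewrite !addrA cosT_sum; ring.
rewrite cs -(cs (t - s)) subrK in h.
have : (1 - cosT s) * c t = 0 by move: h; nra.
move/eqP; rewrite mulf_eq0 subr_eq0 => /orP[/eqP h1|/eqP//].
by case/eqP: s0; apply: cosT_eq1.
Qed.

End MeanCompact.

Lemma pow_small (R : realType) (a b mu : R) : 0 <= a -> a < b -> 0 < mu ->
  ~ (forall N : nat, b ^+ N * mu <= a ^+ N).
Proof.
move=> a0 ab mu0 h; have b0 : 0 < b by lra.
have r1 : `|a / b| < 1 by rewrite ger0_norm ?divr_ge0 ?(ltW b0)// ltr_pdivrMr// mul1r.
have /cvgrPdist_lt/(_ _ mu0)[N _ /(_ N (leqnn N))] := cvg_expr r1.
rewrite /= sub0r normrN ger0_norm ?exprn_ge0 ?divr_ge0 ?(ltW b0)//.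
rewrite expr_div_n ltr_pdivrMr ?exprn_gt0// ltNge mulrC => /negP; exact.
Qed.

Section Kronecker.
Variables (R : realType) (K : topologicalZmodType).
Hypothesis cK : compact [set: K].
Local Notation T := (circle R).
Variables (X : zmodType) (b : X -> chom K T) (psi : X -> T).
Hypotheses (bB : zmod_morphism b) (psiB : zmod_morphism psi).
Hypothesis b0 : forall x, b x = 0 -> psi x = 0.

Let p (t : T) : R := (1 + cosT t) / 2.

Let p_ge0 t : 0 <= p t.
Proof. by have := cosT_le1 t; rewrite /p ler_norml => /andP[h _]; lra. Qed.

Let p_le1 t : p t <= 1.
Proof. by have := cosT_le1 t; rewrite /p ler_norml => /andP[_ h]; lra. Qed.

Let prod (f : X -> K -> T) (l : seq X) (y : K) : R := \prod_(x <- l) p (f x y).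

Let prod_bounded f l : bounded (prod f l).
Proof.
exists 1 => y; rewrite /prod; elim: l => [|x l IHl]; rewrite ?big_nil ?normr1// big_cons.
by rewrite normrM ger0_norm// mulr_ile1.
Qed.

Let tw (phi : X -> T) x y := b x y - phi x.

(** Expanded into characters, the two products have the same terms up to the
    twist by [phi]. A nontrivial character has mean zero whatever the twist,
    and for a trivial one the twist vanishes. The additional cosine makes the
    induction on [l] work. *)
Let prod_mean (mm : mean R K) phi l eta t : zmod_morphism phi ->
  (forall x, b x = 0 -> phi x = 0) ->
  mval mm (fun y => prod (tw phi) l y * cosT (tw phi eta y + t)) =
  mval mm (fun y => prod (tw (fun=> 0)) l y * cosT (tw (fun=> 0) eta y + t)).
Proof.
move=> phiB phi0; elim: l eta => [|x l IHl] eta.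
  have e0 f : (fun y => prod f [::] y * cosT (f eta y + t)) = (fun y => cosT (f eta y + t)).
    by apply/funext => y; rewrite /prod big_nil mul1r.
  rewrite !e0; have [be|be] := eqVneq (b eta) 0.
    by congr mval; apply/funext => y; rewrite /tw phi0.
  have E0 : mval mm (fun y => cosT (tw (fun=> 0) eta y + t)) = 0.
    rewrite -[RHS](mean_char0 mm t be); congr mval; apply/funext => y.
    by rewrite /tw subr0.
  rewrite E0 -[RHS](mean_char0 mm (t - phi eta) be); congr mval; apply/funext => y.
  by rewrite /tw -addrA [- _ + t]addrC.
have step (f : X -> K -> T) : (forall u v y, f (u + v) y = f u y + f v y) ->
    (forall u v y, f (u - v) y = f u y - f v y) ->
    mval mm (fun y => prod f (x :: l) y * cosT (f eta y + t)) =
    2^-1 * mval mm (fun y => prod f l y * cosT (f eta y + t)) +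
    (4^-1 * mval mm (fun y => prod f l y * cosT (f (eta + x) y + t)) +
     4^-1 * mval mm (fun y => prod f l y * cosT (f (eta - x) y + t))).
  move=> fD fB; have bd u : bounded (fun y => prod f l y * cosT (f u y + t)).
    by apply: boundedM; [exact: prod_bounded|exact: bounded_cosT].
  rewrite -!meanZ// -!meanD; try exact: boundedD; try exact: boundedZ; last first.
    by apply: boundedD; exact: boundedZ.
  congr mval; apply/funext => y; rewrite /prod big_cons fD fB.
  have := cosT_sum (f eta y + t) (f x y); rewrite /p.
  rewrite [f eta y + t + f x y]addrAC [f eta y + t - f x y]addrAC => h.
  set P := \prod_(_ <- _) _.
  transitivity (2^-1 * (P * cosT (f eta y + t)) + 4^-1 * (P * (2 * cosT (f eta y + t) * cosT (f x y)))).
    by field.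
  by rewrite -h; ring.
have twD (phi' : X -> T) : zmod_morphism phi' -> forall u v y, tw phi' (u + v) y = tw phi' u y + tw phi' v y.
  by move=> h u v y; rewrite /tw (zmorphD bB) (zmorphD h) opprD addrACA.
have twB (phi' : X -> T) : zmod_morphism phi' -> forall u v y, tw phi' (u - v) y = tw phi' u y - tw phi' v y.
  by move=> h u v y; rewrite /tw bB h opprD addrACA -opprD.
have z : zmod_morphism (fun _ : X => 0 : T) by move=> u v; rewrite subr0.
rewrite (step (tw phi)); [|exact: twD|exact: twB].
by rewrite (step (tw (fun=> 0))); [rewrite !IHl|exact: twD|exact: twB].
Qed.

(** If [psi] is not evaluation at a point, then by compactness finitely many
    factors [(1 + cosT (b x - psi x)) / 2] have a product that is at most some
    [th < 1] everywhere. By [prod_mean] the powers of this product have the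
    same means as those of the untwisted product, which is close to 1 near
    zero; so these means cannot decay like [th ^ N]. *)
Lemma kronecker : exists k, forall x, psi x = b x k.
Proof.
have [//|nk] := pselect (exists k, forall x, psi x = b x k); exfalso.
have [mm] := has_mean R K.
have /choice[xk xkP] k : exists x, cosT (b x k - psi x) < 1.
  have [x /eqP xk] : exists x, psi x <> b x k by apply/existsNP => h; apply: nk; exists k.
  exists x; have := cosT_le1 (b x k - psi x); rewrite ler_norml => /andP[_].
  rewrite le_eqVlt => /orP[/eqP/cosT_eq1/eqP|//].
  by rewrite subr_eq0 eq_sym (negPf xk).
have bcont x : continuous (fun y => cosT (tw psi x y)).
  move=> y; apply: continuous_comp; last exact: cosT_continuous.
  apply: (@continuousB_at _ _ (b x) (fun=> psi x)); first exact: hom_continuous.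
  exact: cvg_cst.
pose c k := (1 + cosT (tw psi (xk k) k)) / 2.
have c1 k : c k < 1 by have := xkP k; rewrite /c /tw; lra.
have [|s [_ sP]] := @compact_cover_seq _ _ (fun k y => cosT (tw psi (xk k) y) < c k) cK.
  move=> k _; apply: (bcont (xk k) k [set r | r < c k]).
  apply: open_nbhs_nbhs; split; first exact: open_lt.
  by rewrite /= /c; have := xkP k; rewrite /tw; lra.
pose l := [seq xk k | k <- s].
have [th [th0 th1 thP]] : exists th, [/\ 0 <= th, th < 1 & forall k, k \in s -> (1 + c k) / 2 <= th].
  elim: (s) => [|k t [th [th0 th1 thP]]]; first by exists 0.
  exists (Num.max th ((1 + c k) / 2)); split.
  - by rewrite le_max th0.
  - by rewrite gt_max th1; have := c1 k; lra.
  by move=> j; rewrite inE le_max => /predU1P[->|/thP ->//]; rewrite lexx orbT.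
have pl (f : X -> K -> T) y : 0 <= prod f l y <= 1.
  rewrite /prod; elim: (l) => [|x r /andP[h1 h2]]; rewrite ?big_nil ?ler01 ?lexx// big_cons.
  by rewrite mulr_ge0// mulr_ile1.
have q1 y : prod (tw psi) l y <= th.
  have [k ks hk] := sP y I.
  apply: le_trans (thP k ks); rewrite /prod (big_rem (xk k)) ?map_f//=.
  rewrite -[X in _ <= X]mulr1 ler_pM//; first last.
  - elim: (rem _ _) => [|x r IHr]; rewrite ?big_nil// big_cons.
    by rewrite mulr_ile1//; elim: (r) => [|? ? ?]; rewrite ?big_nil// big_cons mulr_ge0.
  - by rewrite /p; lra.
  by elim: (rem _ _) => [|x r IHr]; rewrite ?big_nil// big_cons mulr_ge0.
have powE f N y : prod f (flatten (nseq N l)) y = prod f l y ^+ N.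
  elim: N => [|N IHN]; first by rewrite /prod big_nil expr0.
  by rewrite /= /prod big_cat exprS; congr (_ * _); exact: IHN.
(* A power of the product is the product over a repeated list. *)
have meanE N : mval mm (fun y => prod (tw psi) l y ^+ N) = mval mm (fun y => prod (tw (fun=> 0)) l y ^+ N).
  have := prod_mean mm (flatten (nseq N l)) 0 0 psiB b0.
  have e f : (forall y, f 0 y = 0) ->
      (fun y => prod f (flatten (nseq N l)) y * cosT (f 0 y + 0)) = (fun y => prod f l y ^+ N).
    by move=> f0; apply/funext => y; rewrite powE f0 addr0 cosT0 mulr1.
  have b00 : b 0 = 0 by exact: zmorph0 bB.
  rewrite !e// => y; rewrite /tw b00 ?(zmorph0 psiB) subr0//.
pose th' := (1 + th) / 2.
have pcont : continuous (prod (tw (fun=> 0)) l).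
  rewrite /prod; elim: (l) => [|x r IHr].
    by under eq_fun do rewrite big_nil; exact: cst_continuous.
  under eq_fun do rewrite big_cons; move=> y; apply: cvgM; last exact: IHr.
  apply: cvgM; last exact: cvg_cst; apply: cvgD; first exact: cvg_cst.
  apply: continuous_comp; last exact: cosT_continuous.
  apply: (@continuousB_at _ _ (b x) (fun=> 0)); first exact: hom_continuous.
  exact: cvg_cst.
pose U := [set y | th' < prod (tw (fun=> 0)) l y].
have U0 : nbhs 0 U.
  apply: (pcont 0 [set r | th' < r]); apply: open_nbhs_nbhs; split; first exact: open_gt.
  rewrite /= /prod big1 ?/th'; first by lra.
  by move=> x _; rewrite /p /tw hom0 subrr cosT0; lra.
pose ind y : R := `[< U y >]%:R.
have ind01 y : 0 <= ind y <= 1 by rewrite /ind; case: asbool; rewrite ?ler01 ?lexx.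
have bind : bounded ind by exists 1 => y; have /andP[h1 h2] := ind01 y; rewrite ger0_norm.
have mu0 : 0 < mval mm ind.
  apply: (@mean_nbhs_gt0 R K mm cK U 0 ind 1 U0 bind) => // y Uy.
  by rewrite /ind asboolT.
apply: (pow_small th0 (_ : th < th') mu0); first by rewrite /th'; lra.
have bp f N : bounded (fun y => prod f l y ^+ N).
  by exists 1 => y; have /andP[h1 h2] := pl f y; rewrite ger0_norm ?exprn_ge0// exprn_ile1.
move=> N; rewrite -meanZ//; apply: (@le_trans _ _ (mval mm (fun y => prod (tw (fun=> 0)) l y ^+ N))).
  apply: mean_le => [|//|y]; first exact: boundedZ.
  rewrite /ind; case: asboolP => [Uy|_]; last by rewrite mulr0 exprn_ge0//; have /andP[] := pl (tw (fun=> 0)) y.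
  rewrite mulr1 lerXn2r ?nnegrE ?(ltW Uy)//; first by rewrite /th'; lra.
  by have /andP[] := pl (tw (fun=> 0)) y.
rewrite -meanE -[X in _ <= X](mean_cst mm); apply: mean_le => // [|y]; first exact: bounded_cst.
by rewrite lerXn2r ?nnegrE//; have /andP[] := pl (tw psi) y.
Qed.

End Kronecker.

Lemma subr4 (Z : zmodType) (a b c d : Z) : a - b - (c - d) = a - c - (b - d).
Proof. by rewrite !opprB addrACA [RHS]addrACA [- b - c]addrC. Qed.

(** Define the homomorphism on the subgroup spanned by [S] and [x], then
    extend it to [X] with values in the divisible circle. *)
Lemma separating_hom (R : realType) (X : zmodType) (S : zmodClosed X) x :
  x \notin S -> exists g : X -> circle R,
  [/\ zmod_morphism g, forall y, y \in S -> g y = 0 & g x != 0].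
Proof.
move=> xS.
(* The image of [x] must have an order that divides the order of [x] modulo
   [S]: for order [n.+1] the class of [1 / n.+1], for infinite order any
   nonzero class. *)
have [c c0 cP] : exists2 c : circle R, c != 0 & forall n : int, x *~ n \in S -> c *~ n = 0.
  have [ex|nex] := pselect (exists n, x *+ n.+1 \in S).
    pose n := ex_minn ex; have xn : x *+ n.+1 \in S by rewrite /n; case: ex_minnP.
    have nmin m : x *+ m.+1 \in S -> (n <= m)%N by rewrite /n; case: ex_minnP => k _; apply.
    have cn : cpi R (n.+1%:R^-1) *+ n.+1 = 0.
      by rewrite -homMn -(mulr_natr n.+1%:R^-1 n.+1) mulVf ?pnatr_eq0//; apply/cpi_eq0; exact: rpred1.
    have cnat m : x *+ m \in S -> cpi R (n.+1%:R^-1) *+ m = 0.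
      move=> xm; have xr : x *+ (m %% n.+1) \in S.
        have : x *+ m - x *+ n.+1 *+ (m %/ n.+1) \in S by rewrite rpredB// rpredMn.
        by rewrite {1}(divn_eq m n.+1) mulrnDr [(_ %/ _ * _)%N]mulnC mulrnA addrC addKr.
      rewrite (divn_eq m n.+1) mulrnDr [(_ %/ _ * _)%N]mulnC mulrnA cn mul0rn add0r.
      case E: (m %% n.+1)%N xr => [//|r] /nmin.
      by rewrite leqNgt -[(r < n)%N]/(r.+1 <= n)%N -E -ltnS ltn_pmod.
    exists (cpi R (n.+1%:R^-1)).
      apply/eqP => /cpi_small h; have : n.+1%:R^-1 = 0 :> R; last first.
        by move/eqP; rewrite invr_eq0 pnatr_eq0.
      apply: h; rewrite ger0_norm ?invr_ge0// invf_lt1 ?ltr0n// ltr1n.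
      by case: (n) xn => //; rewrite mulr1n (negPf xS).
    case=> m; first exact: cnat.
    by rewrite NegzE !mulrNz rpredN => /cnat h; rewrite -pmulrn h oppr0.
  exists (cpi R 2^-1).
    apply/eqP => /cpi_small h; have : 2^-1 = 0 :> R; last by move/eqP; rewrite invr_eq0 pnatr_eq0.
    by apply: h; rewrite ger0_norm; lra.
  case=> [[|m]|m] h; first by rewrite mulr0z.
    by exfalso; apply: nex; exists m.
  by exfalso; apply: nex; exists m; rewrite NegzE mulrNz rpredN in h.
pose G0 : {pred X} := fun y => `[< exists n : int, y - x *~ n \in S >].
have hG : zmod_closed G0.
  split=> [|y z /asboolP[n yn] /asboolP[m zm]]; apply/asboolP.
    by exists 0; rewrite mulr0z subr0 rpred0.
  by exists (n - m); rewrite mulrzBr subr4 rpredB.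
have /choice[f fP] y : exists d, forall n : int, y - x *~ n \in S -> d = c *~ n.
  have [[n yn]|ny] := pselect (exists n : int, y - x *~ n \in S); last first.
    by exists 0 => n yn; exfalso; apply: ny; exists n.
  exists (c *~ n) => m ym; apply/eqP; rewrite -subr_eq0 -mulrzBr; apply/eqP/cP.
  have -> : x *~ (n - m) = (y - x *~ m) - (y - x *~ n).
    by rewrite mulrzBr opprB [RHS]addrC addrA subrK.
  exact: rpredB.
have [|g [gB gf]] := @extend_hom X (circle R) (zmc hG) f (@divisible_circle R).
  move=> y z; rewrite !zmcE => /asboolP[n yn] /asboolP[m zm].
  rewrite (fP y n yn) (fP z m zm) -mulrzBr; apply: fP.
  by rewrite mulrzBr subr4 rpredB.
exists g; split=> // [y yS|].
  rewrite gf; first by rewrite (fP y 0) ?mulr0z// subr0.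
  by rewrite zmcE; apply/asboolP; exists 0; rewrite mulr0z subr0.
rewrite gf; first by rewrite (fP x 1) ?mulr1z// subrr rpred0.
by rewrite zmcE; apply/asboolP; exists 1; rewrite mulr1z subrr rpred0.
Qed.

(** If [chi] is not one of the [b x], some homomorphism on all characters
    kills the [b x] but not [chi]. By [kronecker] it is evaluation at a point,
    and this point is zero since the [b x] separate points. *)
Lemma separating_chars (R : realType) (K : topologicalZmodType) (X : zmodType)
    (b : X -> chom K (circle R)) : compact [set: K] -> zmod_morphism b ->
  (forall k, (forall x, b x k = 0) -> k = 0) -> forall chi, exists x, chi = b x.
Proof.
move=> cK bB sep chi; have [//|nx] := pselect (exists x, chi = b x); exfalso.
pose S0 : {pred chom K (circle R)} := fun f => `[< exists x, f = b x >].
have hS : zmod_closed S0.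
  split=> [|f g /asboolP[x ->] /asboolP[y ->]]; apply/asboolP.
    by exists 0; rewrite (zmorph0 bB).
  by exists (x - y); rewrite bB.
have chiS : chi \notin zmc hS by rewrite zmcE; apply/negP => /asboolP.
have [psi [psiB psiS psichi]] := separating_hom R chiS.
have [||k kP] := @kronecker R K cK _ id psi _ psiB.
- by [].
- by move=> f ->; exact: zmorph0 psiB.
have k0 : k = 0.
  apply: sep => x; rewrite -[b x]/(id (b x)) -kP psiS//.
  by rewrite zmcE; apply/asboolP; exists x.
by case/eqP: psichi; rewrite kP k0 hom0.
Qed.

(** * Convolution operators on compact groups *)

Section ContinuousOnCompact.
Variables (R : realType) (K : topologicalZmodType).
Hypothesis cK : compact [set: K].

Lemma nbhs_seq (T : topologicalType) (x : T) (J : eqType) (s : seq J) (W : J -> set T) :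
  (forall j, j \in s -> nbhs x (W j)) ->
  exists2 V, nbhs x V & forall j, j \in s -> V `<=` W j.
Proof.
elim: s => [|j s IHs] h; first by exists setT => //; exact: filterT.
have [|V Vx VW] := IHs; first by move=> k ks; apply: h; rewrite inE ks orbT.
exists (V `&` W j); first by apply: filterI => //; apply: h; exact: mem_head.
move=> k; rewrite inE => /predU1P[->|ks] y [Vy Wy] //; exact: VW.
Qed.

Lemma uniformly_continuous (f : K -> R) (e : R) : continuous f -> 0 < e ->
  exists2 V, nbhs 0 V & forall x y, V (y - x) -> `|f x - f y| <= e.
Proof.
move=> fC e0; have e20 : 0 < e / 2 by rewrite divr_gt0.
have /choice[W WP] x : exists W : set K, [/\ nbhs 0 W, (forall z, W z -> W (- z)) &
    forall z t, W z -> W t -> `|f x - f (x + (z + t))| < e / 2].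
  have : nbhs 0 (fun z => `|f x - f (x + z)| < e / 2).
    apply/(nbhs_shift0 x (fun z => `|f x - f z| < e / 2)).
    by have /cvgrPdist_lt/(_ _ e20) := fC x.
  by move=> /nbhs0_halve[W [W0 WN WW]]; exists W.
have [|s [_ sP]] := @compact_cover_seq _ _ (fun x y => W x (y - x)) cK.
  move=> x _; apply/nbhs_shift0; have [W0 _ _] := WP x; apply: filterS W0 => z.
  by rewrite addrAC subrr add0r.
have [|V V0 VW] := @nbhs_seq _ (0 : K) _ s W; first by move=> x _; have [] := WP x.
exists V => // x y Vyx; have [x0 xs Wx] := sP x I.
have [W0 WN WW] := WP x0.
have h1 := WW _ _ Wx (nbhs_singleton W0); have h2 := WW _ _ Wx (VW _ xs _ Vyx).
rewrite addr0 addrCA subrr addr0 in h1.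
have e1 : x0 + (x - x0 + (y - x)) = y by rewrite [x - x0]addrC -addrA addNKr addrC subrK.
rewrite e1 in h2; rewrite -(subrKA (f x0)); apply: le_trans (ler_normD _ _) _.
by rewrite distrC [e]splitr lerD// ltW.
Qed.

Variable mm : mean R K.
Local Notation M := (mval mm).

Lemma cauchy_schwarz (f g : K -> R) : bounded f -> bounded g ->
  M (fun x => f x * g x) ^+ 2 <= M (fun x => f x ^+ 2) * M (fun x => g x ^+ 2).
Proof.
move=> bf bg; set a := M (fun x => f x ^+ 2); set b := M (fun x => f x * g x).
set c := M (fun x => g x ^+ 2).
have bff : bounded (fun x => f x ^+ 2) by exact: boundedM.
have bgg : bounded (fun x => g x ^+ 2) by exact: boundedM.
have bfg : bounded (fun x => f x * g x) by exact: boundedM.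
have q t : 0 <= a - 2 * t * b + t ^+ 2 * c.
  have -> : a - 2 * t * b + t ^+ 2 * c = M (fun x => (f x - t * g x) ^+ 2).
    rewrite /a /b /c -!meanZ// -meanB//; last exact: boundedZ.
    rewrite -meanD//; [|by apply: boundedB => //; exact: boundedZ|exact: boundedZ].
    by congr mval; apply/funext => x; ring.
  apply: mean_ge0 => [|x]; last exact: sqr_ge0.
  by apply: boundedM; apply: boundedB => //; exact: boundedZ.
have c0 : 0 <= c by apply: mean_ge0 => // x; exact: sqr_ge0.
have [cz|cz] := eqVneq c 0.
  rewrite cz mulr0; have [->|b0] := eqVneq b 0; first by rewrite expr0n.
  have := q ((a + 1) / (2 * b)); rewrite cz mulr0 addr0.
  have -> : 2 * ((a + 1) / (2 * b)) * b = a + 1 by field.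
  by lra.
have cp : 0 < c by rewrite lt_neqAle eq_sym cz.
have := q (b / c); have -> : a - 2 * (b / c) * b + (b / c) ^+ 2 * c = (a * c - b ^+ 2) / c.
  by field.
by rewrite pmulr_lge0 ?invr_gt0// subr_ge0.
Qed.

(** Along the ultrafilter one mean is a finite average, uniformly on the
    finite net of rows, and a finite average commutes with the other mean. *)
Lemma fubini (k : K -> K -> R) (B : R) : (forall x y, `|k x y| <= B) ->
  (forall e : R, 0 < e -> exists s : seq K, forall x, exists2 x', x' \in s &
     forall y, `|k x y - k x' y| <= e) ->
  M (fun x => M (fun y => k x y)) = M (fun y => M (fun x => k x y)).
Proof.
move=> kB net.
have bk x : bounded (k x) by exists B.
have bk' y : bounded (k^~ y) by exists B.
have bMx : bounded (fun x => M (k x)) by exists B => x; exact: mean_norm.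
pose sq := mean_s mm.
symmetry; apply: ulim_dist => e e0; have e40 : 0 < e / 4 by lra.
have [s sP] := net _ e40.
have ws : mean_w mm (fun i => forall x, x \in s -> `|M (k x) - avg (sq i) (k x)| < e / 4).
  elim: (s) => [|x t IHt]; first by apply: filterE => i x; rewrite in_nil.
  have Fw : Filter (mean_w mm) by apply: filter_filter.
  have := @filterI _ _ Fw _ _ IHt (ulim_near (mean_ultra mm) (bounded_avg mm (bk x)) e40).
  by apply: filterS => i [h1 h2] z; rewrite inE => /predU1P[->|/h1].
apply: filterS ws => i hi.
have -> : avg (sq i) (fun y => M (k^~ y)) = M (fun x => avg (sq i) (k x)).
  rewrite /avg -[in RHS]/(fun x => _).
  transitivity (M (fun x => (size (sq i))%:R^-1 * \sum_(y <- sq i) k x y)).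
    rewrite meanZ; last first.
      elim: (sq i) => [|y t [c IHt]]; first by exists 0 => x; rewrite big_nil normr0.
      have [d dP] := boundedD (bk' y) (ex_intro _ c IHt).
      by exists d => x; rewrite big_cons.
    by rewrite mean_sum// mulrC.
  by congr mval; apply/funext => x; rewrite mulrC.
have ba : bounded (fun x => avg (sq i) (k x)).
  by exists B => x; apply: avg_bounded => //; exact: mean_size.
rewrite -meanB//; apply: le_lt_trans (_ : e / 4 + e / 4 + e / 4 < e); last by lra.
apply: mean_norm => x; have [x' x's xx'] := sP x.
have h1 : `|M (k x) - M (k x')| <= e / 4 by rewrite -meanB//; exact: mean_norm.
have h2 : `|avg (sq i) (k x') - avg (sq i) (k x)| <= e / 4.
  have -> : avg (sq i) (k x') - avg (sq i) (k x) = avg (sq i) (fun y => k x' y - k x y).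
    by rewrite avgD -[X in _ = _ + X]/(avg (sq i) (fun y => - k x y)) -mulN1r -avgZ;
       congr (_ + avg _ _); apply/funext => y; rewrite mulN1r.
  by apply: avg_bounded => [|y]; [exact: mean_size|rewrite distrC].
have h3 := ltW (hi x' x's).
rewrite -(subrKA (M (k x'))); apply: le_trans (ler_normD _ _) _.
rewrite -(subrKA (avg (sq i) (k x')) (M (k x'))).
have := ler_normD (M (k x') - avg (sq i) (k x')) (avg (sq i) (k x') - avg (sq i) (k x)).
by move: h1 h2 h3; set p := `|_|; set q := `|_|; set r := `|_|; set t := `|_|; lra.
Qed.

Lemma mean_sqr_gt0 (u : K -> R) x0 : continuous u -> u x0 != 0 ->
  0 < M (fun x => u x ^+ 2).
Proof.
move=> uC u0; have bu := continuous_bounded cK uC.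
have uuC : continuous (fun x => u x * u x) by move=> x; apply: cvgM; exact: uC.
have p0 : 0 < u x0 ^+ 2 by rewrite lt_neqAle sqr_ge0 andbT eq_sym sqrf_eq0.
have U0 : nbhs x0 [set x | u x0 ^+ 2 / 2 < u x ^+ 2].
  apply: (uuC x0 [set r | u x0 ^+ 2 / 2 < r]); apply: open_nbhs_nbhs; split.
    exact: open_gt.
  by rewrite /= -expr2; lra.
have hb2 : bounded (fun x => u x ^+ 2) by exact: boundedM.
apply: (@mean_nbhs_gt0 R K mm cK _ x0 _ (u x0 ^+ 2 / 2) U0 hb2).
- by move=> x; exact: sqr_ge0.
- by lra.
- by move=> x /= /ltW.
Qed.

End ContinuousOnCompact.

Section Convolution.
Variables (R : realType) (K : topologicalZmodType).
Hypothesis cK : compact [set: K].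
Variables (mm : mean R K) (h : K -> R).
Hypotheses (hC : continuous h) (hN : forall x, h (- x) = h x).
Local Notation M := (mval mm).
Implicit Types u v : K -> R.

Definition conv u x : R := M (fun y => h (x - y) * u y).

Let bh : bounded h. Proof. exact: continuous_bounded. Qed.

Let hx_bounded x : bounded (fun y => h (x - y)).
Proof. exact: (bounded_comp (fun y => x - y) bh). Qed.

Let hu_bounded u x : bounded u -> bounded (fun y => h (x - y) * u y).
Proof. exact: boundedM. Qed.

Lemma translate_continuous (f : K -> R) a : continuous f -> continuous (fun x => f (x + a)).
Proof.
move=> fC x; apply: (@continuous_comp _ _ _ (fun x => x + a) f); last exact: fC.
move=> U; rewrite [x + a]addrC -nbhs_shift => Ux.
by apply: filterS Ux => y /=; rewrite addrC.
Qed.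

Lemma conv_lip u x x' (e : R) : bounded u -> 0 <= e ->
  (forall y, `|h (x - y) - h (x' - y)| <= e) ->
  (conv u x - conv u x') ^+ 2 <= e ^+ 2 * M (fun y => u y ^+ 2).
Proof.
move=> bu e0 he; rewrite /conv -meanB; [|exact: hu_bounded..].
rewrite (_ : (fun y => _) = (fun y => (h (x - y) - h (x' - y)) * u y)); last first.
  by apply/funext => y; rewrite mulrBl.
apply: le_trans (cauchy_schwarz mm (boundedB (hx_bounded x) (hx_bounded x')) bu) _.
have bu2 : bounded (fun y => u y ^+ 2) by exact: boundedM.
rewrite ler_wpM2r//; first by apply: mean_ge0 => // y; exact: sqr_ge0.
rewrite -[X in _ <= X](mean_cst mm); apply: mean_le; [|exact: bounded_cst|].
  by apply: boundedM; apply: boundedB; exact: hx_bounded.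
by move=> y; rewrite -(real_normK (num_real _)) lerXn2r ?nnegrE.
Qed.

Lemma h_uniform (e : R) : 0 < e -> exists2 V, nbhs (0 : K) V &
  forall x x', V (x' - x) -> forall y, `|h (x - y) - h (x' - y)| <= e.
Proof.
move=> e0; have [V V0 VP] := uniformly_continuous cK hC e0.
by exists V => // x x' Vx y; apply: VP; rewrite opprB addrA subrK.
Qed.

Lemma sqr_lt_norm (a e : R) : 0 <= e -> a ^+ 2 <= e ^+ 2 -> `|a| <= e.
Proof.
move=> e0; rewrite -(real_normK (num_real a)) => h2.
by rewrite -(@ler_pXn2r _ 2) ?nnegrE.
Qed.

Lemma conv_uniform (e : R) : 0 < e -> exists2 V, nbhs (0 : K) V &
  forall u x x', bounded u -> M (fun y => u y ^+ 2) <= 1 -> V (x' - x) ->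
    `|conv u x - conv u x'| <= e.
Proof.
move=> e0; have [V V0 VP] := h_uniform e0; exists V => // u x x' bu u1 Vx.
apply: sqr_lt_norm (ltW e0) _; apply: le_trans (conv_lip bu (ltW e0) (VP _ _ Vx)) _.
by rewrite ler_piMr// exprn_ge0// ltW.
Qed.

Lemma conv_continuous u : bounded u -> continuous (conv u).
Proof.
move=> bu x; apply/cvgrPdist_le => e e0.
set c := M (fun y => u y ^+ 2).
have c0 : 0 <= c by apply: mean_ge0 => [|y]; [exact: boundedM | exact: sqr_ge0].
pose d := e / (c + 1); have d0 : 0 < d by rewrite divr_gt0//; lra.
have [V V0 VP] := h_uniform d0.
apply/nbhs_shift0; apply: filterS V0 => z Vz; apply: sqr_lt_norm (ltW e0) _.
apply: le_trans (conv_lip bu (ltW d0) (VP _ _ _)) _; first by rewrite addrAC subrr add0r.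
rewrite -/c (_ : e = d * (c + 1)); last by rewrite /d divfK// gt_eqF//; lra.
by rewrite (exprMn 2 d (c + 1)) ler_wpM2l ?exprn_ge0 ?(ltW d0)//; nra.
Qed.

Lemma convD u v x : bounded u -> bounded v ->
  conv (fun y => u y + v y) x = conv u x + conv v x.
Proof.
move=> bu bv; rewrite /conv -meanD; [|exact: hu_bounded..].
by congr mval; apply/funext => y; rewrite mulrDr.
Qed.

Lemma convZ a u x : bounded u -> conv (fun y => a * u y) x = a * conv u x.
Proof.
move=> bu; rewrite /conv -meanZ; last exact: hu_bounded.
by congr mval; apply/funext => y; rewrite mulrCA.
Qed.

Lemma conv_shift u a x : bounded u -> conv (fun y => u (y + a)) x = conv u (x + a).
Proof.
move=> bu; rewrite /conv -[RHS](mean_shift mm a); last exact: hu_bounded.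
by congr mval; apply/funext => y; rewrite opprD addrACA subrr addr0.
Qed.

Lemma conv_bound u x (H : R) : bounded u -> (forall y, `|h y| <= H) ->
  conv u x ^+ 2 <= H ^+ 2 * M (fun y => u y ^+ 2).
Proof.
move=> bu hH; apply: le_trans (cauchy_schwarz mm (hx_bounded x) bu) _.
have bu2 : bounded (fun y => u y ^+ 2) by exact: boundedM.
rewrite ler_wpM2r//; first by apply: mean_ge0 => // y; exact: sqr_ge0.
rewrite -[X in _ <= X](mean_cst mm); apply: mean_le; [|exact: bounded_cst|].
  by apply: boundedM; exact: hx_bounded.
move=> y; rewrite -(real_normK (num_real _)) lerXn2r ?nnegrE//.
exact: le_trans (normr_ge0 _) (hH 0).
Qed.

(** The kernel is symmetric since [h] is even, and uniform continuity provides
    the nets required by [fubini]. *)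
Lemma conv_sym u v : continuous u -> continuous v ->
  M (fun x => u x * conv v x) = M (fun x => conv u x * v x).
Proof.
move=> uC vC; have bu := continuous_bounded cK uC; have bv := continuous_bounded cK vC.
have [Bu Bu0 uB] : exists2 B : R, 0 < B & forall x, `|u x| <= B.
  have [B uB] := bu; exists (B + 1) => [|x]; first by have := le_trans (normr_ge0 _) (uB 0); lra.
  by apply: le_trans (uB x) _; lra.
have [Bv Bv0 vB] : exists2 B : R, 0 < B & forall x, `|v x| <= B.
  have [B vB] := bv; exists (B + 1) => [|x]; first by have := le_trans (normr_ge0 _) (vB 0); lra.
  by apply: le_trans (vB x) _; lra.
have [Bh Bh0 hB] : exists2 B : R, 0 < B & forall x, `|h x| <= B.
  have [B hB] := bh; exists (B + 1) => [|x]; first by have := le_trans (normr_ge0 _) (hB 0); lra.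
  by apply: le_trans (hB x) _; lra.
pose k x y := u x * h (x - y) * v y.
have kB x y : `|k x y| <= Bu * Bh * Bv by rewrite /k !normrM !ler_pM// mulr_ge0.
transitivity (M (fun x => M (k x))).
  congr mval; apply/funext => x; rewrite /conv -meanZ; last exact: hu_bounded.
  by congr mval; apply/funext => y; rewrite /k mulrA.
rewrite (fubini mm kB).
  congr mval; apply/funext => y; rewrite /conv mulrC -meanZ; last exact: hu_bounded.
  congr mval; apply/funext => x; rewrite /k -(hN (y - x)) opprB; ring.
move=> e e0; pose B := Bu * Bv + Bh * Bv + 1.
have B0 : 0 < B by rewrite /B; have := mulr_gt0 Bu0 Bv0; have := mulr_gt0 Bh0 Bv0; lra.
have eB : 0 < e / B by rewrite divr_gt0.
have [V V0 VP] := uniformly_continuous cK uC eB; have [W W0 WP] := h_uniform eB.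
have [|s [_ sP]] := @compact_cover_seq _ _ (fun x' x => (V `&` W) (x - x')) cK.
  move=> x _; apply/nbhs_shift0; apply: filterS (filterI V0 W0) => z.
  by rewrite addrAC subrr add0r.
exists s => x; have [x' x's [Vx Wx]] := sP x I; exists x' => // y.
have -> : k x y - k x' y = ((u x - u x') * h (x - y) + u x' * (h (x - y) - h (x' - y))) * v y.
  by rewrite /k; ring.
have h1 := VP _ _ Vx; have h2 := WP _ _ Wx y.
rewrite distrC in h1; rewrite distrC in h2.
rewrite normrM; apply: (@le_trans _ _ ((e / B * Bh + Bu * (e / B)) * Bv)).
  rewrite ler_pM//; apply: le_trans (ler_normD _ _) _.
  by rewrite !normrM lerD// ler_pM.
rewrite (_ : (e / B * Bh + Bu * (e / B)) * Bv = e / B * (Bu * Bv + Bh * Bv)); last by ring.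
rewrite -[X in _ <= X](divfK (lt0r_neq0 B0)) ler_pM2l// /B; lra.
Qed.

(** The largest eigenvalue [L] of the squared operator is the supremum of the
    mean of [conv u ^+ 2] over the [u] of norm at most one. For a maximizing
    sequence [un] the functions [wn = conv un] are equicontinuous, so that
    their ultralimit [v] is a uniform limit. In mean square [conv wn]
    approaches [L * un], and one more convolution turns this into uniform
    convergence, of [conv (conv wn)] to [L * v]. *)
Lemma conv_eigenvector : h 0 != 0 -> exists (L : R) v,
  [/\ 0 < L, continuous v, forall x, conv (conv v) x = L * v x & exists x, v x != 0].
Proof.
move=> h0; have [H hH] := bh.
have H0 : 0 <= H by exact: le_trans (normr_ge0 _) (hH 0).
pose N u := M (fun y => u y ^+ 2).
have Nge0 u : bounded u -> 0 <= N u.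
  by move=> bu; apply: mean_ge0 => [|y]; [exact: boundedM | exact: sqr_ge0].
pose S : set R := [set r | exists u, [/\ continuous u, N u <= 1 & r = N (conv u)]].
have bC u : continuous u -> bounded u by exact: continuous_bounded.
have cC u : continuous u -> continuous (conv u) by move=> /bC; exact: conv_continuous.
have Sub : has_ubound S.
  exists (H ^+ 2) => r [u [uC u1 ->]]; rewrite -[X in _ <= X](mean_cst mm).
  have bcu := bC _ (cC _ uC).
  apply: mean_le => [||x]; [exact: boundedM|exact: bounded_cst|].
  apply: le_trans (conv_bound x (bC _ uC) hH) _.
  by rewrite ler_piMr// exprn_ge0.
have S0 : S 0.
  have c00 : conv (fun=> 0) = fun=> 0.
    apply/funext => x; rewrite /conv -[RHS](mean_cst mm); congr mval.
    by apply/funext => y; rewrite mulr0.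
  exists (fun=> 0); split; first exact: cst_continuous.
    by rewrite /N expr0n /= mean_cst.
  by rewrite c00 /N expr0n/= mean_cst.
have Shas : has_sup S by split; [exists 0|].
pose L := sup S.
have Lub r : S r -> r <= L by move=> Sr; apply: sup_upper_bound.
have hom u : continuous u -> N (conv u) <= L * N u.
  move=> uC; have bu := bC _ uC; have [Nu|Nu] := eqVneq (N u) 0.
    rewrite Nu mulr0 /N (_ : (fun y => _) = fun=> 0) ?mean_cst//.
    apply/funext => x; apply/eqP; rewrite eq_le sqr_ge0 andbT.
    by apply: le_trans (conv_bound x bu hH) _; rewrite -/(N u) Nu mulr0.
  have Np : 0 < N u by rewrite lt_neqAle eq_sym Nu Nge0.
  pose t := Num.sqrt (N u); have t0 : 0 < t by rewrite sqrtr_gt0.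
  have t2 : t ^+ 2 = N u by rewrite sqr_sqrtr// ltW.
  pose u' y := t^-1 * u y.
  have u'C : continuous u' by move=> y; apply: cvgM; [exact: cvg_cst|exact: uC].
  have sc (f : K -> R) : bounded f -> N (fun y => t^-1 * f y) = t^-2 * N f.
    move=> bf; rewrite /N -meanZ; last exact: boundedM.
    by congr mval; apply/funext => y; rewrite exprMn exprVn.
  have Nu' : N u' = 1 by rewrite sc// t2 mulVf.
  have cu' : conv u' = fun y => t^-1 * conv u y by apply/funext => y; rewrite /u' convZ.
  have /Lub : S (N (conv u')) by exists u'; rewrite Nu'.
  rewrite cu' sc; last exact: (bC _ (cC _ uC)).
  by rewrite t2 ler_pdivrMl// mulrC.
have L0 : 0 < L.
  have Nh : 0 < N h by exact: (mean_sqr_gt0 cK mm hC h0).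
  have Nch : 0 < N (conv h).
    apply: (@mean_sqr_gt0 _ _ cK _ _ 0); first exact: cC.
    have -> : conv h 0 = N h.
      by rewrite /conv /N; congr mval; apply/funext => y; rewrite sub0r hN -expr2.
    exact: lt0r_neq0.
  have := lt_le_trans Nch (hom _ hC).
  by rewrite pmulr_lgt0.
have /choice[un unP] n : exists u, [/\ continuous u, N u <= 1 & L - n.+1%:R^-1 < N (conv u)].
  have n0 : 0 < n.+1%:R^-1 :> R by rewrite invr_gt0.
  by have [r [u [uC u1 ->]] ur] := sup_adherent n0 Shas; exists u.
have [w [uw wge]] := nat_ultra.
pose wn n := conv (un n).
have wC n : continuous (wn n) by apply: cC; have [] := unP n.
have wB n x : `|wn n x| <= H.
  have [uC u1 _] := unP n; apply: sqr_lt_norm (H0) _.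
  by apply: le_trans (conv_bound x (bC _ uC) hH) _; rewrite ler_piMr// exprn_ge0.
have bw x : bounded (fun n => wn n x) by exists H.
pose v x := ulim w (fun n => wn n x).
have vV (e : R) : 0 < e -> exists2 V, nbhs (0 : K) V & forall x x', V (x' - x) ->
    `|v x - v x'| <= e /\ forall n, `|wn n x - wn n x'| <= e.
  move=> e0; have [V V0 VP] := conv_uniform e0; exists V => // x x' Vx.
  have wnV n : `|wn n x - wn n x'| <= e by have [uC u1 _] := unP n; apply: VP => //; exact: bC.
  split=> //; rewrite /v -[ulim w (fun n => wn n x')]mul1r -mulNr -ulimZ// -ulimD//; last exact: boundedZ.
  have bd : bounded (fun n => wn n x + -1 * wn n x') by apply: boundedD => //; exact: boundedZ.
  rewrite ler_norml -{1}(ulim_cst uw (- e)) -{2}(ulim_cst uw e); apply/andP; split;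
    apply: ulim_le => //; try exact: bounded_cst;
    by apply: filterE => n; have := wnV n; rewrite mulN1r ler_norml => /andP[].
have vC : continuous v.
  move=> x; apply/cvgrPdist_le => e e0; have [V V0 VP] := vV e e0.
  apply/nbhs_shift0; apply: filterS V0 => z Vz.
  by have [] := VP x (x + z); rewrite // addrAC subrr add0r.
(* Equicontinuity and a finite net make the pointwise limit uniform. *)
have unif (e : R) : 0 < e -> w (fun n => forall x, `|v x - wn n x| <= e).
  move=> e0; have e40 : 0 < e / 4 by lra.
  have [V V0 VP] := vV _ e40.
  have [|s [_ sP]] := @compact_cover_seq _ _ (fun x' x => V (x - x')) cK.
    move=> x _; apply/nbhs_shift0; apply: filterS V0 => z.
    by rewrite addrAC subrr add0r.
  have ws : w (fun n => forall x, x \in s -> `|v x - wn n x| < e / 4).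
    elim: (s) => [|x t IHt]; first by apply: filterE => i x; rewrite in_nil.
    have Fw : Filter w by apply: filter_filter.
    have := @filterI _ _ Fw _ _ IHt (ulim_near uw (bw x) e40).
    by apply: filterS => i [h1 h2] z; rewrite inE => /predU1P[->|/h1].
  apply: filterS ws => n hn x; have [x' x's Vx] := sP x I; have [h1 h2] := VP _ _ Vx.
  have h3 := h2 n; have h4 := ltW (hn _ x's).
  rewrite -(subrKA (v x')); apply: le_trans (ler_normD _ _) _.
  rewrite -(subrKA (wn n x') (v x')).
  have := ler_normD (v x' - wn n x') (wn n x' - wn n x).
  rewrite distrC in h1.
  by move: h1 h3 h4; set p := `|_|; set q := `|_|; set r := `|_|; set t := `|_|; lra.
(* The limit is nonzero because the means of [wn n ^+ 2] tend to [L]. *)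
have Nv0 : exists x, v x != 0.
  have [//|nv] := pselect (exists x, v x != 0); exfalso.
  have v0 x : v x = 0 by apply/eqP/negPn/negP => vx; apply: nv; exists x.
  pose e := Num.min 1 (L / 4).
  have e0 : 0 < e by rewrite lt_min ltr01 divr_gt0.
  have [m [m0 mL]] := natmul_large 2 L0.
  have [n [hn nm]] := filter_ex (filterI (unif e e0) (wge m)).
  have [_ _ hN'] := unP n.
  have : N (wn n) <= e ^+ 2.
    rewrite -[X in _ <= X](mean_cst mm); apply: mean_le => [||x].
    - by have b := bC _ (wC n); exact: boundedM.
    - exact: bounded_cst.
    rewrite -(real_normK (num_real _)) lerXn2r ?nnegrE ?(ltW e0)//.
    by have := hn x; rewrite v0 sub0r normrN.
  have e1 : e <= 1 by rewrite ge_min lexx.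
  have eL : e <= L / 4 by rewrite ge_min lexx orbT.
  have : n.+1%:R^-1 <= L / 2.
    rewrite -[X in X <= _]mul1r ler_pdivrMr ?ltr0n//.
    have : m%:R <= n.+1%:R :> R by rewrite ler_nat (leq_trans nm).
    move: mL; set a := m%:R; set b := n.+1%:R => h1 h2; nra.
  move: hN'; rewrite -/(wn n); set a := N _; set b := _^-1 => h1 h2 h3; nra.
exists L, v; split=> // x.
have bv := bC _ vC.
have convH u y (e : R) : bounded u -> 0 <= e -> (forall z, `|u z| <= e) -> `|conv u y| <= H * e.
  move=> bu e0 ue; apply: mean_norm => z; rewrite normrM ler_pM//.
suff small (e : R) : 0 < e -> `|conv (conv v) x - L * v x| <= (H * H + L + 1) * e.
  apply/eqP; rewrite -subr_eq0 -normr_le0 leNgt; apply/negP => p0.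
  set c := H * H + L + 1 in small; have c0 : 0 < c by rewrite /c; nra.
  have := small (`|conv (conv v) x - L * v x| / (2 * c)); rewrite divr_gt0 ?mulr_gt0// => /(_ isT).
  have -> : c * (`|conv (conv v) x - L * v x| / (2 * c)) = `|conv (conv v) x - L * v x| / 2.
    by field; rewrite gt_eqF.
  lra.
move=> e0; have e2 : 0 < e ^+ 2 by rewrite exprn_gt0.
have [m [m0 me]] := natmul_large (H ^+ 2 * L) e2.
have [n [hn nm]] := filter_ex (filterI (unif e e0) (wge m)).
have bwn := bC _ (wC n).
have step1 : `|conv (conv v) x - conv (conv (wn n)) x| <= H * (H * e).
  have bcv := bC _ (cC _ vC); have bcw := bC _ (cC _ (wC n)).
  rewrite -[conv (conv (wn n)) x]mul1r -mulNr -convZ// -convD//; last exact: boundedZ.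
  apply convH; [by apply: boundedD => //; exact: boundedZ|by rewrite mulr_ge0// ltW|].
  move=> z; rewrite -convZ// -convD//; last exact: boundedZ.
  apply convH; [by apply: boundedD => //; exact: boundedZ|exact: ltW|].
  by move=> t; rewrite mulN1r.
have step2 : `|conv (conv (wn n)) x - L * wn n x| <= e.
  have [uC u1 uL] := unP n; rewrite -/(wn n) in uL.
  have bu := bC _ uC; have bcw := bC _ (cC _ (wC n)).
  pose g y := conv (wn n) y + - L * un n y.
  have gC : continuous g.
    by move=> y; apply: cvgD; [exact: cC|apply: cvgM; [exact: cvg_cst|exact: uC]].
  have bg := bC _ gC.
  have -> : conv (conv (wn n)) x - L * wn n x = conv g x.
    by rewrite /g convD//; [rewrite convZ// mulNr|exact: boundedZ].
  apply: sqr_lt_norm (ltW e0) _; apply: le_trans (conv_bound x bg hH) _.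
  (* Expand the square; the cross term is the mean of [wn n ^+ 2], by
     symmetry, which is nearly [L]. *)
  have Ng : M (fun y => g y ^+ 2) <= L / n.+1%:R.
    have -> : M (fun y => g y ^+ 2) = N (conv (wn n)) - 2 * L * N (wn n) + L ^+ 2 * N (un n).
      have sy : M (fun y => conv (wn n) y * un n y) = N (wn n).
        by rewrite -(conv_sym (wC n) uC).
      have b1 : bounded (fun y => conv (wn n) y ^+ 2) by exact: boundedM.
      have b2 : bounded (fun y => conv (wn n) y * un n y) by exact: boundedM.
      have b3 : bounded (fun y => un n y ^+ 2) by exact: boundedM.
      rewrite -sy /N -!meanZ// -meanB//; last exact: boundedZ.
      rewrite -meanD//; [|by apply: boundedB => //; exact: boundedZ|exact: boundedZ].
      by congr mval; apply/funext => y; rewrite /g; ring.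
    have h1 := hom _ (wC n); rewrite -[L / _]/(L * _).
    move: h1 u1 uL L0; set a := N _; set b := N _; set c := N _; set d := _^-1 => h1 h2 h3 h4.
    nra.
  apply: le_trans (_ : H ^+ 2 * (L / n.+1%:R) <= _); first by rewrite ler_wpM2l// exprn_ge0.
  rewrite mulrA ler_pdivrMr ?ltr0n// mulrC; apply: le_trans (ltW _) _; first by rewrite mulrC; exact: me.
  by rewrite [X in _ <= X]mulrC ler_pM2r// ler_nat (leq_trans nm).
have step3 : `|L * wn n x - L * v x| <= L * e.
  by rewrite -mulrBr normrM (gtr0_norm L0) ler_wpM2l ?(ltW L0)// distrC hn.
rewrite -(subrKA (conv (conv (wn n)) x)); apply: le_trans (ler_normD _ _) _.
rewrite -(subrKA (L * wn n x) (conv (conv (wn n)) x)).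
have := ler_normD (conv (conv (wn n)) x - L * wn n x) (L * wn n x - L * v x).
by move: step1 step2 step3; set p := `|_|; set q := `|_|; set r := `|_|; set t := `|_|; nra.
Qed.

End Convolution.

(** * Characters separate the points of a compact group *)

(** Induction on the dimension. If translation by some [y0] does not act as a
    scalar, let [l] be an eigenvalue of its matrix [A]. The family [F *m (A -
    l%:M)] is nonzero, takes values in a smaller space, and is again stable
    under translations because translations commute. *)
Lemma joint_eigenfunction (C : numClosedFieldType) (G : zmodType) n (F : G -> 'rV[C]_n) :
  (forall y, exists A : 'M[C]_n, forall x, F (x + y) = F x *m A) ->
  (exists x, F x != 0) ->
  exists r (L : 'M[C]_(n, r)), (exists x, F x *m L != 0) /\
    forall y, exists l, forall x, F (x + y) *m L = l *: (F x *m L).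
Proof.
have [m] := ubnP n; elim: m n F => // m IHm n F; rewrite ltnS => nm FM F0.
have [all|] := pselect (forall y, exists l, forall x, F (x + y) = l *: F x).
  exists n, 1%:M; split; first by have [x] := F0; exists x; rewrite mulmx1.
  by move=> y; have [l lP] := all y; exists l => x; rewrite !mulmx1.
move/existsNP => [y0 /forallNP ny0].
have [A AP] := FM y0.
have n0 : (0 < n)%N.
  by case: n F F0 {nm FM ny0 A AP} => // F [x]; rewrite (thinmx0 (F x)) eqxx.
have [l /eigenvalueP[v vA v0]] := eigenvalue_closed A n0.
pose B : 'M[C]_n := A - l%:M.
have rn : (\rank B < n)%N.
  rewrite ltn_neqAle rank_leq_row andbT; apply/eqP => rB.
  have Bfree : row_free B by rewrite /row_free rB.
  have : v *m B = 0 by rewrite mulmxBr vA mul_mx_scalar subrr.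
  by move/eqP; rewrite mulmx_free_eq0// (negPf v0).
have FB x : F x *m B = F (x + y0) - l *: F x.
  by rewrite mulmxBr -AP mul_mx_scalar.
have [r [cb [rb [{}rn rfree cbrb]]]] : exists r (cb : 'M[C]_(n, r)) (rb : 'M[C]_(r, n)),
    [/\ (r < n)%N, row_free rb & cb *m rb = B].
  by exists (\rank B), (col_base B), (row_base B); rewrite row_base_free mulmx_base.
have key x y D : (forall z, F (z + y) = F z *m D) -> F (x + y) *m B = F x *m B *m D.
  by move=> DP; rewrite !FB mulmxBl addrAC !DP -scalemxAl.
have [||s [L [[x L0] LP]]] := IHm r (fun x => F x *m cb) (leq_trans rn nm).
- move=> y; have [D DP] := FM y; exists (rb *m D *m pinvmx rb) => x.
  rewrite -[LHS](mulmxKp rfree) -[_ *m cb *m rb]mulmxA cbrb (key x y D)//.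
  by rewrite !mulmxA -[F x *m cb *m rb]mulmxA cbrb.
- apply: contrapT => /forallNP all0; apply: (ny0 l) => x.
  apply/eqP; rewrite -subr_eq0 -FB -cbrb mulmxA.
  by have /negP/negPn/eqP -> := all0 x; rewrite mul0mx.
exists s, (cb *m L); split; first by exists x; rewrite mulmxA.
by move=> y; have [l' l'P] := LP y; exists l' => z; rewrite !mulmxA; exact: l'P.
Qed.

Section CharacterFromEigenfunction.
Variables (R : realType) (K : topologicalZmodType).
Hypothesis cK : compact [set: K].
Variables (a b : K -> R).
Hypotheses (aC : continuous a) (bC : continuous b) (a0 : a 0 = 1) (b0 : b 0 = 0).
Hypotheses (aD : forall x y, a (x + y) = a x * a y - b x * b y)
  (bD : forall x y, b (x + y) = a x * b y + b x * a y).

(** The squared modulus is multiplicative and bounded, so it is at most 1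
    everywhere; at [x] and at [- x] its values are inverse to each other. *)
Lemma unit_modulus x : a x ^+ 2 + b x ^+ 2 = 1.
Proof.
pose m x := a x ^+ 2 + b x ^+ 2.
have mD y z : m (y + z) = m y * m z by rewrite /m aD bD; ring.
have m0 : m 0 = 1 by rewrite /m a0 b0; ring.
have [B mB] : exists B : R, forall y, m y <= B.
  have [A aA] := continuous_bounded cK aC; have [B bB] := continuous_bounded cK bC.
  exists (A ^+ 2 + B ^+ 2) => y; rewrite /m -(real_normK (num_real (a y))).
  rewrite -(real_normK (num_real (b y))) lerD// lerXn2r ?nnegrE//.
    exact: le_trans (aA y).
  exact: le_trans (bB y).
have mge0 y : 0 <= m y by rewrite /m addr_ge0 ?sqr_ge0.
have mX y n : m (y *+ n) = m y ^+ n.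
  by elim: n => [|n IHn]; rewrite ?mulr0n ?m0// mulrS mD IHn exprS.
have mle1 y : m y <= 1.
  rewrite leNgt; apply/negP => m1.
  have d0 : 0 < m y - 1 by lra.
  have [n [_ nB]] := natmul_large B d0.
  have := mB (y *+ n); rewrite mX leNgt => /negP; apply; apply: lt_le_trans nB _.
  have : 1 + n%:R * (m y - 1) <= m y ^+ n.
    elim: n => [|n IHn]; first by rewrite mul0r addr0 expr0.
    rewrite exprS -natr1; move: IHn (ler0n R n); set u := n%:R; set p := _ ^+ n => h1 h2.
    have h3 := mulr_ge0 h2 (sqr_ge0 (m y - 1)).
    have h4 := ler_wpM2l (mge0 y) h1.
    nra.
  by lra.
have := mD x (- x); rewrite subrr m0 => h.
have := mle1 x; have := mle1 (- x); have := mge0 x; have := mge0 (- x); rewrite -/(m x).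
by move: h; set u := m x; set v := m (- x); nra.
Qed.

Lemma angle_ex x : exists t, [/\ `|t| <= 2^-1, cos (2 * pi * t) = a x & sin (2 * pi * t) = b x].
Proof.
have u := unit_modulus x; have pi0 := pi_gt0 R.
have a1 : -1 <= a x <= 1.
  have : 0 <= b x ^+ 2 by exact: sqr_ge0.
  by move=> h; apply/andP; split; nra.
have [/andP[t0 tpi] ct] := acos_def a1; set t := acos (a x) in t0 tpi ct *.
have st : sin t ^+ 2 = b x ^+ 2 by rewrite sin2cos2 ct -u; ring.
have st0 : 0 <= sin t by apply: sin_ge0_pi; rewrite t0.
have c0 : 2 * pi != 0 :> R by rewrite mulf_neq0// gt_eqF.
have tb : `|t / (2 * pi)| <= 2^-1.
  rewrite ger0_norm ?divr_ge0 ?mulr_ge0 ?(ltW pi0)//.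
  by rewrite ler_pdivrMr ?mulr_gt0//; lra.
have tE : 2 * pi * (t / (2 * pi)) = t by rewrite mulrC divfK.
have [bp|bn] := lerP 0 (b x).
  exists (t / (2 * pi)); rewrite tE; split=> //.
  by apply/eqP; rewrite -(@eqrXn2 _ 2) ?st.
exists (- (t / (2 * pi))); rewrite normrN mulrN tE cosN sinN; split=> //.
apply: (canLR opprK); apply/eqP; rewrite -(@eqrXn2 _ 2) ?st ?sqrrN//.
by rewrite oppr_ge0 ltW.
Qed.

(** The angle of the complex number [(a x, b x)] is additive modulo integers
    by the addition formulas, and continuous since it is within 1/4 of zero
    where [a] is positive. *)
Lemma eigenfunction_char : exists chi : chom K (circle R),
  forall x, chi x = 0 -> a x = 1 /\ b x = 0.
Proof.
have /choice[t tP] := angle_ex.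
pose f x := cpi R (t x).
have fD x y : f (x + y) = f x + f y.
  have [_ cx sx] := tP x; have [_ cy sy] := tP y; have [_ cxy sxy] := tP (x + y).
  rewrite /f -homD; apply/eqP; rewrite -subr_eq0 -homB; apply/eqP/cosT_eq1.
  rewrite cosT_cpi (mulrBr (2 * pi)) cosB (mulrDr (2 * pi)) cxy sxy aD bD cosD sinD cx sx cy sy.
  have ux := unit_modulus x; have uy := unit_modulus y.
  transitivity ((a x ^+ 2 + b x ^+ 2) * (a y ^+ 2 + b y ^+ 2)); first by ring.
  by rewrite ux uy mulr1.
have fB : zmod_morphism f.
  by move=> x y; apply: (addIr (f y)); rewrite -fD !subrK.
have fC : continuous f.
  apply: hom_circle_continuous => //.
  have : nbhs 0 [set x | 0 < a x].
    have a0C : {for 0, continuous a} by exact: aC.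
    by apply: (a0C [set r : R | 0 < r]); apply: open_nbhs_nbhs; split; [exact: open_gt|rewrite /= a0].
  apply: filterS => x /= ax; apply: cball_cpi; have [t2 cx _] := tP x.
  rewrite leNgt; apply/negP => t4; move: ax; rewrite -cx.
  have -> : cos (2 * pi * t x) = cos (2 * pi * `|t x|).
    by case: (ger0P (t x)) => // _; rewrite mulrN cosN.
  have pi0 := pi_gt0 R.
  have -> : 2 * pi * `|t x| = pi - (pi - 2 * pi * `|t x|) by ring.
  rewrite cosB cospi sinpi mul0r addr0 mulN1r oppr_gt0 => /lt_geF.
  rewrite cos_ge0_pihalf//; apply/andP; split; nra.
exists (mkhom fB fC) => x /= fx; have [_ cx sx] := tP x.
have ax : a x = 1 by rewrite -cx -cosT_cpi -/(f x) fx cosT0.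
split=> //; have := unit_modulus x; rewrite ax expr1n => h.
by apply/eqP; rewrite -sqrf_eq0; apply/eqP; lra.
Qed.

End CharacterFromEigenfunction.

Section PeterWeyl.
Variables (R : realType) (K : topologicalZmodType).
Hypotheses (cK : compact [set: K]) (hK : hausdorff_space K).
Local Notation T := (circle R).

Section Eigenspace.
Variables (mm : mean R K) (h : K -> R) (L : R).
Hypotheses (hC : continuous h) (hN : forall x, h (- x) = h x) (L0 : 0 < L).
Local Notation M := (mval mm).
Local Notation cv := (conv mm h).

Definition eigenfun (u : K -> R) := continuous u /\ forall x, cv (cv u) x = L * u x.

Let cb (u : K -> R) : continuous u -> bounded u. Proof. exact: (continuous_bounded cK). Qed.
Let cC (u : K -> R) : continuous u -> continuous (cv u).
Proof. by move=> /cb bu x; exact: (conv_continuous cK hC bu). Qed.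

Lemma eigenfunD u v : eigenfun u -> eigenfun v -> eigenfun (fun x => u x + v x).
Proof.
move=> [uC uE] [vC vE]; split; first by move=> x; apply: cvgD; [exact: uC|exact: vC].
move=> x; rewrite (_ : cv (fun x => u x + v x) = fun x => cv u x + cv v x).
  by rewrite (convD cK mm hC); [rewrite uE vE mulrDr|exact: cb (cC _)..].
by apply/funext => y; rewrite (convD cK mm hC)//; exact: cb.
Qed.

Lemma eigenfunZ c u : eigenfun u -> eigenfun (fun x => c * u x).
Proof.
move=> [uC uE]; split.
  by move=> x; apply: cvgM; [exact: cvg_cst|exact: uC].
move=> x; rewrite (_ : cv (fun x => c * u x) = fun x => c * cv u x).
  by rewrite (convZ cK mm hC); [rewrite uE mulrCA|exact: cb (cC _)].
by apply/funext => y; rewrite (convZ cK mm hC)//; exact: cb.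
Qed.

Lemma eigenfun_shift u a : eigenfun u -> eigenfun (fun x => u (x + a)).
Proof.
move=> [uC uE]; split; first exact: translate_continuous.
move=> x; rewrite (_ : cv (fun x => u (x + a)) = fun x => cv u (x + a)).
  by rewrite (conv_shift cK mm hC); [rewrite uE|exact: cb (cC _)].
by apply/funext => y; rewrite (conv_shift cK mm hC)//; exact: cb.
Qed.

Lemma eigenfun0 : eigenfun (fun=> 0).
Proof.
split=> [|x]; first exact: cst_continuous.
have c0 : cv (fun=> 0) = fun=> 0.
  apply/funext => y; rewrite /conv -[RHS](mean_cst mm); congr mval.
  by apply/funext => z; rewrite mulr0.
by rewrite !c0 mulr0.
Qed.

Lemma eigenfun_sum n (c : 'I_n -> R) (e : 'I_n -> K -> R) :
  (forall i, eigenfun (e i)) -> eigenfun (fun x => \sum_i c i * e i x).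
Proof.
move=> eE; elim: (index_enum _) => [|i s IHs].
  by under eq_fun do rewrite big_nil; exact: eigenfun0.
under eq_fun do rewrite big_cons; apply: eigenfunD => //; exact: eigenfunZ.
Qed.

Definition orthonormal n (e : 'I_n -> K -> R) :=
  (forall i, eigenfun (e i)) /\ forall i j, M (fun x => e i x * e j x) = (i == j)%:R.

Lemma bessel n (e : 'I_n -> K -> R) f : orthonormal e -> bounded f ->
  \sum_i M (fun x => f x * e i x) ^+ 2 <= M (fun x => f x ^+ 2).
Proof.
move=> [eE eo] bf; pose c i := M (fun x => f x * e i x).
have be i : bounded (e i) by apply: cb; have [] := eE i.
pose g x := \sum_i c i * e i x.
have bg : bounded g by apply: cb; have [] := eigenfun_sum c eE.
have fg : M (fun x => f x * g x) = \sum_i c i ^+ 2.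
  rewrite (_ : (fun x => f x * g x) = fun x => \sum_i c i * (f x * e i x)).
    rewrite mean_sum; last by move=> i; apply: boundedZ; exact: boundedM.
    by apply: eq_bigr => i _; rewrite meanZ ?expr2//; exact: boundedM.
  by apply/funext => x; rewrite /g mulr_sumr; apply: eq_bigr => i _; rewrite mulrCA.
have gg : M (fun x => g x ^+ 2) = \sum_i c i ^+ 2.
  rewrite (_ : (fun x => g x ^+ 2) = fun x => \sum_i c i * (g x * e i x)); last first.
    by apply/funext => x; rewrite expr2 {2}/g mulr_sumr; apply: eq_bigr => i _; rewrite mulrCA.
  rewrite mean_sum; last by move=> i; apply: boundedZ; exact: boundedM.
  apply: eq_bigr => i _; rewrite meanZ ?expr2; last exact: boundedM.
  congr (_ * _); rewrite (_ : (fun x => g x * e i x) = fun x => \sum_j c j * (e j x * e i x)).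
    rewrite mean_sum; last by move=> j; apply: boundedZ; exact: boundedM.
    rewrite (bigD1 i)//= meanZ; last exact: boundedM.
    rewrite eo eqxx mulr1 big1 ?addr0// => j /negPf ji.
    by rewrite meanZ ?eo ?ji ?mulr0//; exact: boundedM.
  by apply/funext => x; rewrite /g mulr_suml; apply: eq_bigr => j _; rewrite mulrA.
have b1 : bounded (fun x => f x ^+ 2) by exact: boundedM.
have b2 : bounded (fun x => f x * g x) by exact: boundedM.
have b3 : bounded (fun x => g x ^+ 2) by exact: boundedM.
have : 0 <= M (fun x => (f x - g x) ^+ 2).
  by apply: mean_ge0 => [|x]; [apply: boundedM; exact: boundedB|exact: sqr_ge0].
rewrite (_ : (fun x => (f x - g x) ^+ 2) = fun x => (f x ^+ 2 - 2 * (f x * g x)) + g x ^+ 2).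
  rewrite meanD//; last by apply: boundedB => //; exact: boundedZ.
  rewrite meanB//; last exact: boundedZ.
  by rewrite meanZ// fg gg -/(c _); set s := \sum_i _; lra.
by apply/funext => x; ring.
Qed.

(** Bessel's inequality for the convolution of [h (x - _)], whose coefficients
    on the family are the [L * e i x], bounds the sum of the [(L * e i x) ^+
    2] uniformly in [x]. The mean over [x] of this sum is [n * L ^+ 2]. *)
Lemma orthonormal_bound : exists m : nat, forall n (e : 'I_n -> K -> R), orthonormal e -> (n <= m)%N.
Proof.
have [H hH] := cb hC.
have H0 : 0 <= H by exact: le_trans (normr_ge0 _) (hH 0).
have [m [_ mP]] := natmul_large (H ^+ 2 * H ^+ 2) (exprn_gt0 2 L0).
exists m => n e [eE eo].
have be i : bounded (e i) by apply: cb; have [] := eE i.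
have pointwise x : \sum_i (L * e i x) ^+ 2 <= H ^+ 2 * H ^+ 2.
  pose hx y := h (x - y).
  have hxC : continuous hx.
    move=> y; apply: (@continuous_comp _ _ _ (fun y => x - y) h); last exact: hC.
    by apply: (@continuousB_at K K (fun=> x) id); [exact: cvg_cst|exact: cvg_id].
  have bhx := cb hxC.
  have cx : continuous (cv hx) by exact: cC.
  have hx2 : M (fun y => hx y ^+ 2) <= H ^+ 2.
    rewrite -[X in _ <= X](mean_cst mm); apply: mean_le => [||y]; [exact: boundedM|exact: bounded_cst|].
    by rewrite -(real_normK (num_real (hx y))) lerXn2r ?nnegrE//; exact: hH.
  apply: le_trans (_ : M (fun y => cv hx y ^+ 2) <= _).
    apply: le_trans (bessel (conj eE eo) (cb cx)); rewrite le_eqVlt; apply/orP; left; apply/eqP.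
    apply: eq_bigr => i _; congr (_ ^+ 2); have [eC eL] := eE i.
    by rewrite -eL -conv_sym//; exact: cC.
  rewrite -[X in _ <= X](mean_cst mm); apply: mean_le => [||y]; [by have := cb cx; move=> ?; exact: boundedM|exact: bounded_cst|].
  apply: le_trans (conv_bound cK mm hC y bhx hH) _.
  by rewrite ler_wpM2l ?exprn_ge0.
have : M (fun x => \sum_i (L * e i x) ^+ 2) <= H ^+ 2 * H ^+ 2.
  rewrite -[X in _ <= X](mean_cst mm); apply: mean_le => //; last exact: bounded_cst.
  exists (H ^+ 2 * H ^+ 2) => x; rewrite ger0_norm//.
  by apply: sumr_ge0 => i _; exact: sqr_ge0.
rewrite mean_sum; last by move=> i; apply: boundedM; exact: boundedZ.
rewrite (eq_bigr (fun=> L ^+ 2)); last first.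
  move=> i _; rewrite (_ : (fun x => _) = fun x => L ^+ 2 * (e i x * e i x)).
    by rewrite meanZ ?eo ?eqxx ?mulr1//; exact: boundedM.
  by apply/funext => x; ring.
rewrite sumr_const card_ord -mulr_natl => h1.
rewrite -(ler_nat R); rewrite -(ler_pM2r (exprn_gt0 2 L0)).
by apply: le_trans h1 _; exact: ltW.
Qed.

(** By [orthonormal_bound] there is a maximal orthonormal family, and it
    spans: otherwise the normalized remainder of some eigenfunction extends
    it. *)
Lemma orthonormal_basis : exists n (e : 'I_n -> K -> R), orthonormal e /\
  forall u, eigenfun u -> forall x, u x = \sum_i M (fun y => u y * e i y) * e i x.
Proof.
have [m mP] := orthonormal_bound.
suff : forall d n (e : 'I_n -> K -> R), (m < n + d)%N -> orthonormal e ->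
    exists n (e : 'I_n -> K -> R), orthonormal e /\
    forall u, eigenfun u -> forall x, u x = \sum_i M (fun y => u y * e i y) * e i x.
  by move=> /(_ m.+1 0%N (fun=> fun=> 0)); apply; rewrite ?add0n//; split=> -[].
elim=> [|d IHd] n e; first by rewrite addn0 ltnNge => /negP h1 /mP.
rewrite addnS -addSn => md oe.
have [all|] := pselect (forall u, eigenfun u -> forall x, u x = \sum_i M (fun y => u y * e i y) * e i x).
  by exists n, e.
move=> /existsNP[u /not_implyP[uE /existsNP[x0 ux0]]].
have [eE eo] := oe.
have be i : bounded (e i) by apply: cb; have [] := eE i.
have bu : bounded u by apply: cb; have [] := uE.
pose v x := u x + \sum_i - M (fun y => u y * e i y) * e i x.
have vE : eigenfun v by apply: eigenfunD => //; exact: eigenfun_sum.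
have bv : bounded v by apply: cb; have [] := vE.
have vx0 : v x0 != 0.
  apply/eqP => v0; apply: ux0; apply/eqP; rewrite -subr_eq0 -[X in _ == X]v0 /v -sumrN.
  by apply/eqP; congr (_ + _); apply: eq_bigr => i _; rewrite mulNr.
have [vC _] := vE.
have Np := mean_sqr_gt0 cK mm vC vx0; set N := M _ in Np.
pose t := (Num.sqrt N)^-1.
have t2 : t ^+ 2 = N^-1 by rewrite exprVn sqr_sqrtr// ltW.
have ve j : M (fun x => v x * e j x) = 0.
  rewrite (_ : (fun x => _) = fun x => u x * e j x + \sum_i - M (fun y => u y * e i y) * (e i x * e j x)).
    rewrite meanD; [|exact: boundedM|].
      rewrite mean_sum; last by move=> i; apply: boundedZ; exact: boundedM.
      rewrite (bigD1 j)//= meanZ ?eo ?eqxx ?mulr1; last exact: boundedM.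
      rewrite big1 ?addr0 ?subrr// => i /negPf ij.
      by rewrite meanZ ?eo ?ij ?mulr0//; exact: boundedM.
    elim: (index_enum _) => [|i s [c IHs]]; first by exists 0 => x; rewrite big_nil normr0.
    have b1 : bounded (fun x => - M (fun y => u y * e i y) * (e i x * e j x)).
      by apply: boundedZ; exact: boundedM.
    have [d' d'P] := boundedD b1 (ex_intro _ c IHs).
    by exists d' => x; rewrite big_cons.
  apply/funext => x; rewrite /v mulrDl mulr_suml; congr (_ + _).
  by apply: eq_bigr => i _; rewrite mulrA.
pose e' (i : 'I_n.+1) := if unlift ord_max i is Some j then e j else fun x => t * v x.
apply: (IHd n.+1 e' md); split.
  by move=> i; rewrite /e'; case: unliftP => [j|] _ //; exact: eigenfunZ.
have tve j : M (fun x => t * v x * e j x) = 0.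
  rewrite (_ : (fun x => _) = fun x => t * (v x * e j x)).
    by rewrite meanZ ?ve ?mulr0//; exact: boundedM.
  by apply/funext => x; rewrite mulrA.
move=> i j; rewrite /e'.
case: (unliftP ord_max i) => [i'|] ->; case: (unliftP ord_max j) => [j'|] ->.
- by rewrite eo (inj_eq (@lift_inj _ _)).
- rewrite (_ : (fun x => _) = fun x => t * v x * e i' x).
    by rewrite tve eq_sym (negPf (neq_lift _ _)).
  by apply/funext => x; rewrite mulrC.
- by rewrite tve (negPf (neq_lift _ _)).
rewrite eqxx (_ : (fun x => _) = fun x => t ^+ 2 * v x ^+ 2).
  by rewrite meanZ; [rewrite t2 -/N mulVf// lt0r_neq0|exact: boundedM].
by apply/funext => x; ring.
Qed.

Import complex.

(** The eigenspace is finite-dimensional and stable under translations, so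
    over the complex numbers it contains a joint eigenfunction of all
    translations. Translated and normalized to have value 1 at zero, this is
    multiplicative; take its real and imaginary parts. *)
Lemma eigenspace_char u0 x0 : eigenfun u0 -> u0 x0 != 0 -> exists a b : K -> R,
  [/\ eigenfun a, eigenfun b, a 0 = 1 & b 0 = 0] /\
  (forall x y, a (x + y) = a x * a y - b x * b y) /\
  (forall x y, b (x + y) = a x * b y + b x * a y).
Proof.
move=> u0E u0x; have [n [e [[eE eo] eP]]] := orthonormal_basis.
pose toC (r : R) : R[i] := r%:C%C.
pose F x : 'rV[R[i]]_n := \row_i toC (e i x).
have [||r [L' [[x1 FL] FP]]] := @joint_eigenfunction R[i] K n F.
- move=> y; exists (\matrix_(i, j) toC (M (fun z => e j (z + y) * e i z))) => x.
  apply/rowP => j; rewrite !mxE.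
  have ej := eigenfun_shift y (eE j); rewrite (eP _ ej x) /toC rmorph_sum.
  by apply: eq_bigr => i _; rewrite !mxE rmorphM mulrC.
- exists x0; apply/eqP => /rowP F0; case/eqP: u0x; rewrite (eP _ u0E) big1// => i _.
  by have := F0 i; rewrite !mxE => /(congr1 (@complex.Re R)) /= ->; rewrite mulr0.
have [j FLj] : exists j, (F x1 *m L') 0 j != 0.
  by apply/rV0Pn.
pose G x : R[i] := (F x *m L') 0 j.
have Gne : G x1 != 0 by [].
pose lam y := G (x1 + y) / G x1.
have GP y x : G (x + y) = lam y * G x.
  have [l lP] := FP y.
  have GE z : G (z + y) = l * G z by rewrite /G lP mxE.
  by rewrite GE /lam GE mulfK.
pose c i := L' i j / G x1.
have lamE y : lam y = \sum_i toC (e i (x1 + y)) * c i.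
  rewrite /lam /G mxE mulr_suml; apply: eq_bigr => i _.
  by rewrite mxE /c mulrA.
have lamD x y : lam (x + y) = lam x * lam y.
  by rewrite {1}/lam addrA GP -mulrA mulrC.
have lam0 : lam 0 = 1 by rewrite /lam addr0 divff.
clearbody lam.
have ReD (z t : R[i]) : complex.Re (z + t) = complex.Re z + complex.Re t by case: z t => [? ?] [].
have ImD (z t : R[i]) : complex.Im (z + t) = complex.Im z + complex.Im t by case: z t => [? ?] [].
have ReM (z t : R[i]) : complex.Re (z * t) = complex.Re z * complex.Re t - complex.Im z * complex.Im t by case: z t => [? ?] [].
have ImM (z t : R[i]) : complex.Im (z * t) = complex.Re z * complex.Im t + complex.Im z * complex.Re t by case: z t => [? ?] [].
have Resum (s : 'I_n -> R[i]) : complex.Re (\sum_i s i) = \sum_i complex.Re (s i).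
  exact: (big_morph _ ReD (erefl _)).
have Imsum (s : 'I_n -> R[i]) : complex.Im (\sum_i s i) = \sum_i complex.Im (s i).
  exact: (big_morph _ ImD (erefl _)).
have aE y : complex.Re (lam y) = \sum_i complex.Re (c i) * e i (y + x1).
  rewrite lamE Resum; apply: eq_bigr => i _; rewrite ReM /= mul0r subr0.
  by rewrite mulrC addrC.
have bE y : complex.Im (lam y) = \sum_i complex.Im (c i) * e i (y + x1).
  rewrite lamE Imsum; apply: eq_bigr => i _; rewrite ImM /= mul0r addr0.
  by rewrite mulrC addrC.
exists (fun y => complex.Re (lam y)), (fun y => complex.Im (lam y)); split; last first.
  by split=> x y; rewrite lamD; [exact: ReM|exact: ImM].
split.
- rewrite (_ : (fun y => _) = fun y => \sum_i complex.Re (c i) * e i (y + x1)).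
    by apply: (@eigenfun_sum n (fun i => complex.Re (c i)) (fun i y => e i (y + x1))) => i; exact: eigenfun_shift.
  by apply/funext.
- rewrite (_ : (fun y => _) = fun y => \sum_i complex.Im (c i) * e i (y + x1)).
    by apply: (@eigenfun_sum n (fun i => complex.Im (c i)) (fun i y => e i (y + x1))) => i; exact: eigenfun_shift.
  by apply/funext.
- by rewrite lam0.
- by rewrite lam0.
Qed.

End Eigenspace.

(** Suppose that all characters kill [p]. Let [f] be continuous with [f p != f
    0], let [k] be its autocorrelation and [h x = 2 * k x - k (x + p) - k (x -
    p)]. Since [h 0] is the mean of [(f (x + p) - f x) ^+ 2], it is positive,
    so convolution by [h] has a positive eigenvalue whose eigenspace contains
    the real part of a character. That function is invariant under [p], while
    convolution by [h] kills all functions invariant under [p]. *)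
Theorem peter_weyl (p : K) : p != 0 -> exists chi : chom K T, chi p != 0.
Proof.
move=> p0; have [//|nchi] := pselect (exists chi : chom K T, chi p != 0); exfalso.
have chip (chi : chom K T) : chi p = 0 by apply/eqP/negPn/negP => h; apply: nchi; exists chi.
have [mm] := has_mean R K.
have [f [fC f01]] : exists f : K -> R, continuous f /\ f p != f 0.
  have nK := compact_normal hK cK.
  have cl (x : K) : closed [set x] by apply: compact_closed => //; exact: compact_set1.
  have p00 : [set p] `&` [set 0] = set0.
    by rewrite -subset0 => x [/= -> e]; rewrite e eqxx in p0.
  have /(@uniform_separatorP _ R)[f [fC _ fp f0]] := (@normal_separatorP R K).1 nK _ _ (cl p) (cl 0) p00.
  exists f; split=> //; have -> : f p = 0 by apply: fp; exists p.
  by have -> : f 0 = 1; [apply: f0; exists 0|rewrite eq_sym oner_neq0].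
have bf := continuous_bounded cK fC.
pose k x := mval mm (fun z => f (z + x) * f z).
have bfs x : bounded (fun z => f (z + x)) by exact: (bounded_comp (fun z => z + x) bf).
have kb x : bounded (fun z => f (z + x) * f z) by exact: boundedM.
have kC : continuous k.
  move=> x; apply/cvgrPdist_le => e e0; have [B fB] := bf.
  have B0 : 0 <= B by exact: le_trans (normr_ge0 _) (fB 0).
  have eB : 0 < e / (B + 1) by rewrite divr_gt0//; lra.
  have [V V0 VP] := uniformly_continuous cK fC eB.
  apply/nbhs_shift0; apply: filterS V0 => y Vy; rewrite /k -meanB//.
  apply: mean_norm => z; rewrite -mulrBl normrM; apply: (@le_trans _ _ (e / (B + 1) * B)).
    rewrite ler_pM//; apply: VP; rewrite opprD addrACA subrr add0r addrAC subrr add0r//.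
  by rewrite mulrAC ler_pdivrMr ?ler_wpM2l ?(ltW e0)//; lra.
have kN x : k (- x) = k x.
  rewrite /k -(mean_shift mm x)//; congr mval; apply/funext => z.
  by rewrite addrK mulrC.
pose h x := 2 * k x - k (x + p) - k (x - p).
have kTC a : continuous (fun x => k (x + a)) by exact: translate_continuous.
have hC : continuous h.
  move=> x; apply: cvgB; last exact: (kTC (- p)).
  by apply: cvgB; [apply: cvgM; [exact: cvg_cst|exact: kC]|exact: (kTC p)].
have hN x : h (- x) = h x.
  rewrite /h kN -(kN (- x + p)) -(kN (- x - p)) !opprD !opprK; ring.
have h0 : h 0 != 0.
  apply: lt0r_neq0.
  have gC : continuous (fun x => f (x + p) - f x).
    by move=> x; apply: cvgB; [exact: translate_continuous|exact: fC].
  have gp : f (0 + p) - f 0 != 0 by rewrite add0r subr_eq0.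
  have := mean_sqr_gt0 cK mm gC gp; rewrite (_ : (fun x => _) = fun x =>
      (f (x + p) * f (x + p) + f (x + 0) * f x) - 2 * (f (x + p) * f x)); last first.
    by apply/funext => x; rewrite addr0; ring.
  rewrite meanB; [|by apply: boundedD => //; exact: boundedM|exact: boundedZ].
  rewrite meanD// ; last exact: boundedM.
  rewrite meanZ// -/(k p) -/(k 0) (mean_shift mm p (boundedM bf bf)) /h add0r sub0r kN.
  have -> : mval mm (fun y => f y * f y) = k 0 by rewrite /k; congr mval; apply/funext => z; rewrite addr0.
  by lra.
have [L [v [L0 vC vE [x0 vx0]]]] := conv_eigenvector cK mm hC hN h0.
have [a [b [[[aC aE] [bC _] a0 b0] [aD bD]]]] :=
  eigenspace_char hC hN L0 (conj vC vE) vx0.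
have [chi chiP] := eigenfunction_char cK aC bC a0 b0 aD bD.
have [ap bp] := chiP p (chip chi).
have ainv y : a (y + p) = a y by rewrite aD ap bp mulr1 mulr0 subr0.
have ba := continuous_bounded cK aC; have bk := continuous_bounded cK kC.
have ca0 x : conv mm h a x = 0.
  have bka s : bounded (fun y => k (x - y + s) * a y).
    by apply: boundedM => //; exact: (bounded_comp (fun y => x - y + s) bk).
  have ks s : (forall y, a (y + s) = a y) ->
      mval mm (fun y => k (x - y + s) * a y) = mval mm (fun y => k (x - y) * a y).
    move=> sinv; rewrite -(mean_shift mm s (bka s)); congr mval; apply/funext => y.
    by rewrite sinv opprD addrA subrK.
  have ainvN y : a (y + - p) = a y by rewrite -(ainv (y + - p)) subrK.
  have bka0 : bounded (fun y => k (x - y) * a y).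
    by apply: boundedM => //; exact: (bounded_comp (fun y => x - y) bk).
  rewrite /conv (_ : (fun y => _) = fun y =>
      (2 * (k (x - y) * a y) - k (x - y + p) * a y) - k (x - y + - p) * a y).
    rewrite (meanB mm (boundedB (boundedZ _ bka0) (bka p)) (bka (- p))).
    rewrite (meanB mm (boundedZ _ bka0) (bka p)) (meanZ mm _ bka0) (ks p ainv) (ks (- p) ainvN).
    by move: (mval mm _) => q; lra.
  by apply/funext => y; rewrite /h; ring.
have := aE 0; rewrite a0 mulr1 => aE0.
have c0 : conv mm h (conv mm h a) 0 = 0.
  rewrite (_ : conv mm h a = fun=> 0); last by apply/funext.
  by rewrite /conv -[RHS](mean_cst mm); congr mval; apply/funext => z; rewrite mulr0.
by rewrite c0 in aE0; rewrite -aE0 ltxx in L0.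
Qed.

End PeterWeyl.

(** * Spaces of homomorphisms and the bidual *)

Section FunctionSpaces.
Variables (A B : topologicalZmodType).

(** Joint continuity is uniform over a compact set of arguments. *)
Lemma continuous_curry (X : topologicalType) (h : X -> chom A B) :
  (forall x a U, nbhs (h x a) U -> nbhs (x, a) [set z : X * A | U (h z.1 z.2)]) ->
  continuous h.
Proof.
move=> hP; apply: continuous_to_hom => x K O cK oO hK.
move/compact_near_coveringP : cK.
move=> /(_ X (nbhs x) (fun y a => O (h y a)) _) KP.
suff : \forall y \near x, K `<=` [set a | O (h y a)].
  by apply: filterS => y KO _ [a Ka <-]; exact: KO.
apply: KP => a Ka.
have [|[P Q] /= [Px Qa] PQ] := hP x a O.
  by apply: open_nbhs_nbhs; split=> //; apply: hK; exists a.
by exists (Q, P) => //= -[b y] /= [Qb Py]; exact: (PQ (y, b)).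
Qed.

(** The argument can be confined to a compact neighbourhood, where the
    compact-open topology controls it. *)
Lemma eval_nbhs (f : chom A B) a U : LCA A -> nbhs (f a) U ->
  nbhs (f, a) [set z : chom A B * A | U (z.1 z.2)].
Proof.
move=> lA Ufa; have [C [Ca cC _]] := LCA_nbhs_in lA (@filterT _ (nbhs a) _).
have [[P Q] /= [Pa Qf] PQ] := near_eval cC (nbhs_singleton Ca) Ufa.
exists (Q, P `&` C); first by split=> //; exact: filterI.
by move=> [g b] /= [Qg [Pb Cb]]; exact: (PQ (b, g)).
Qed.

Lemma hom_cvg (F : set_system (chom A B)) (L : chom A B) : Filter F ->
  (forall K O, compact K -> open O -> L @` K `<=` O -> F [set g : chom A B | g @` K `<=` O]) ->
  F --> L.
Proof.
move=> FF H.
have FL : (@hom_fun A B : chom A B -> {compact-open, A -> B}) @ F --> (L : {compact-open, A -> B}).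
  by apply/compact_open_cvgP => K O; exact: H.
move=> U; rewrite /= nbhsE => -[V [[V' oV' <-] /= VL] VU].
apply: (@filterS _ F FF _ _ VU); apply: FL; exact: open_nbhs_nbhs.
Qed.

(** The topology is defined by a subbasis. Near zero it has the expected
    basis, since homomorphisms that are small on two compact sets are small on
    their union. *)
Lemma hom_nbhs0_basis (U : set (chom A B)) : nbhs 0 U ->
  exists K V, [/\ compact K, nbhs 0 V & forall f : chom A B, (forall x, K x -> V (f x)) -> U f].
Proof.
pose F : set_system (chom A B) := [set U | exists K V, [/\ compact K, nbhs 0 V &
  forall f : chom A B, (forall x, K x -> V (f x)) -> U f]].
suff : F --> (0 : chom A B) by exact.
have FF : Filter F.
  split.
  - by exists set0, setT; split=> //; [exact: compact0|exact: filterT].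
  - move=> P Q [K [V [cK V0 KV]]] [K' [V' [cK' V'0 KV']]].
    exists (K `|` K'), (V `&` V'); split; [exact: compactU|exact: filterI|].
    move=> f fK; split; first by apply: KV => x Kx; have [] := fK x (or_introl Kx).
    by apply: KV' => x Kx; have [] := fK x (or_intror Kx).
  move=> P Q PQ [K [V [cK V0 KV]]]; exists K, V; split=> // f /KV; exact: PQ.
apply: hom_cvg => K O cK oO KO.
have [[x Kx]|K0] := pselect (exists x, K x).
  exists K, O; split=> //; last by move=> f fK _ [y Ky <-]; exact: fK.
  by apply: open_nbhs_nbhs; split=> //; apply: KO; exists x.
exists set0, setT; split; [exact: compact0|exact: filterT|].
by move=> f _ _ [y Ky <-]; case: K0; exists y.
Qed.

(** Ascoli's theorem for homomorphisms. An ultrafilter on [W] converges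
    pointwise; by equicontinuity the limit is continuous and the convergence
    is uniform on compact sets. *)
Lemma compact_homs (W : set (chom A B)) (P : A -> set B) : hausdorff_space B ->
  (forall a, compact (P a)) -> (forall f a, W f -> P a (f a)) ->
  (forall V, nbhs 0 V -> nbhs 0 (fun x => forall f, W f -> V (f x))) ->
  (forall l : chom A B, (forall a V, closed V -> (forall f, W f -> V (f a)) -> V (l a)) -> W l) ->
  compact W.
Proof.
move=> hB cP WP We Wl; rewrite compact_ultra => F UF FW.
have FF : Filter F by apply: filter_filter.
have lim_ex : forall a : A, exists b : B, (fun f : chom A B => f a : B) @ F --> b.
  move=> a; have Ua := @ultra_fmap _ _ (fun f : chom A B => f a) _ UF.
  have := cP a; rewrite compact_ultra => /(_ _ Ua)[|b [_ bP]]; last by exists b.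
  by apply: (@filterS _ F FF W) => // f Wf; exact: WP.
have [l lP'] := choice lim_ex.
have lP a (U : set B) : nbhs (l a) U -> F (fun f : chom A B => U (f a)).
  by move=> /(lP' a).
have Fex (X Y : set (chom A B)) : F X -> F Y -> exists2 f, X f & Y f.
  move=> FX FY; have PF : ProperFilter F by apply: ultra_proper.
  by have [f [Xf Yf]] := @filter_ex _ F PF _ (@filterI _ F FF _ _ FX FY); exists f.
have lB : zmod_morphism l.
  move=> x y.
  apply: hB => P1 Q1 Pn Qn.
  have [[U V] /= [Ux Vy] UV] :
      nbhs (l x, l y) [set z : B * B | Q1 (z.1 - z.2)] by exact: (@sub_continuous B (l x, l y)).
  have [f Pf [Uf Vf]] := Fex _ _ (lP _ _ Pn) (@filterI _ F FF _ _ (lP _ _ Ux) (lP _ _ Vy)).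
  by exists (f (x - y)); split=> //; rewrite homB; exact: (UV (f x, f y)).
have lcl a V : closed V -> (forall f, W f -> V (f a)) -> V (l a).
  move=> clV WV; apply: clV => U /lP FU.
  have [f Wf Uf] := Fex _ _ FW FU.
  by exists (f a); split=> //; exact: WV.
have lC : continuous l.
  apply: additive_continuous => // V V0; have [V' [V'0 clV' V'V]] := nbhs0_closed V0.
  apply: filterS (We _ V'0) => x xV; apply: V'V; exact: lcl.
pose L := mkhom lB lC; exists L; split; first exact: Wl.
apply: hom_cvg.
move=> K O cK oO LK; move/compact_near_coveringP : cK.
move=> /(_ _ F (fun (f : chom A B) a => O (f a)) _) KP.
suff : F (fun f : chom A B => K `<=` [set a | O (f a)]).
  by apply: (@filterS _ F FF) => f KO _ [a Ka <-]; exact: KO.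
apply: KP => a Ka.
have : nbhs (l a) O by apply: open_nbhs_nbhs; split=> //; apply: LK; exists a.
rewrite -nbhs_shift0 => /nbhs0_halve[V [V0 VN VO]].
have FV : F [set f : chom A B | V (f a - l a)].
  apply: (lP a [set b | V (b - l a)]); rewrite -nbhs_shift0.
  by apply: filterS V0 => z Vz /=; rewrite addrAC subrr add0r.
exists ((fun x => forall f, W f -> V (f (x - a))), W `&` [set f : chom A B | V (f a - l a)]).
  split; last exact: filterI.
  rewrite /= -nbhs_shift0; apply: filterS (We _ V0) => z zV f Wf.
  by rewrite [a + z]addrC addrK; exact: zV.
move=> [b f] /= [bV [Wf Vf]].
have -> : f b = l a + ((f a - l a) + f (b - a)).
  by rewrite homB addrA [l a + _]addrC subrK addrC subrK.
by apply: VO => //; exact: bV.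
Qed.

End FunctionSpaces.

Definition alpha_at (R : realType) (A : topologicalZmodType) (a : A) (chi : pdual R A) : circle R :=
  chi a.

Lemma alpha_atB (R : realType) (A : topologicalZmodType) (a : A) : zmod_morphism (@alpha_at R A a).
Proof. by []. Qed.

Lemma alpha_at_continuous (R : realType) (A : topologicalZmodType) (a : A) :
  continuous (@alpha_at R A a).
Proof.
apply: additive_continuous => [|V V0]; first exact: alpha_atB.
have : nbhs 0 [set f : chom A (circle R) | f @` [set a] `<=` V°].
  apply: open_nbhs_nbhs; split.
    by apply: hom_open; [exact: compact_set1|exact: open_interior].
  move=> _ [_ -> <-]; exact: V0.
by apply: filterS => f fV; exact: (interior_subset (fV (f a) (ex_intro2 _ _ a erefl erefl))).
Qed.

(** The canonical map to the bidual. *)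
Definition alpha_fun (R : realType) (A : topologicalZmodType) (a : A) : pdual R (pdual R A) :=
  mkhom (@alpha_atB R A a) (@alpha_at_continuous R A a).

Lemma alpha_funB (R : realType) (A : topologicalZmodType) : zmod_morphism (@alpha_fun R A).
Proof. by move=> x y; apply: homP => chi; exact: homB. Qed.

Lemma alpha_fun_continuous (R : realType) (A : topologicalZmodType) : LCA A ->
  continuous (@alpha_fun R A).
Proof.
move=> lA; apply: continuous_curry => a chi U /= Uchi.
have [[P Q] /= [Pchi Qa] PQ] := eval_nbhs lA Uchi.
by exists (Q, P) => //= -[b phi] /= [Qb Pphi]; exact: (PQ (phi, b)).
Qed.

Lemma nbhs_polar (A B : topologicalZmodType) (P : set A) (V : set B) : compact P ->
  nbhs 0 V -> nbhs (0 : chom A B) [set f | forall x, P x -> V (f x)].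
Proof.
move=> cP V0.
have : nbhs (0 : chom A B) [set f : chom A B | f @` P `<=` V°].
  apply: open_nbhs_nbhs; split; first by apply: hom_open => //; exact: open_interior.
  by move=> _ [x _ <-]; exact: V0.
by apply: filterS => f fV x Px; exact: (interior_subset (fV (f x) (ex_intro2 _ _ x Px erefl))).
Qed.

Lemma compact_bound (R : realType) (A : topologicalZmodType) (K : set A) (f : chom A R) :
  compact K -> exists M : R, forall x, K x -> `|f x| <= M.
Proof.
move=> cK.
have : compact (f @` K).
  apply: continuous_compact => //; apply: continuous_subspaceT; exact: hom_continuous.
move=> /compact_bounded[M [_ MP]]; exists (M + 1) => x Kx.
by apply: (MP (M + 1)); [rewrite ltrDl|exists x].
Qed.

(** Homomorphisms trivial on a fixed neighbourhood are equicontinuous for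
    free. *)
Lemma kill_compact (R : realType) (A : topologicalZmodType) (S : set A) : nbhs 0 S ->
  compact [set chi : chom A (circle R) | forall x, S x -> chi x = 0].
Proof.
move=> S0; apply: (@compact_homs A (circle R) _ (fun=> setT)) => //.
- exact: circle_hausdorff.
- by move=> _; exact: circle_compact.
- by move=> V V0; apply: filterS S0 => x Sx f /(_ x Sx) ->; exact: nbhs_singleton.
move=> l lP x Sx; apply: (lP x [set 0]); last by move=> f; exact.
exact: (compact_closed (@circle_hausdorff R) (@compact_set1 _ _)).
Qed.

Lemma nbhs_forall (I : finType) (X : topologicalType) (x : X) (P : I -> set X) :
  (forall i, nbhs x (P i)) -> nbhs x [set y | forall i, P i y].
Proof.
move=> xP; suff : forall s : seq I, nbhs x [set y | forall i, i \in s -> P i y].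
  by move=> /(_ (enum I)); apply: filterS => y yP i; apply: yP; rewrite mem_enum.
elim=> [|i s IHs]; first by apply: filterE.
apply: filterS (filterI (xP i) IHs) => y [Piy Py] j; rewrite inE => /predU1P[->//|]; exact: Py.
Qed.

(** If [`|r|] exceeds [d], some [t * r] with [`|t| <= 1] is a real number
    above [d] and at most 1/2, so its class is not in the ball. *)
Lemma small_slope (R : realType) (d r : R) : 0 <= d -> d < 2^-1 ->
  (forall t, `|t| <= 1 -> cball d (cpi R (t * r))) -> `|r| <= d.
Proof.
move=> d0 d2 H; rewrite leNgt; apply/negP => rx.
have r0 : r != 0 by rewrite -normr_gt0; exact: le_lt_trans rx.
pose q : R := Num.min `|r| 2^-1.
have q0 : 0 <= q by rewrite le_min normr_ge0 invr_ge0 ler0n.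
have qr : q <= `|r| by rewrite ge_min lexx.
have q2 : q <= 2^-1 by rewrite ge_min lexx orbT.
have q4 : d < q by rewrite lt_min rx.
have t1 : `|q / r| <= 1 by rewrite normf_div (ger0_norm q0) ler_pdivrMr ?normr_gt0// mul1r.
have := H _ t1; rewrite divfK// => /cpi_cball_lift; rewrite (ger0_norm q0) => h.
have : q <= d by apply: h; lra.
by rewrite leNgt q4.
Qed.

(** * Duality for a group with a lattice *)

(** The group [A] has three layers: [A / G], which is discrete, [G / N], which
    is compact, and the lattice [N], whose coordinates are the real
    homomorphisms [rho]. Each statement below treats them in turn. *)
Section LatticeDuality.
Variables (R : realType) (A : topologicalZmodType).
Local Notation T := (circle R).

Definition realchar (rho : chom A R) (t : R) : pdual R A :=
  comphom (cpi R) (comphom (scalehom t) rho).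

Lemma realcharB (rho : chom A R) : zmod_morphism (realchar rho).
Proof.
move=> s t; apply: homP => x.
transitivity (cpi R (s * rho x) - cpi R (t * rho x)); last by [].
by rewrite -homB -mulrBl.
Qed.

Lemma realchar_continuous (rho : chom A R) : continuous (realchar rho).
Proof.
apply: continuous_curry => t a U Uta.
have : nbhs (t * rho a) (cpi R @^-1` U) by exact: hom_nbhs.
have rc : (fun z : R * A => z.1 * rho z.2) @ (t, a) --> t * rho a.
  have c2 : {for (t, a), continuous (fun z : R * A => rho z.2)}.
    by apply: (@continuous_comp _ _ _ snd rho); [exact: cvg_snd|exact: hom_continuous].
  by apply: cvgM; [exact: cvg_fst|exact: c2].
by move=> /rc.
Qed.

(** The multiples [t * rho] of a real homomorphism, taken modulo integers,
    form a real line in the dual. *)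
Definition realline (rho : chom A R) : chom R (pdual R A) :=
  mkhom (realcharB rho) (@realchar_continuous rho).

Hypothesis hA : hausdorff_space A.
Variables (C : set A) (G N : zmodClosed A).
Hypotheses (cC : compact C) (C0 : nbhs 0 C) (CN : forall x, C x -> C (- x)).
Hypothesis GP : forall x, x \in G <-> exists n, sumset n C x.
Variables (k : nat) (e : 'I_k -> A) (rho : 'I_k -> chom A R) (n : nat).
Hypotheses (eG : forall i, e i \in G) (rhoe : forall i j, rho i (e j) = (i == j)%:R).
Hypothesis GC : forall x, x \in G -> exists c z, sumset n C c /\ x = c + \sum_i e i *~ z i.
Hypothesis NP : forall x, x \in N <-> exists z : 'I_k -> int, x = \sum_i e i *~ z i.

Let G0 : nbhs 0 (fun x => x \in G).
Proof. by apply: filterS C0 => x Cx; apply/GP; exists 1%N; exact: sumset1. Qed.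

Let rho_lattice i z : rho i (\sum_j e j *~ z j) = (z i)%:~R.
Proof.
rewrite hom_sum (bigD1 i)//= homMz rhoe eqxx big1 ?addr0// => j ji.
by rewrite homMz rhoe eq_sym (negPf ji) mul0rz.
Qed.

Let rhoint i x : x \in N -> rho i x \is a Num.int.
Proof. by move=> /NP[z ->]; rewrite rho_lattice intr_int. Qed.

Let N0 x : x \in N -> (forall i, rho i x = 0) -> x = 0.
Proof.
move=> /NP[z ->] z0; apply: big1 => i _.
by have := z0 i; rewrite rho_lattice => /eqP; rewrite intr_eq0 => /eqP ->; rewrite mulr0z.
Qed.

Let N_discrete : nbhs 0 [set x | x \in N -> x = 0].
Proof.
have : nbhs 0 [set x | forall i, `|rho i x| < 1].
  apply: nbhs_forall => i; have := hom_nbhs0 (rho i) (nbhs0_norm_lt (@ltr01 R)).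
  by apply: filterS.
apply: filterS => x x1 xN; apply: N0 => // i; have := x1 i.
have /intrP[z ->] := rhoint i xN.
by rewrite -intr_norm -[1]/(1%:~R) ltr_int => h; have -> : z = 0 by lia.
Qed.

Lemma lattice_closed : closed (fun x => x \in N).
Proof.
move=> x clx; have [V [V0 VN VD]] := nbhs0_halve N_discrete.
have near U : nbhs 0 U -> exists y, y \in N /\ U (y - x).
  move=> U0; have /clx[y [yN Uy]] : nbhs x (fun y => U (y - x)).
    by rewrite -nbhs_shift0; apply: filterS U0 => z Uz; rewrite addrAC subrr add0r.
  by exists y.
have [y [yN Vy]] := near V V0.
have [/eqP|yx] := eqVneq (y - x) 0; first by rewrite subr_eq0 => /eqP <-.
have [U U0 nU] := hausdorff_nbhs0P hA yx.
have [z [zN [Vz Uz]]] := near _ (filterI V0 U0).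
exfalso; apply: nU; suff -> : y = z by [].
apply/eqP; rewrite -subr_eq0; apply/eqP.
have -> : y - z = (y - x) + - (z - x) by rewrite opprB addrA subrK.
apply: (VD (y - x) (- (z - x))) => //; first exact: VN.
by rewrite opprB addrA subrK rpredB.
Qed.

Local Notation Q := (tquot N).
Local Notation K := (homim (comphom (tpi N) (sg_incl G))).

Let KP q : q \in K <-> exists2 x, x \in G & tpi N x = q.
Proof.
split=> [/asboolP[x _ <-]|[x xG <-]]; first by exists (sg_val x) => //; exact: sg_valP.
by apply/asboolP; exists (SGrp xG).
Qed.

Let hQ : hausdorff_space Q. Proof. exact: tquot_hausdorff lattice_closed. Qed.

Let K0 : nbhs 0 (fun q => q \in K).
Proof.
have := @tpi_nbhs _ N 0 _ G0; rewrite hom0; apply: filterS => _ [x xG <-].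
by apply/KP; exists x.
Qed.

Let cK : compact [set: sgrp K].
Proof.
have cS : compact (tpi N @` sumset n C).
  apply: continuous_compact; last exact: compact_sumset.
  by apply: continuous_subspaceT; exact: hom_continuous.
have -> : [set: sgrp K] = @sg_val _ K @^-1` (tpi N @` sumset n C).
  apply/seteqP; split=> // q _ /=; have /KP[x xG xq] := sg_valP q.
  have [c [z [cS' xE]]] := GC xG; exists c => //; rewrite -xq; apply/tpi_eqP.
  rewrite xE opprD addrA subrr add0r rpredN; apply/NP; by exists z.
apply: sg_compact => // _ [c cS' <-]; apply/KP; exists c => //; apply/GP; by exists n.
Qed.

(** Outside [G], use a character of the discrete group [A / G]. On [N],
    rescale one of the [rho i]. On the rest of [G], use a character of the
    compact group [G / N] and extend it from this open subgroup to [A / N]. *)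
Lemma lattice_enough_chars x : x != 0 -> exists chi : chom A T, chi x != 0.
Proof.
move=> x0; have [xG|xG] := boolP (x \in G); last first.
  have [g [gB gG gx]] := separating_hom R xG.
  have gC : continuous g.
    apply: hom_circle_continuous => //; apply: filterS G0 => y yG.
    by rewrite (gG y yG); exact: cball0.
  by exists (mkhom gB gC).
have [xN|xN] := boolP (x \in N).
  have [i xi] : exists i, rho i x != 0.
    apply: contrapT => /forallNP xi; case/eqP: x0; apply: N0 => // i.
    by apply/eqP/negPn/negP; exact: xi.
  exists (realchar (rho i) (2^-1 / rho i x)); apply/eqP => /= e0.
  have : cpi R (2^-1) = 0 by rewrite -[RHS]e0 /= divfK.
  have h1 : `|2^-1 : R| < 1 by rewrite ger0_norm ?invr_ge0// invf_lt1// ltr1n.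
  move=> /(cpi_small h1) /eqP; by rewrite invr_eq0 pnatr_eq0.
have tx : tpi N x \in K by apply/KP; exists x.
have tx0 : SGrp tx != 0.
  apply/eqP => /(congr1 (@sg_val _ _)) /= /tpi_eq0; exact/negP.
have [chi chix] := peter_weyl R cK (sg_hausdorff hQ) tx0.
have [g gP] := open_extension chi (@divisible_circle R) K0.
exists (comphom g (tpi N)); by rewrite /= (gP (SGrp tx)).
Qed.

Let sumsetN' (B : nat) : exists m, forall z : 'I_k -> int, (forall i, (`|z i| <= B)%N) ->
  sumset m C (\sum_i e i *~ z i).
Proof.
have C00 : C 0 by exact: nbhs_singleton.
have [m mP] := choice (fun i => (GP (e i)).1 (eG i)).
exists (\sum_i B * m i)%N => z zB.
elim/big_rec2: _ => [|i y p _ py]; first by [].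
apply: sumsetD => //.
suff : sumset (B * m i) C (e i *+ `|z i|%N).
  case: (z i) => j; first by [].
  by rewrite NegzE mulrNz => h; apply: sumsetN.
apply: (@sumset_le _ (`|z i| * m i)%N) => //; first by rewrite leq_mul.
exact: sumset_muln.
Qed.

(** The lattice coordinates of [x] are differences of values of the [rho i] at
    [x] and on a compact set. *)
Lemma lattice_bounded (b : R) : exists m, forall x, x \in G -> (forall i, `|rho i x| <= b) ->
  sumset m C x.
Proof.
have [M MP] := choice (fun i => compact_bound (rho i) (compact_sumset (n := n) cC)).
pose B := Num.bound (`|b| + \sum_i `|M i|).
have [m mP] := sumsetN' B; exists (n + m)%N => x /GC[c [z [cC' xE]]] xb.
rewrite xE; apply: sumsetD => //; apply: mP => i.
have h : `|(z i)%:~R : R| <= `|b| + \sum_i `|M i|.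
  have -> : (z i)%:~R = rho i x - rho i c by rewrite xE homD rho_lattice addrAC subrr add0r.
  apply: le_trans (ler_normB _ _) _; apply: lerD; first exact: le_trans (xb i) (ler_norm _).
  apply: le_trans (MP i c cC') _; apply: le_trans (ler_norm _) _.
  by rewrite (bigD1 i)//= lerDl sumr_ge0.
rewrite -(ler_nat R) natr_absz intr_norm; apply: le_trans h _.
by apply/ltW/archi_boundP; rewrite addr_ge0 ?sumr_ge0.
Qed.

(** If [alpha_fun R x] is small on the compact group of characters that kill
    [G], then [x] is in [G]. If it is small on segments of the real lines of
    the [rho i], the [rho i x] are bounded and [x] lies in a fixed compact
    set. Finitely many characters exclude the part of this set that is outside
    [U]. *)
Lemma lattice_alpha_open (U : set A) : nbhs 0 U ->
  nbhs (0 : pdual R (pdual R A)) [set psi | forall x, psi = alpha_fun R x -> U x].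
Proof.
move=> U0.
have n1 : nbhs (0 : pdual R (pdual R A)) [set psi | forall x, psi = alpha_fun R x -> x \in G].
  have cb4 : nbhs (0 : T) (cball 4^-1) by apply: cball_nbhs; rewrite invr_gt0.
  have := nbhs_polar (@kill_compact R A _ G0) cb4; apply: filterS => psi psiP x psix.
  apply/negPn/negP => xG; have [g [gB gG gx]] := separating_hom R xG.
  have gC : continuous g.
    apply: hom_circle_continuous => //; apply: filterS G0 => y yG.
    by rewrite (gG y yG); exact: cball0.
  case/eqP: gx; apply: cball_subgroup => j.
  have := psiP (mkhom gB gC *+ j); rewrite psix.
  have -> : alpha_fun R x (mkhom gB gC *+ j) = g x *+ j by rewrite homMn.
  by apply=> y yG; rewrite -[LHS]/(alpha_fun R y (mkhom gB gC *+ j)) homMn /= /alpha_at /= gG// mul0rn.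
have n2 : nbhs (0 : pdual R (pdual R A))
    [set psi | forall x, psi = alpha_fun R x -> forall i, `|rho i x| <= 4^-1].
  suff : nbhs (0 : pdual R (pdual R A)) [set psi | forall i x, psi = alpha_fun R x -> `|rho i x| <= 4^-1].
    by apply: filterS => psi psiP x psix i; exact: psiP.
  apply: nbhs_forall => i.
  have cI : compact (realline (rho i) @` [set t | -1 <= t <= 1]).
    apply: continuous_compact; first by apply: continuous_subspaceT; exact: hom_continuous.
    by have := @segment_compact R (-1) 1; rewrite set_itvE.
  have cb4 : nbhs (0 : T) (cball 4^-1) by apply: cball_nbhs; rewrite invr_gt0.
  have := nbhs_polar cI cb4; apply: filterS => psi psiP x psix.
  apply: small_slope => [||t t1]; first by rewrite invr_ge0.
    by lra.
  have := psiP (realline (rho i) t); rewrite psix; apply.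
  by exists t => //=; rewrite -ler_norml.
have [m mP] := lattice_bounded 4^-1.
pose S := sumset m C `&` ~` U°.
have cS : compact S.
  apply: compact_closedI; first exact: compact_sumset.
  by apply: open_closedC; exact: open_interior.
have /choice[w wP] : forall y : A, exists w : chom A T * set T, S y ->
    nbhs 0 w.2 /\ nbhs y [set x | ~ w.2 (w.1 x)].
  move=> y; have [Sy|] := pselect (S y); last by exists (0, setT).
  have y0 : y != 0 by apply/eqP => y0; case: Sy => _; apply; rewrite y0; exact: U0.
  have [chi chiy] := lattice_enough_chars y0.
  have [V V0 nV] := hausdorff_nbhs0P (@circle_hausdorff R) chiy.
  have [W [W0 clW WV]] := nbhs0_closed V0.
  exists (chi, W) => _; split=> //=.
  have : nbhs (chi y) (~` W).
    by apply: open_nbhs_nbhs; split; [exact: closed_openC|move=> /WV].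
  exact: hom_nbhs.
have Sn y : S y -> nbhs y [set x | ~ (w y).2 ((w y).1 x)] by move=> /wP[].
have [s [sS sP]] := compact_cover_seq cS Sn.
have n3 : nbhs (0 : pdual R (pdual R A))
    [set psi | forall y, y \in s -> (w y).2 (psi (w y).1)].
  elim: s sS {sP} => [|y s IHs] sS; first by apply: filterE.
  have w0 : nbhs 0 (w y).2 by have /wP[] := sS y (mem_head _ _).
  have h1 := nbhs_polar (@compact_set1 _ (w y).1) w0.
  have h2 := IHs (fun y' y's => sS y' (mem_behead (s := y :: s) y's)).
  apply: filterS (filterI h1 h2) => psi [psi1 psi2] y'; rewrite inE => /predU1P[->|]; last exact: psi2.
  exact: psi1.
apply: filterS (filterI n1 (filterI n2 n3)) => psi [p1 [p2 p3]] x psix.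
apply: contrapT => nUx.
have Sx : S x by split; [apply: mP; [exact: p1|exact: p2]|move=> /interior_subset].
have [y ys nwy] := sP x Sx; apply: nwy; have := p3 y ys; by rewrite psix.
Qed.

(** The point is found layer by layer: [a0] accounts for the characters of [A
    / G], [a1] in [G] for those of [A / N], and a point [a2] of the lattice
    for the real lines. Every character is the sum of one that kills [N] and
    of elements of the real lines. *)
Lemma lattice_alpha_surj (psi : pdual R (pdual R A)) : exists x, psi = alpha_fun R x.
Proof.
(* The dual of the discrete group [A / G] is compact and its points are
   separated by [A / G], which is therefore its whole dual. *)
have [a0 a0P] : exists a, forall chi : chom A T, (forall x, x \in G -> chi x = 0) -> psi chi = chi a.
  have G0' : nbhs (0 : tquot G) [set 0].
    have := @tpi_nbhs _ G 0 _ G0; rewrite hom0; apply: filterS => _ [x xG <-].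
    exact/tpi_eq0.
  have cD : compact [set: pdual R (tquot G)].
    have := @kill_compact R (tquot G) _ G0'; congr compact; apply/seteqP; split=> // chi _ x ->.
    exact: hom0.
  have sep (chi : pdual R (tquot G)) : (forall x, alpha_fun R x chi = 0) -> chi = 0.
    by move=> h; apply: homP => x; exact: h.
  have [q qP] := separating_chars cD (@alpha_funB R (tquot G)) sep
    (comphom psi (dualmap R (tpi G))).
  have [a aq] := tpi_surj q; exists a => chi /tquot_lift[g gP].
  have -> : chi = dualmap R (tpi G) g by apply: homP => x /=; rewrite gP.
  transitivity (comphom psi (dualmap R (tpi G)) g); first by [].
  by rewrite qP -aq.
(* After subtraction of [a0], the value at a character of [A / N] only depends
   on its restriction to [G / N]. *)
have [a1 a1G a1P] : exists2 a1, a1 \in G & forall chi : chom A T, (forall x, x \in N -> chi x = 0) ->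
    psi chi = chi (a0 + a1).
  pose b (chi : pdual R Q) : chom (sgrp K) T := comphom chi (sg_incl K).
  pose psiX (chi : pdual R Q) : T := psi (comphom chi (tpi N)) - chi (tpi N a0).
  have bB : zmod_morphism b by move=> x y; exact: homP.
  have psiXB : zmod_morphism psiX.
    move=> x y; rewrite /psiX.
    have -> : comphom (x - y) (tpi N) = comphom x (tpi N) - comphom y (tpi N) by exact: homP.
    by rewrite homB subr4.
  have b0 chi : b chi = 0 -> psiX chi = 0.
    move=> bchi; rewrite /psiX a0P ?subrr// => x xG.
    have tx : tpi N x \in K by apply/KP; exists x.
    by have := congr1 (fun f : chom (sgrp K) T => f (SGrp tx)) bchi.
  have [q qP] := kronecker cK bB psiXB b0.
  have /KP[a aG aq] := sg_valP q; exists a => // chi /tquot_lift[g gP].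
  have -> : chi = comphom g (tpi N) by apply: homP => x /=; rewrite gP.
  rewrite homD; have := qP g; rewrite /psiX /b /= -aq => <-.
  by rewrite addrC subrK.
(* On each real line what remains has an integral slope, since its value at
   the character [rho i] modulo integers, which kills [N], is zero. *)
pose psi' : pdual R (pdual R A) := psi - alpha_fun R (a0 + a1).
have psi'E chi : psi' chi = psi chi - chi (a0 + a1) by [].
clearbody psi'.
have /choice[r rP] i := char_real (comphom psi' (realline (rho i))).
have rint i : r i \is a Num.int.
  apply/cpi_eq0; rewrite -[r i]mulr1 -rP /= psi'E a1P ?subrr// => x xN.
  suff : cpi R (1 * rho i x) = 0 by [].
  by apply/cpi_eq0; rewrite mul1r rhoint.
have /choice[z zP] : forall i, exists z : int, r i = z%:~R by move=> i; exact/intrP.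
pose a2 := \sum_i e i *~ z i.
have a2N : a2 \in N by apply/NP; exists z.
exists (a0 + a1 + a2); apply: homP => chi.
suff : psi' chi = chi a2.
  by rewrite psi'E => /eqP; rewrite subr_eq addrC => /eqP ->; rewrite /= /alpha_at -homD.
have /choice[s sP] : forall i, exists s, cpi R s = chi (e i).
  by move=> i; have [s _ sE] := cpi_surj (chi (e i)); exists s.
pose chi' : chom A T := chi - \sum_i realline (rho i) (s i).
have sumE x : (\sum_i realline (rho i) (s i) : chom A T) x = cpi R (\sum_i s i * rho i x).
  rewrite hom_sum; elim/big_rec2: _ => [|i y p _ <-]; first by [].
  by [].
have chi'N x : x \in N -> chi' x = 0.
  move=> /NP[y ->].
  have -> : chi' (\sum_i e i *~ y i) = chi (\sum_i e i *~ y i) - (\sum_i realline (rho i) (s i) : chom A T) (\sum_i e i *~ y i) by [].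
  rewrite sumE !hom_sum -sumrB big1// => i _.
  by rewrite rho_lattice homMz -sP -homMz -mulrzr subrr.
have chiE : chi = chi' + \sum_i realline (rho i) (s i) by rewrite subrK.
rewrite chiE homD.
have -> : (chi' + \sum_i realline (rho i) (s i)) a2 = chi' a2 + (\sum_i realline (rho i) (s i) : chom A T) a2 by [].
rewrite psi'E (a1P _ chi'N) subrr (chi'N _ a2N) !add0r sumE !hom_sum.
apply: eq_bigr => i _; rewrite rho_lattice -zP.
transitivity (comphom psi' (realline (rho i)) (s i)); first by [].
by rewrite rP mulrC.
Qed.

End LatticeDuality.

(** * Pontryagin duality *)

Section Pontryagin.
Variables (R : realType) (A : topologicalZmodType).
Hypothesis lA : LCA A.
Local Notation T := (circle R).

Lemma lattice_data : exists (C : set A) (G N : zmodClosed A) k (e : 'I_k -> A)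
    (rho : 'I_k -> chom A R) n,
  [/\ [/\ compact C, nbhs 0 C, forall x, C x -> C (- x) &
        forall x, x \in G <-> exists n, sumset n C x],
      forall i, e i \in G, forall i j, rho i (e j) = (i == j)%:R,
      forall x, x \in G -> exists c z, sumset n C c /\ x = c + \sum_i e i *~ z i &
      forall x, x \in N <-> exists z : 'I_k -> int, x = \sum_i e i *~ z i].
Proof.
have [C [C0 cC _ CN]] := LCA_nbhs lA.
have [G GP] := gen_exists (nbhs_singleton C0) CN.
have [k [e [rho [n [eG rhoe GC]]]]] := lattice_LCA R cC C0 CN GP.
have [N NP] := lattice_subgroup e.
by exists C, G, N, k, e, rho, n.
Qed.

Lemma enough_chars (x : A) : x != 0 -> exists chi : chom A T, chi x != 0.
Proof.
have [C [G [N [k [e [rho [n [[cC C0 CN GP] eG rhoe GC NP]]]]]]]] := lattice_data.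
exact: (lattice_enough_chars lA.1 cC C0 GP rhoe GC NP).
Qed.

Lemma enough_chars2 (x y : A) : (forall chi : chom A T, chi x = chi y) -> x = y.
Proof.
move=> xy; apply/eqP; rewrite -subr_eq0; apply/negPn/negP => /enough_chars[chi].
by rewrite homB xy subrr eqxx.
Qed.

Definition alpha : chom A (pdual R (pdual R A)) :=
  mkhom (@alpha_funB R A) (alpha_fun_continuous lA).

Lemma alphaE a chi : alpha a chi = chi a.
Proof. by []. Qed.

Lemma alpha_inverse_ex : exists beta : chom (pdual R (pdual R A)) A, cancel alpha beta /\ cancel beta alpha.
Proof.
have [C [G [N [k [e [rho [n [[cC C0 CN GP] eG rhoe GC NP]]]]]]]] := lattice_data.
have /choice[b bP] := lattice_alpha_surj cC C0 GP rhoe GC NP.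
have ab psi : alpha (b psi) = psi by rewrite [RHS]bP; exact: homP.
have ba a : b (alpha a) = a.
  by apply: enough_chars2 => chi; rewrite -!alphaE ab.
have bB : zmod_morphism b by move=> x y; rewrite -[RHS]ba homB !ab.
have bC : continuous b.
  apply: additive_continuous => // U U0.
  have := lattice_alpha_open lA.1 cC C0 CN GP eG rhoe GC NP U0.
  by apply: filterS => psi; apply; rewrite [LHS]bP.
by exists (mkhom bB bC); split.
Qed.

Definition alpha_inv : chom (pdual R (pdual R A)) A := projT1 (cid alpha_inverse_ex).

Lemma alphaK : cancel alpha alpha_inv.
Proof. by rewrite /alpha_inv; case: cid => beta []. Qed.

Lemma alpha_invK : cancel alpha_inv alpha.
Proof. by rewrite /alpha_inv; case: cid => beta []. Qed.

Lemma alpha_invE psi (chi : pdual R A) : chi (alpha_inv psi) = psi chi.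
Proof. by rewrite -alphaE alpha_invK. Qed.

End Pontryagin.

(** * Finiteness of real homomorphisms *)

Section FiniteDimension.
Variables (R : realType) (V : lmodType R).

Definition functional (l : V -> R) := forall a u v, l (a *: u + v) = a * l u + l v.

Lemma functional0 l : functional l -> l 0 = 0.
Proof. by move=> lL; have := lL (-1) 0 0; rewrite scaler0 addr0 mulN1r addNr. Qed.

Lemma functional_sum l n (c : 'I_n -> R) (e : 'I_n -> V) : functional l ->
  l (\sum_i c i *: e i) = \sum_i c i * l (e i).
Proof.
move=> lL; elim/big_rec2: _ => [|i y x _ <-]; first exact: functional0.
by rewrite lL.
Qed.

(** Add a functional that is nonzero on the common kernel of those chosen so
    far: the rank of the kernel drops, so the process stops. *)
Lemma finite_sep (I : eqType) (L : I -> V -> R) : finite_dim V ->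
  (forall i, functional (L i)) -> (forall v, (forall i, L i v = 0) -> v = 0) ->
  exists s : seq I, forall v, (forall i, i \in s -> L i v = 0) -> v = 0.
Proof.
move=> [n [e eP]] LL sep.
pose w i : 'cV[R]_n := \col_a L i (e a).
have wE i (c : 'I_n -> R) : ((\row_a c a) *m w i = 0) <-> L i (\sum_a c a *: e a) = 0.
  have E : ((\row_a c a) *m w i) 0 0 = L i (\sum_a c a *: e a).
    by rewrite functional_sum// mxE; apply: eq_bigr => a _; rewrite !mxE.
  split=> [h|h]; first by rewrite -E h mxE.
  by apply/matrixP => a b; rewrite !ord1 E h mxE.
suff [s sP] : exists s : seq I, forall c : 'rV[R]_n,
    (forall i, i \in s -> c *m w i = 0) -> forall i, c *m w i = 0.
  exists s => v vs; have [c vE] := eP v; apply: sep => i.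
  rewrite vE; apply/wE; apply: sP => j js; apply/wE; rewrite -vE; exact: vs.
suff : forall d (U : 'M[R]_n), (\rank U < d)%N ->
    (exists s : seq I, forall c : 'rV[R]_n, (forall i, i \in s -> c *m w i = 0) -> (c <= U)%MS) ->
    exists s : seq I, forall c : 'rV[R]_n,
      (forall i, i \in s -> c *m w i = 0) -> forall i, c *m w i = 0.
  move=> /(_ n.+1 1%:M); apply; first by rewrite ltnS rank_leq_row.
  by exists [::] => c _; exact: submx1.
elim=> // d IHd U rU [s sP].
have [all|/existsNP[i Ui]] := pselect (forall i, U *m w i = 0).
  by exists s => c /sP /submxP[D ->] i; rewrite -mulmxA all mulmx0.
apply: (IHd (U :&: kermx (w i))%MS); last first.
  exists (i :: s) => c cs; rewrite sub_capmx sP => [/=|j js]; last first.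
    by apply: cs; rewrite inE js orbT.
  by apply/sub_kermxP; apply: cs; exact: mem_head.
rewrite ltnS in rU; apply: leq_trans rU; apply: rank_ltmx.
rewrite /ltmx capmxSl /=; apply/negP => h; apply: Ui; apply/sub_kermxP.
exact: submx_trans h (capmxSr _ _).
Qed.

(** The converse of [finite_sep], by induction on the number of functionals.
    Subspaces are predicates, as [V] is not yet known to have finite
    dimension. *)
Lemma finite_sep_dim (m : nat) (L : 'I_m -> V -> R) : (forall i, functional (L i)) ->
  (forall v, (forall i, L i v = 0) -> v = 0) -> finite_dim V.
Proof.
move=> LL sep.
suff : forall (s : seq 'I_m) (W : V -> Prop),
    (forall a u v, W u -> W v -> W (a *: u + v)) ->
    (forall v, W v -> (forall i, i \in s -> L i v = 0) -> v = 0) ->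
    exists n (e : 'I_n -> V), forall v, W v -> exists c : 'I_n -> R, v = \sum_i c i *: e i.
  move=> /(_ (enum 'I_m) (fun=> True)) [//||n [e eP]].
    by move=> v _ h; apply: sep => i; apply: h; rewrite mem_enum.
  by exists n, e => v; exact: eP.
elim=> [|i s IHs] W WL Wsep.
  exists 0%N, (fun=> 0) => v Wv; exists (fun=> 0).
  by rewrite big_ord0; exact: Wsep.
have [||n [e eP]] := IHs (fun v => W v /\ L i v = 0).
- by move=> a u v [Wu Lu] [Wv Lv]; split; [exact: WL|rewrite LL Lu Lv mulr0 addr0].
- by move=> v [Wv Lv] vs; apply: Wsep => // j; rewrite inE => /predU1P[->|/vs].
have [[v0 [Wv0 Lv0]]|none] := pselect (exists v0, W v0 /\ L i v0 <> 0); last first.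
  exists n, e => v Wv; apply: eP; split=> //; apply: contrapT => Lv; apply: none; by exists v.
exists n.+1, (fun j => oapp e v0 (unlift ord0 j)) => v Wv.
have [|c cE] := eP (- (L i v / L i v0) *: v0 + v).
  by split; [exact: WL|rewrite LL mulNr divfK ?addNr//; exact/eqP].
exists (fun j => oapp c (L i v / L i v0) (unlift ord0 j)).
rewrite big_ord_recl unlift_none /=.
under eq_bigr do rewrite liftK /=.
by rewrite -cE scaleNr addrA subrr add0r.
Qed.

Lemma finite_sep_dims (I : eqType) (s : seq I) (L : I -> V -> R) : (forall i, functional (L i)) ->
  (forall v, (forall i, i \in s -> L i v = 0) -> v = 0) -> finite_dim V.
Proof.
move=> LL sep; apply: (@finite_sep_dim (size s) (fun j => L (tnth (in_tuple s) j))) => // v vs.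
by apply: sep => i /(tnthP (in_tuple s))[j ->]; exact: vs.
Qed.

End FiniteDimension.

Section TorsionModCompact.
Variable R : realType.

Lemma hom_separated (A : topologicalZmodType) : finite_dim (homto R A) ->
  exists s : seq A, forall f : chom A R, (forall a, a \in s -> f a = 0) -> f = 0.
Proof.
move=> fd; apply: (@finite_sep R (homto R A) A (fun a f => f a)) => //.
by move=> f f0; apply: homP => a; exact: f0.
Qed.

Lemma real_line_coef (B : topologicalZmodType) (chi : pdual R B) (phi : chom R B) :
  exists r, forall t, chi (phi t) = cpi R (r * t).
Proof. exact: (char_real (comphom chi phi)). Qed.

Lemma cpi_mul_inj (r s : R) : (forall t, cpi R (r * t) = cpi R (s * t)) -> r = s.
Proof.
move=> rs; have [->//|rs0] := eqVneq r s; rewrite -subr_eq0 in rs0.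
have : cpi R ((r - s) * (2^-1 / (r - s))) = 0.
  by rewrite mulrBl homB rs subrr.
rewrite mulrC divfK// => /cpi_small h.
have : (2^-1 : R) = 0 by apply: h; rewrite ger0_norm ?invr_ge0// invf_lt1// ltr1n.
by move/eqP; rewrite invr_eq0 pnatr_eq0.
Qed.

(** By duality a real homomorphism [f] on the dual of [B] is the same as a
    real line [phi] in [B], with [chi (phi t) = f chi * t] modulo integers;
    the slopes at finitely many characters determine the line. *)
Lemma hom_dual_separated (B : topologicalZmodType) : LCA B -> finite_dim (homfrom R B) ->
  exists s : seq (pdual R B), forall f : chom (pdual R B) R, (forall chi, chi \in s -> f chi = 0) -> f = 0.
Proof.
move=> lB fd.
have /choice[L LP] : forall z : pdual R B * homfrom R B, exists r, forall t, z.1 (z.2 t) = cpi R (r * t).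
  by move=> [chi phi]; exact: (real_line_coef chi phi).
have LE (chi : pdual R B) (phi : homfrom R B) r : (forall t, chi (phi t) = cpi R (r * t)) -> L (chi, phi) = r.
  by move=> h; apply: cpi_mul_inj => t; rewrite -LP -h.
have [||s sP] := @finite_sep R (homfrom R B) (pdual R B) (fun chi phi => L (chi, phi)) fd.
- move=> chi a u v; apply: LE => t.
  have -> : (a *: u + v : homfrom R B) t = u (a * t) + v t by [].
  by rewrite homD (LP (chi, u)) (LP (chi, v)) -homD; congr (cpi R _); rewrite mulrDl mulrCA mulrA.
- move=> phi phi0; apply: homP => t; apply: (enough_chars2 (R := R) lB) => chi.
  by rewrite (LP (chi, phi)) phi0 mul0r !hom0.
exists s => f fs; apply: homP => chi.
pose phi : chom R B := comphom (alpha_inv R lB) (realline f).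
have phiE (chi' : pdual R B) t : chi' (phi t) = cpi R (f chi' * t).
  by rewrite alpha_invE mulrC.
have phi0 : phi = 0 by apply: sP => chi' /fs f0; apply: LE => t; rewrite phiE f0.
have : f chi = 0.
  apply: cpi_mul_inj => t; rewrite -phiE phi0 mul0r hom0.
  by symmetry; exact: (hom0 (cpi R)).
by [].
Qed.

(** Up to multiples, the group is generated by the compact set [C]. In this
    form the finiteness of the real dual is used from here on. *)
Definition torsion_mod (A : topologicalZmodType) (C : set A) (G : zmodClosed A) :=
  [/\ [/\ compact C, nbhs 0 C & forall x, C x -> C (- x)],
    forall x, x \in G <-> exists n, sumset n C x &
    forall x, exists2 n, (0 < n)%N & x *+ n \in G].

(** Let [C] contain the finitely many points that detect real homomorphisms.
    An element [x] of infinite order modulo the subgroup generated by [C]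
    would give a nonzero real homomorphism that these points do not detect:
    zero on the subgroup and 1 at [x], extended to the whole group. *)
Lemma torsion_mod_ex (A : topologicalZmodType) : LCA A ->
  (exists s : seq A, forall f : chom A R, (forall a, a \in s -> f a = 0) -> f = 0) ->
  exists (C : set A) G, torsion_mod C G.
Proof.
move=> lA [s sP].
have [C0 [C00 cC0 _ C0N]] := LCA_nbhs lA.
have [C [cC Cn CN Cs]] : exists C : set A, [/\ compact C, nbhs 0 C, forall x, C x -> C (- x) &
    forall a, a \in s -> C a].
  elim: s {sP} => [|a s [C [cC Cn CN Cs]]]; first by exists C0.
  exists (C `|` ([set a] `|` [set - a])); split.
  - by apply: compactU => //; apply: compactU; exact: compact_set1.
  - by apply: filterS Cn => x; left.
  - by move=> x [/CN|[->|->]]; [left|right; right|right; left; rewrite /= opprK].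
  by move=> b; rewrite inE => /predU1P[->|/Cs]; [right; left|left].
have [G GP] := gen_exists (nbhs_singleton Cn) CN.
have G0 : nbhs 0 (fun x => x \in G).
  by apply: filterS Cn => x Cx; apply/GP; exists 1%N; exact: sumset1.
exists C, G; split=> // x; apply: contrapT => nx.
have {}nx n : x *+ n.+1 \notin G.
  by apply/negP => h; apply: nx; exists n.+1.
pose H : {pred A} := fun y => `[< exists2 n : int, y - x *~ n \in G & True >].
have HP y : y \in H <-> exists n : int, y - x *~ n \in G.
  by split=> [/asboolP[n yn _]|[n yn]]; [exists n|apply/asboolP; exists n].
have Hz : zmod_closed H.
  split=> [|y z /HP[n yn] /HP[m zm]]; apply/HP.
    by exists 0; rewrite mulr0z subrr rpred0.
  exists (n - m); rewrite mulrzBr subr4; exact: rpredB.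
have xn (n : int) : x *~ n \in G -> n = 0.
  case: n => [[//|n]|n] h; first by have := nx n; rewrite h.
  have := nx n; rewrite -rpredN -[- _]/(x *~ (Negz n)); by rewrite h.
have /choice[c cP] : forall y, exists n : int, y \in H -> y - x *~ n \in G.
  move=> y; have [/HP[n yn]|//] := boolP (y \in H); [by exists n|by exists 0].
have cE y n : y - x *~ n \in G -> c y = n.
  move=> yn; have yH : y \in H by apply/HP; exists n.
  apply/eqP; rewrite -subr_eq0; apply/eqP; apply: xn.
  have -> : x *~ (c y - n) = (y - x *~ n) - (y - x *~ c y).
    by rewrite mulrzBr opprB [RHS]addrC addrA subrK.
  exact: rpredB yn (cP y yH).
have cB y z : y \in zmc Hz -> z \in zmc Hz -> (c (y - z))%:~R = (c y)%:~R - (c z)%:~R :> R.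
  rewrite !zmcE => yH zH; rewrite (cE (y - z) (c y - c z)) ?rmorphB//.
  by rewrite mulrzBr subr4 rpredB ?cP.
have [g [gB gP]] := extend_hom (@divisibleR R) cB.
have gG y : y \in G -> g y = 0.
  move=> yG; rewrite gP; last by rewrite zmcE; apply/HP; exists 0; rewrite mulr0z subr0.
  by rewrite (cE y 0) ?mulr0z ?subr0.
have gC : continuous g.
  apply: (@real_hom_continuous _ _ g 0) => //; apply: filterS G0 => y yG.
  by rewrite gG ?normr0.
have g0 : mkhom gB gC = 0.
  by apply: sP => a /Cs Ca; apply: gG; apply/GP; exists 1%N; exact: sumset1.
have : g x = 0 by rewrite -[g x]/(mkhom gB gC x) g0.
rewrite gP; last by rewrite zmcE; apply/HP; exists 1; rewrite mulr1z subrr rpred0.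
by rewrite (cE x 1) ?mulr1z ?subrr ?rpred0// => /eqP; rewrite oner_eq0.
Qed.

End TorsionModCompact.

(** * Polars *)

Section Polars.
Variable R : realType.

Lemma nbhs0_multiples (A : topologicalZmodType) (C : set A) (M : nat) : nbhs 0 C ->
  nbhs 0 [set x : A | forall j, (0 < j <= M)%N -> C (x *+ j)].
Proof.
move=> C0; suff : nbhs 0 [set x : A | forall j : 'I_M.+1, C (x *+ j)].
  by apply: filterS => x xC j /andP[_ jM]; exact: (xC (Ordinal (jM : (j < M.+1)%N))).
apply: nbhs_forall => j.
have : nbhs (0 : A) (mulnhom A j @^-1` C) by exact: hom_nbhs0.
by apply: filterS.
Qed.

(** Equicontinuity holds because a character that is small at the first [M]
    multiples of [x] is [M] times smaller at [x]. *)
Lemma chars_compact (A : topologicalZmodType) (C : set A) (e : R) : nbhs 0 C -> 0 <= e -> e <= 4^-1 ->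
  compact [set chi : chom A (circle R) | forall x, C x -> cball e (chi x)].
Proof.
move=> C0 e0 e4; apply: (@compact_homs A (circle R) _ (fun=> setT)) => //.
- exact: circle_hausdorff.
- by move=> _; exact: circle_compact.
- move=> V /cball_basis[d d0 dV].
  have [M [M0 MP]] := natmul_large 1 d0.
  have := nbhs0_multiples M C0; apply: filterS => x xC f fC.
  apply: dV; apply: (@cball_le _ (4^-1 / M%:R)).
    have M0' : (0 : R) < M%:R by rewrite ltr0n.
    by rewrite ler_pdivrMr//; lra.
  apply: cball_multiples => // j jM; rewrite -homMn; apply: cball_le e4 _; apply: fC; exact: xC.
by move=> l lP x Cx; apply: (lP x (cball e)); [exact: cball_closed|move=> f; exact].
Qed.

Lemma pdual_LCA (A : topologicalZmodType) : LCA A -> LCA (pdual R A).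
Proof.
move=> lA; have [C [C0 cC _ _]] := LCA_nbhs lA.
have e0 : (0 : R) < 4^-1 by rewrite invr_gt0.
apply: (@nbhs_LCA _ [set chi : chom A (circle R) | forall x, C x -> cball 4^-1 (chi x)]).
- apply: hausdorff_nbhs0 => chi chi0.
  have [x chix] : exists x, chi x != 0.
    apply: contrapT => /forallNP h; case/eqP: chi0; apply: homP => x.
    by apply/eqP/negPn/negP; exact: h.
  have [U U0 nU] := hausdorff_nbhs0P (@circle_hausdorff R) chix.
  exists [set f : chom A (circle R) | forall y, [set x] y -> U (f y)].
    by apply: nbhs_polar => //; exact: compact_set1.
  by move=> /(_ x erefl).
- by apply: nbhs_polar => //; exact: cball_nbhs.
exact: (chars_compact C0 (ltW e0)).
Qed.

Definition polar (B : topologicalZmodType) (D : set (pdual R B)) (e : R) : set B :=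
  [set b | forall chi, D chi -> cball e (chi b)].

Lemma polar_nbhs (B : topologicalZmodType) (D : set (pdual R B)) e : LCA B -> compact D -> 0 < e ->
  nbhs 0 (polar D e).
Proof.
move=> lB cD e0; have := @nbhs_polar (pdual R B) (circle R) D _ cD (cball_nbhs e0).
move=> /(hom_nbhs0 (alpha R lB)); by apply: filterS => b bD chi; exact: bD.
Qed.

(** Under duality this is a set of characters of the dual as in
    [chars_compact]. *)
Lemma polar_compact (B : topologicalZmodType) (D : set (pdual R B)) e : LCA B -> nbhs 0 D ->
  0 <= e -> e <= 4^-1 -> compact (polar D e).
Proof.
move=> lB D0 e0 e4.
have -> : polar D e = alpha_inv R lB @` [set psi : chom (pdual R B) (circle R) | forall x, D x -> cball e (psi x)].
  apply/seteqP; split=> [b bD|_ [psi psiD <-] chi Dchi]; last by rewrite alpha_invE; exact: psiD.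
  by exists (alpha R lB b); [exact: bD|exact: alphaK].
apply: continuous_compact; last exact: chars_compact.
by apply: continuous_subspaceT; exact: hom_continuous.
Qed.

(** A neighbourhood of zero in [B] is one in the bidual, where
    [hom_nbhs0_basis] applies. *)
Lemma nbhs_polar_basis (B : topologicalZmodType) (V : set B) : LCA B -> nbhs 0 V ->
  exists (P : set (pdual R B)) (e : R), [/\ compact P, 0 < e & polar P e `<=` V].
Proof.
move=> lB /(hom_nbhs0 (alpha_inv R lB))/hom_nbhs0_basis[P [W [cP /cball_basis[e e0 eW] PW]]].
exists P, e; split=> // b bP; rewrite -[b](alphaK R lB).
by apply: PW => chi Pchi; apply: eW; exact: bP.
Qed.

End Polars.

(** * Multiplication by integers *)

Lemma finite_nbhs (A : topologicalZmodType) (F : set A) : hausdorff_space A -> finite_set F ->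
  ~ F 0 -> nbhs 0 (~` F).
Proof.
move=> hA /finite_seqP[s ->]; elim: s => [|y s IHs] /= ys0; first by apply: filterE => x.
have y0 : y != 0 by apply/eqP => y0; apply: ys0; rewrite y0 mem_head.
have [U U0 nU] := hausdorff_nbhs0P hA y0.
have /IHs h : ~ [set` s] 0 by move=> /= s0; apply: ys0; rewrite inE s0 orbT.
apply: filterS (filterI U0 h) => x [Ux sx] /=.
by rewrite inE => /predU1P[xy|//]; apply: nU; rewrite -xy.
Qed.

Lemma mul_induct (P : nat -> Prop) : P 1%N -> (forall p, prime p -> P p) ->
  (forall m n, P m -> P n -> P (m * n)%N) -> forall n, (0 < n)%N -> P n.
Proof.
move=> P1 Pp PM n; have [m] := ubnP n; elim: m n => // m IHm n; rewrite ltnS => nm n0.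
have [n1|n1] := leqP n 1; first by have -> : n = 1%N by lia.
rewrite -(divnK (pdiv_dvd n)); apply: PM; last by apply: Pp; exact: pdiv_prime.
have p1 : (1 < pdiv n)%N by rewrite prime_gt1 ?pdiv_prime.
apply: IHm; last by rewrite divn_gt0 ?pdiv_leq// ltnW.
by apply: leq_trans nm; rewrite ltn_Pdiv.
Qed.

Section Multiplication.
Variable A : topologicalZmodType.

Definition mul_open n := forall U : set A, nbhs 0 U -> nbhs 0 [set x *+ n | x in U].

Definition mul_proper n := forall S : set A, compact S -> exists2 P, compact P & forall x, S (x *+ n) -> P x.

(** The finiteness condition at [n] without quotient groups or strict
    morphisms; see [finite_ranks_mulfin] and [mulfin_finite_ranks]. *)
Definition mulfin n := [/\ mul_open n, finite_set [set x : A | x *+ n = 0] &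
  exists s : seq A, forall x, exists2 a, a \in s & exists y, x = y *+ n + a].

Lemma mul_open1 : mul_open 1.
Proof. by move=> U; apply: filterS => x Ux; exists x. Qed.

Lemma mul_openM m n : mul_open m -> mul_open n -> mul_open (m * n).
Proof.
by move=> om on U /om/on; apply: filterS => _ [_ [x Ux <-] <-]; exists x; rewrite // mulrnA.
Qed.

Lemma mul_proper1 : mul_proper 1.
Proof. by move=> S cS; exists S. Qed.

Lemma mul_properM m n : mul_proper m -> mul_proper n -> mul_proper (m * n).
Proof.
move=> pm pn S /pn[P /pm[Q cQ PQ] SP]; exists Q => // x; rewrite mulrnA => /SP; exact: PQ.
Qed.

Lemma homimP n y : y \in homim (mulnhom A n) <-> exists x, x *+ n = y.
Proof. by split=> [/asboolP[x _ <-]|[x <-]]; [exists x|apply/asboolP; exists x]. Qed.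

(** The image is closed and of finite index, hence open, and a strict morphism
    is open onto its image. *)
Lemma strict_open n : strict (mulnhom A n) -> finite_set [set: tquot (homim (mulnhom A n))] ->
  mul_open n.
Proof.
set f := mulnhom A n => -[_ fo fc] fin U U0.
have cE x : coim_map (tpi (homker f) x) = f x by exact: (coim_map_pi f).
have Icl : closed (fun x => x \in homim f).
  suff E : [set x | x \in homim f] = range (coim_map (f := f)) by rewrite -E in fc.
  apply/seteqP; split=> [y /homimP[x <-]|_ [q _ <-]].
    by exists (tpi (homker f) x) => //; exact: (coim_map_pi f).
  have [x <-] := tpi_surj q; apply/homimP; exists x; symmetry; exact: (coim_map_pi f).
have I0 : nbhs 0 (fun x => x \in homim f).
  have h : nbhs (0 : tquot (homim f)) [set 0].
    have hQ := tquot_hausdorff Icl.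
    have := finite_nbhs hQ (sub_finite_set (@subsetT _ [set~ 0]) fin).
    by move=> /(_ (fun h => h erefl)); apply: filterS => q /contrapT.
  by have := hom_nbhs0 (tpi (homim f)) h; apply: filterS => x; exact: (tpi_eq0 _ _).1.
have := @tpi_nbhs _ (homker f) 0 _ U0; rewrite nbhsE => -[Q [oQ Q0] QU].
have [V oV QV] := (fo Q).1 oQ.
have V0 : nbhs 0 V.
  apply: open_nbhs_nbhs; split=> //.
  suff : coim_map (tpi (homker f) 0) = 0 by move=> <-; rewrite QV in Q0; exact: Q0.
  by rewrite cE hom0.
apply: filterS (filterI I0 V0) => z [/homimP[x xz] Vz].
have : Q (tpi (homker f) x) by rewrite QV /preimage /mkset cE; change (V (x *+ n)); rewrite xz.
move=> /QU[u Uu /(congr1 (coim_map (f := f)))]; rewrite !cE => e.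
by exists u => //; rewrite -xz; exact: e.
Qed.

Lemma open_strict n : mul_open n -> strict (mulnhom A n).
Proof.
set f := mulnhom A n => fo.
have cE x : coim_map (tpi (homker f) x) = f x by exact: coim_map_pi.
have cinj : injective (coim_map (f := f)).
  move=> q q'; have [x <-] := tpi_surj q; have [x' <-] := tpi_surj q'.
  rewrite !cE => e; apply/tpi_eqP; apply/eqP; by rewrite homB e subrr.
split=> // [U|].
  split=> [oU|[V oV ->]]; last first.
    apply: open_comp => // q _; apply: tpi_factor_continuous.
    have -> : coim_map (f := f) \o tpi (homker f) = f by apply/funext => x; exact: cE.
    exact: hom_continuous.
  exists (coim_map (f := f) @` U); last first.
    apply/seteqP; split=> [q Uq|q [q' Uq' /cinj <-]] //; by exists q.
  rewrite openE => _ [q Uq <-]; have [x xq] := tpi_surj q.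
  rewrite /interior -nbhs_shift0.
  have : nbhs 0 (fun y => U (tpi (homker f) (x + y))).
    apply/(nbhs_shift0 x (fun y => U (tpi (homker f) y))); apply: hom_nbhs; rewrite xq.
    exact: open_nbhs_nbhs.
  move=> /fo; apply: filterS => _ [y Uy <-]; exists (tpi (homker f) (x + y)) => //.
  by rewrite -xq !cE homD.
have -> : range (coim_map (f := f)) = [set x | x \in homim f].
  apply/seteqP; split=> [_ [q _ <-]|y /homimP[x <-]] /=.
    have [x <-] := tpi_surj q; apply/homimP; exists x; symmetry; exact: cE.
  by exists (tpi (homker f) x) => //; exact: cE.
apply: (subgroup_open_closed (G := homim f) _).2.
by apply: filterS (fo _ filterT) => _ [x _ <-]; apply/homimP; exists x.
Qed.

(** Near a point of the image the preimages lie in a compact set, by openness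
    and finiteness of the kernel; near any other point there are none, as the
    image is an open subgroup. *)
Lemma open_proper n : LCA A -> mul_open n -> finite_set [set x : A | x *+ n = 0] -> mul_proper n.
Proof.
move=> lA no fin S cS; have [D [D0 cD _ _]] := LCA_nbhs lA.
have cker : compact [set x : A | x *+ n = 0] by exact: finite_compact.
have /choice[w wP] : forall s : A, exists w : set A * set A,
    [/\ nbhs s w.1, compact w.2 & forall x, w.1 (x *+ n) -> w.2 x].
  move=> s; have [[b bs]|nb] := pselect (exists b, b *+ n = s); last first.
    exists ((fun x => exists2 d : A, x - s = d *+ n & True), set0); split=> /=; last 2 first.
    - exact: compact0.
    - by move=> x [d e _]; apply: nb; exists (x - d); rewrite mulrnBl -e opprB addrC subrK.
    rewrite -nbhs_shift0; apply: filterS (no _ filterT) => _ [d _ <-]; exists d => //.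
    by rewrite addrAC subrr add0r.
  exists ((fun x => exists2 d, D d & x - s = d *+ n), [set b + z | z in [set z.1 + z.2 | z in D `*` [set x : A | x *+ n = 0]]]); split=> /=.
  - rewrite -nbhs_shift0; apply: filterS (no _ D0) => _ [d Dd <-]; exists d => //.
    by rewrite addrAC subrr add0r.
  - by apply: compact_shiftset; exact: compact_addset.
  move=> x [d Dd e]; exists (x - b); last by rewrite addrC subrK.
  exists (d, x - b - d); last by rewrite /= addrC subrK.
  by split=> //=; rewrite !mulrnBl bs e subrr.
have [|s [_ sP]] := @compact_cover_seq _ S (fun s => (w s).1) cS; first by move=> x _; have [] := wP x.
exists (fun x => exists2 y, y \in s & (w y).2 x).
  elim: s {sP} => [|y s IHs].
    by rewrite (_ : (fun x => _) = set0); [exact: compact0|apply/seteqP; split=> // x []].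
  rewrite (_ : (fun x => _) = (w y).2 `|` (fun x => exists2 y, y \in s & (w y).2 x)).
    by apply: compactU => //; have [] := wP y.
  apply/seteqP; split=> [x [z]|x [wx|[z zs wx]]].
  - by rewrite inE => /predU1P[->|zs] wx; [left|right; exists z].
  - by exists y => //; exact: mem_head.
  by exists z => //; rewrite inE zs orbT.
by move=> x /sP[y ys wx]; exists y => //; have [_ _] := wP y; exact.
Qed.

Lemma finite_ranks_mulfin n : strict (mulnhom A n) -> finite_set [set x | x \in homker (mulnhom A n)] ->
  finite_set [set: tquot (homim (mulnhom A n))] -> mulfin n.
Proof.
move=> st fk fc; split; first exact: strict_open.
  by apply: sub_finite_set fk => x /= x0; apply/eqP.
have /finite_seqP[s sE] := fc; exists (map repr s) => x.
exists (repr (tpi (homim (mulnhom A n)) x)).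
  by apply: map_f; have : [set: tquot (homim (mulnhom A n))] (tpi _ x) by []; rewrite sE.
have /homimP[y yE] : x - repr (tpi (homim (mulnhom A n)) x) \in homim (mulnhom A n).
  by apply/tpi_eqP; rewrite tpi_repr.
by exists y; rewrite yE subrK.
Qed.

Lemma mulfin_finite_ranks n : mulfin n -> [/\ strict (mulnhom A n),
  finite_set [set x | x \in homker (mulnhom A n)] & finite_set [set: tquot (homim (mulnhom A n))]].
Proof.
move=> [no fk [s sP]]; split; first exact: open_strict.
  by apply: sub_finite_set fk => x /eqP.
apply: (@sub_finite_set _ _ [set` map (tpi (homim (mulnhom A n))) s]); last exact: finite_seq.
move=> q _; have [x <-] := tpi_surj q; have [a sa [y xE]] := sP x.
rewrite /= (_ : tpi _ x = tpi (homim (mulnhom A n)) a); first exact: map_f.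
by apply/tpi_eqP; apply/homimP; exists y; rewrite xE addrK.
Qed.

End Multiplication.

(** * Local compactness of the group of homomorphisms *)

(** Finitely many translates of [C] cover [P], and their centres have a common
    multiple in [G]. *)
Lemma torsion_mod_compact (A : topologicalZmodType) (C : set A) G (P : set A) :
  torsion_mod C G -> compact P ->
  exists2 n, (0 < n)%N & exists m, forall x, P x -> sumset m C (x *+ n).
Proof.
move=> [[cC C0 CN] GP tG] cP; have C00 := nbhs_singleton C0.
have [|s [_ sP]] := @compact_cover_seq _ P (fun y => [set x | C (x - y)]) cP.
  move=> x _; rewrite -nbhs_shift0; apply: filterS C0 => z Cz.
  by rewrite /= addrAC subrr add0r.
have [n n0 [m mP]] : exists2 n, (0 < n)%N & exists m, forall y, y \in s -> sumset m C (y *+ n).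
  elim: s {sP} => [|y s [n n0 [m mP]]]; first by exists 1%N => //; exists 0%N.
  have [n' n'0 /GP[m' m'P]] := tG y.
  exists (n' * n)%N; first by rewrite muln_gt0 n0 n'0.
  exists (n * m' + n' * m)%N => z; rewrite inE => /predU1P[->|zs].
    by rewrite mulrnA; apply: (@sumset_le _ (n * m')) => //; [rewrite leq_addr|exact: sumset_muln].
  rewrite (mulnC n' n) mulrnA; apply: (@sumset_le _ (n' * m)) => //; first by rewrite leq_addl.
  by apply: sumset_muln; exact: mP.
exists n => //; exists (n * 1 + m)%N => x /sP[y ys Cxy].
rewrite -(subrK y x) mulrnDl; apply: sumsetD; last exact: mP.
by apply: sumset_muln; exact: sumset1.
Qed.

Lemma eval_morph (A B : topologicalZmodType) (a : A) : zmod_morphism (fun f : chom A B => f a).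
Proof. by []. Qed.

Lemma hom_hausdorff (A B : topologicalZmodType) : hausdorff_space B -> hausdorff_space (chom A B).
Proof.
move=> hB; apply: hausdorff_nbhs0 => f f0.
have [x fx] : exists x, f x != 0.
  apply: contrapT => /forallNP h; case/eqP: f0; apply: homP => x.
  by apply/eqP/negPn/negP; exact: h.
have [U U0 nU] := hausdorff_nbhs0P hB fx.
exists [set g : chom A B | forall y, [set x] y -> U (g y)].
  by apply: nbhs_polar => //; exact: compact_set1.
by move=> /(_ x erefl).
Qed.

Definition mulprimes (A : topologicalZmodType) := forall p, prime p -> mulfin A p.

Lemma mulprimes_open (A : topologicalZmodType) n : mulprimes A -> (0 < n)%N -> mul_open A n.
Proof.
move=> mA; apply: mul_induct; first exact: mul_open1.
  by move=> p /mA[].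
exact: mul_openM.
Qed.

Lemma mulprimes_proper (A : topologicalZmodType) n : LCA A -> mulprimes A -> (0 < n)%N ->
  mul_proper A n.
Proof.
move=> lA mA; apply: mul_induct; first exact: mul_proper1.
  by move=> p /mA[no nf _]; exact: open_proper.
exact: mul_properM.
Qed.

Section HomLocallyCompact.
Variables (R : realType) (A B : topologicalZmodType).
Hypotheses (lB : LCA B) (mA : mulprimes A) (mB : mulprimes B).
Variables (C : set A) (G : zmodClosed A) (D : set (pdual R B)) (H : zmodClosed (pdual R B)).
Hypotheses (tA : torsion_mod C G) (tB : torsion_mod D H).

Let eps : R := 8^-1.
Let eps0 : 0 < eps. Proof. by rewrite invr_gt0. Qed.
Let eps4 : eps <= 4^-1. Proof. by rewrite /eps; lra. Qed.

Definition smallhoms : set (chom A B) := [set f | forall c, C c -> polar D eps (f c)].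

Lemma smallhoms_nbhs : nbhs 0 smallhoms.
Proof.
have [[cC _ _] _ _] := tA; have [[cD _ _] _ _] := tB.
by apply: nbhs_polar => //; exact: polar_nbhs.
Qed.

(** A neighbourhood of zero is given by smallness on a compact set of
    characters, and some multiple of that set lies in a sumset of [D]; so
    smallness on [D] of sufficiently many multiples of [x] is enough for a
    multiple of [x]. *)
Let polar_multiples (V : set B) : nbhs 0 V -> exists2 n, (0 < n)%N &
  exists M, forall x, (forall j, (0 < j <= M)%N -> polar D eps (x *+ j)) -> V (x *+ n).
Proof.
move=> /(nbhs_polar_basis R lB)[P [e [cP e0 PV]]].
have [n n0 [m mP]] := torsion_mod_compact tB cP.
exists n => //; have [M [M0 MP]] := natmul_large (m%:R * 4^-1) e0.
have M0' : (0 : R) < M%:R by rewrite ltr0n.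
exists M => x xM; apply: PV => chi Pchi.
rewrite homMn -[chi x *+ n]/(alpha_fun R x chi *+ n) -homMn.
have h : forall chi, D chi -> cball (4^-1 / M%:R) (alpha_fun R x chi).
  move=> chi' Dchi'; apply: cball_multiples => // j jM.
  by rewrite -[_ *+ j]/(chi' x *+ j) -homMn; apply: cball_le eps4 _; exact: xM.
have := sumset_morph (homB (alpha_fun R x)) h (mP _ Pchi).
move=> /cball_sumset; apply: cball_le.
by rewrite mulrA ler_pdivrMr// mulrC [e * _]mulrC ltW// mulrC.
Qed.

(** By Ascoli's theorem. A multiple [a *+ n] is a sum of elements of [C], so
    [f a] lies in the preimage of a compact set under multiplication by [n],
    which is proper on [B]. Equicontinuity follows from [polar_multiples], as
    multiplication by [n] is open on [A]. *)
Lemma smallhoms_compact : compact smallhoms.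
Proof.
have [[cC C0 CN] GP tG] := tA; have [[cD D0 DN] HP tH] := tB.
have cU : compact (polar D eps) by apply: polar_compact => //; exact: ltW.
have pt a : exists P, compact P /\ forall f, smallhoms f -> P (f a).
  have [n n0 /GP[m am]] := tG a.
  have [P cP PP] := mulprimes_proper lB mB n0 (compact_sumset (n := m) cU).
  by exists P; split=> // f fW; apply: PP; rewrite -homMn; exact: (sumset_morph (homB f) fW am).
have [P PP] := choice pt.
apply: (@compact_homs A B smallhoms P) => //.
- exact: lB.1.
- by move=> a; have [] := PP a.
- by move=> f a; have [_] := PP a; exact.
- move=> V /polar_multiples[n n0 [M MP]].
  apply: filterS (mulprimes_open mA n0 (nbhs0_multiples M C0)) => _ [a aM <-] f fW.
  by rewrite homMn; apply: MP => j jM; rewrite -homMn; apply: fW; exact: aM.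
move=> l lP c Cc; apply: (lP c (polar D eps)); first exact: (compact_closed lB.1 cU).
by move=> f; exact.
Qed.

Lemma hom_LCA : LCA (chom A B).
Proof.
apply: nbhs_LCA smallhoms_nbhs smallhoms_compact; apply: hom_hausdorff; exact: lB.1.
Qed.

End HomLocallyCompact.

Section FiniteClasses.

(** Finitely many invariants with finitely many values each divide [S] into
    finitely many classes. *)
Lemma finite_classes (X J Z : eqType) (d : J -> X -> Z) (F : J -> seq Z) (l : seq J) (S : set X) :
  (forall j f, j \in l -> S f -> d j f \in F j) ->
  exists s : seq X, forall f, S f -> exists2 g, g \in s & S g /\ forall j, j \in l -> d j f = d j g.
Proof.
elim: l S => [|j l IHl] S SF.
  have [[f0 Sf0]|nS] := pselect (exists f, S f); last by exists [::] => f Sf; case: nS; exists f.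
  by exists [:: f0] => f Sf; exists f0; rewrite ?mem_head.
have IH z : exists s : seq X, forall f, S f /\ d j f = z -> exists2 g, g \in s &
    (S g /\ d j g = z) /\ forall i, i \in l -> d i f = d i g.
  by apply: IHl => i f il [Sf _]; apply: SF => //; rewrite inE il orbT.
have [s sP] := choice IH.
exists (flatten [seq s z | z <- F j]) => f Sf.
have [g gs [[Sg gz] gl]] := sP (d j f) f (conj Sf erefl).
exists g; first by apply/flattenP; exists (s (d j f)) => //; apply: map_f; apply: SF => //; exact: mem_head.
by split=> // i; rewrite inE => /predU1P[->|/gl].
Qed.

End FiniteClasses.

(** * Multiplication by a prime on the group of homomorphisms *)

Lemma sumrMz (A : zmodType) (I : Type) (s : seq I) (P : pred I) (F : I -> A) (k : int) :
  (\sum_(i <- s | P i) F i) *~ k = \sum_(i <- s | P i) F i *~ k.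
Proof. by apply: (big_morph (fun x => x *~ k)) => [x y|]; rewrite ?mulrzDl ?mul0rz. Qed.

Section ModPBasis.
Variables (A : zmodType) (p : nat).
Hypothesis pp : prime p.

Definition gen_mod r (a : 'I_r -> A) := forall x, exists y (n : 'I_r -> int),
  x = y *+ p + \sum_i a i *~ n i.

Definition indep_mod r (a : 'I_r -> A) := forall y (n : 'I_r -> int),
  \sum_i a i *~ n i = y *+ p -> forall i, exists m, n i = m * p%:Z.

(** As long as there is a relation with a coefficient prime to [p], Bezout
    expresses the corresponding generator, modulo [p], by the others. *)
Lemma basis_mod : (exists s : seq A, forall x, exists2 a, a \in s & exists y, x = y *+ p + a) ->
  exists r (a : 'I_r -> A), gen_mod a /\ indep_mod a.
Proof.
move=> [s sP].
suff : forall r (a : 'I_r -> A), gen_mod a -> exists r (a : 'I_r -> A), gen_mod a /\ indep_mod a.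
  move=> /(_ _ (fun i : 'I_(size s) => tnth (in_tuple s) i)); apply.
  move=> x; have [a /(tnthP (in_tuple s))[j ->] [y ->]] := sP x.
  exists y, (fun i => (i == j)%:Z); congr (_ + _).
  rewrite (bigD1 j)//= eqxx mulr1z big1 ?addr0// => i /negPf ->; exact: mulr0z.
elim=> [|r IHr] a ga; first by exists 0%N, a; split=> // y n _ [].
have [ia|] := pselect (indep_mod a); first by exists r.+1, a.
move=> /existsNP[y /existsNP[n /not_implyP[e /existsNP[j nj]]]].
apply: (IHr (fun i => a (lift j i))) => x; have [z [k ->]] := ga x.
have [u [v uv]] : exists u v : int, u * n j + v * p%:Z = 1.
  have cop : coprimez (n j) p%:Z.
    rewrite coprimezE /= coprime_sym prime_coprime//; apply/negP => h; apply: nj.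
    have : (p%:Z %| n j)%Z by rewrite dvdzE.
    by move=> /dvdzP[m mE]; exists m.
  by have [u [v uv]] := Bezoutz (n j) p%:Z; exists u, v; rewrite uv; exact/eqP.
exists (z + (y *~ u + a j *~ v) *~ k j), (fun i => k (lift j i) - k j * (u * n (lift j i))).
rewrite (bigD1_ord j)//= mulrnDl -addrA; congr (_ + _).
have -> : \sum_i a (lift j i) *~ (k (lift j i) - k j * (u * n (lift j i))) =
   \sum_i a (lift j i) *~ k (lift j i) - (\sum_i a (lift j i) *~ n (lift j i)) *~ u *~ k j.
  rewrite !sumrMz -sumrB; apply: eq_bigr => i _; rewrite mulrzBr; congr (_ - _).
  by rewrite -!mulrzA; congr (_ *~ _); ring.
rewrite (bigD1_ord j)//= in e; move/(canRL (addKr _)) : e => ->.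
rewrite [in RHS]addrA [RHS]addrAC addrC [in RHS]addrC; congr (_ + _).
rewrite -{1}[a j]mulr1z -uv.
rewrite mulrzDr !mulrzDl !mulrnDl !mulNrz.
rewrite !pmulrn -!mulrzA.
have -> : u * n j * k j = n j * u * k j by ring.
have -> : v * p%:Z * k j = v * k j * p%:Z by ring.
have -> : n j * (u * k j) = n j * u * k j by ring.
have -> : v * (k j * p%:Z) = v * k j * p%:Z by ring.
have -> : p%:Z * (u * k j) = u * (k j * p%:Z) by ring.
by rewrite opprD opprK [RHS]addrC addrA subrK.
Qed.

End ModPBasis.

Section MulHom.
Variables (A B : topologicalZmodType) (p : nat).
Hypotheses (pp : prime p) (mA : mulfin A p) (mB : mulfin B p).
Hypotheses (lA : LCA A) (lB : LCA B).
Variables (r : nat) (a : 'I_r -> A).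
Hypotheses (ga : gen_mod p a) (ia : indep_mod p a).

(** The last formula defines [g]. By independence modulo [p], two expressions
    of the same point arise from each other by carrying multiples of [p] from
    the coefficients to [y] and by changing [y] by [p]-torsion; by the
    hypotheses on [f] neither affects the value. *)
Lemma lift_mul (f : chom A B) (b : 'I_r -> B) : (forall x, x *+ p = 0 -> f x = 0) ->
  (forall i, f (a i) = b i *+ p) ->
  exists g : chom A B, g *+ p = f /\
    forall y n, g (y *+ p + \sum_i a i *~ n i) = f y + \sum_i b i *~ n i.
Proof.
move=> fk fb.
have ex x : exists yn : A * ('I_r -> int), x = yn.1 *+ p + \sum_i a i *~ yn.2 i.
  by have [y [n xE]] := ga x; exists (y, n).
have [yn ynE] := choice ex.
pose g x := f (yn x).1 + \sum_i b i *~ (yn x).2 i.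
have gE y n : g (y *+ p + \sum_i a i *~ n i) = f y + \sum_i b i *~ n i.
  set x := _ + _; rewrite /g; have := ynE x; set y0 := (yn x).1; set n0 := (yn x).2 => xE.
  have e : \sum_i a i *~ (n0 i - n i) = (y - y0) *+ p.
    rewrite mulrnBl (eq_bigr (fun i => a i *~ n0 i - a i *~ n i)); last by move=> i _; rewrite mulrzBr.
    rewrite sumrB; apply/eqP; rewrite subr_eq addrAC eq_sym subr_eq addrC.
    by rewrite ![_ + _ *+ p]addrC; apply/eqP; exact: xE.
  have [m mP] := choice (ia e).
  have k0 : (y - y0 - \sum_i a i *~ m i) *+ p = 0.
    rewrite mulrnBl -e -sumrMnl -sumrB big1// => i _.
    by rewrite mP mulrzA pmulrn subrr.
  have := fk _ k0; rewrite homB homB hom_sum => /eqP.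
  rewrite subr_eq0 => /eqP fy; apply/eqP.
  rewrite -subr_eq0 opprD addrACA -sumrB -[f y0 - f y]opprB fy addrC subr_eq0.
  by apply/eqP; apply: eq_bigr => i _; rewrite -mulrzBr mP mulrC mulrzA homMz -pmulrn fb.
have gB : zmod_morphism g.
  move=> x x'; rewrite {1}(ynE x) {1}(ynE x').
  have -> : (yn x).1 *+ p + \sum_i a i *~ (yn x).2 i - ((yn x').1 *+ p + \sum_i a i *~ (yn x').2 i) =
     ((yn x).1 - (yn x').1) *+ p + \sum_i a i *~ ((yn x).2 i - (yn x').2 i).
    rewrite mulrnBl opprD addrACA -sumrB; congr (_ + _); apply: eq_bigr => i _; by rewrite mulrzBr.
  rewrite gE homB /g opprD [RHS]addrACA -sumrB; congr (_ + _).
  by apply: eq_bigr => i _; rewrite mulrzBr.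
have g0 y : g (y *+ p) = f y.
  have := gE y (fun=> 0); rewrite !big1 ?addr0//; by move=> i _; rewrite mulr0z.
have gC : continuous g.
  apply: additive_continuous => // V V0; have [mo _ _] := mA.
  have := mo _ (hom_nbhs0 f V0); apply: filterS => _ [y fyV <-].
  by rewrite /preimage /mkset g0.
exists (mkhom gB gC); split=> //; apply: homP => x.
have -> : (mkhom gB gC *+ p) x = g x *+ p by exact: (zmorphMn (@eval_morph A B x)).
have -> : f x = f (yn x).1 *+ p + \sum_i f (a i) *~ (yn x).2 i.
  by rewrite {1}(ynE x) homD homMn hom_sum; congr (_ + _); apply: eq_bigr => i _; rewrite homMz.
rewrite /g mulrnDl -sumrMnl; congr (_ + _); apply: eq_bigr => i _.
by rewrite fb !pmulrn -!mulrzA mulrC.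
Qed.

Lemma gen_nat x : exists y (n : 'I_r -> 'I_p), x = y *+ p + \sum_i a i *+ n i.
Proof.
have [y [n ->]] := ga x; have p0 := prime_gt0 pp.
have np i : (`|(n i %% p%:Z)%Z| < p)%N.
  have := ltz_pmod (n i) (d := p%:Z) p0; have := modz_ge0 (n i) (d := p%:Z); lia.
exists (y + \sum_i a i *~ (n i %/ p%:Z)%Z), (fun i => Ordinal (np i)).
rewrite mulrnDl -addrA; congr (_ + _); rewrite -sumrMnl -big_split /=; apply: eq_bigr => i _.
rewrite {1}(divz_eq (n i) p%:Z) mulrzDr mulrzA pmulrn; congr (_ + _).
have := modz_ge0 (n i) (d := p%:Z); case: (n i %% p%:Z)%Z => // m /(_ _); lia.
Qed.

(** The finitely many remainders modulo [p], with which the quotients of the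
    elements of a compact set remain in a compact set. *)
Let digits : set A := [set - \sum_i a i *+ n i | n in [set: {ffun 'I_r -> 'I_p}]].

Let digits_compact : compact digits.
Proof. by apply: finite_compact; apply: finite_image; exact: finite_finset. Qed.

(** If [f] is small, it kills the finite [p]-torsion of [A], as zero is
    isolated in the [p]-torsion of [B], and its values at the [a i] are [p]
    times small elements. So [lift_mul] divides it by [p], and the result is
    small on [K] because only finitely many remainders occur. *)
Lemma hom_mul_open : mul_open (chom A B) p.
Proof.
move=> U /hom_nbhs0_basis[K [V [cK V0 KV]]].
have [moA fkA _] := mA; have [moB fkB _] := mB.
have [V2 [V20 _ V2V]] := nbhs0_halve V0.
have [V4 [V40 _ V4s]] := nbhs0_sums r V20.
have V50 := nbhs0_multiples p V40; set V5 := [set x | _] in V50.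
have [K1 cK1 K1P] := open_proper lA moA fkA (compact_addset cK digits_compact).
have n1 : nbhs (0 : chom A B) [set f | forall x, x *+ p = 0 -> f x = 0].
  have h : nbhs (0 : B) (~` [set b | b *+ p = 0 /\ b <> 0]).
    apply: finite_nbhs; [exact: lB.1| |by move=> [_]; apply].
    by apply: sub_finite_set fkB => b [].
  apply: filterS (nbhs_polar (finite_compact fkA) h) => f fP x xp.
  by apply: contrapT => fx; apply: (fP x xp); split=> //; rewrite -homMn xp hom0.
have n2 : nbhs (0 : chom A B) [set f | forall i, exists2 b, V5 b & b *+ p = f (a i)].
  apply: nbhs_forall => i.
  apply: filterS (nbhs_polar (@compact_set1 _ (a i)) (moB _ V50)) => f /(_ (a i) erefl)[b Vb bE].
  by exists b.
have n3 := nbhs_polar cK1 V20.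
apply: filterS (filterI n1 (filterI n2 n3)) => f [fk [fb f2]].
have /choice[b bP] : forall i, exists b, V5 b /\ b *+ p = f (a i).
  by move=> i; have [b Vb bE] := fb i; exists b.
have [|g [gp gE]] := @lift_mul f b fk; first by move=> i; have [] := bP i.
exists g => //; apply: KV => x Kx; have [y [n xE]] := gen_nat x.
have gx : g x = f y + \sum_i b i *+ n i by rewrite xE (gE y (fun i => n i : int)).
rewrite gx; apply: V2V.
  apply: f2; apply: K1P; exists (x, - \sum_i a i *+ n i); last by rewrite /= xE addrK.
  split=> //=; exists [ffun i => n i] => //; congr (- _); by apply: eq_bigr => i _; rewrite ffunE.
have -> : \sum_i b i *+ n i = \sum_(x <- [seq b i *+ n i | i <- enum 'I_r]) x.
  by rewrite big_map big_enum.
apply: V4s; first by rewrite size_map size_enum_ord.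
move=> _ /mapP[i _ ->]; have [Vb _] := bP i.
have [->|n0] := posnP (n i); first by rewrite mulr0n; exact: nbhs_singleton.
by apply: Vb; rewrite n0 ltnW.
Qed.

(** A homomorphism killed by [p] takes values in the finite [p]-torsion of [B]
    and is determined by those at representatives of [A] modulo [p]. *)
Lemma hom_mul_kernel : finite_set [set f : chom A B | f *+ p = 0].
Proof.
have [_ _ [s sP]] := mA; have [_ /finite_seqP[kB kBE] _] := mB.
pose S := [set f : chom A B | f *+ p = 0].
have fp f x : S f -> f x *+ p = 0.
  by move=> Sf; rewrite -(zmorphMn (@eval_morph A B x)) Sf.
have [|t tP] := @finite_classes (chom A B) A B (fun a f => f a) (fun=> kB) s S.
  move=> j f _ Sf; have : [set x : B | x *+ p = 0] (f j) by exact: fp.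
  by rewrite kBE.
apply: (@sub_finite_set _ _ [set` t]); last exact: finite_seq.
move=> f Sf; have [g gt [Sg fg]] := tP f Sf.
suff -> : f = g by [].
apply: homP => x; have [c cs [y ->]] := sP x.
by rewrite !homD !homMn !fp// fg.
Qed.

(** The class of [f] modulo [p] is determined by the values of [f] on the
    finite [p]-torsion of [A] and by the classes modulo [p] of its values at
    the [a i]: if these agree for two homomorphisms, [lift_mul] divides the
    difference. *)
Lemma hom_mul_cokernel : exists s : seq (chom A B), forall f, exists2 g, g \in s &
  exists h, f = h *+ p + g.
Proof.
have [_ /finite_seqP[kA kAE] _] := mA; have [_ /finite_seqP[kB kBE] [s sP]] := mB.
have ex b : exists c, c \in s /\ exists y, b = y *+ p + c.
  by have [c cs cP] := sP b; exists c.
have [c cP] := choice ex.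
pose d (z : bool * A) (f : chom A B) := if z.1 then f z.2 else c (f z.2).
pose F (z : bool * A) := if z.1 then kB else s.
pose l := [seq (true, x) | x <- kA] ++ [seq (false, a i) | i <- enum 'I_r].
have [|t tP] := @finite_classes (chom A B) _ B d F l setT.
  move=> j f; rewrite mem_cat => /orP[] /mapP[x xl ->] _ /=; last first.
    by have [] := cP (f (a x)).
  have : [set b : B | b *+ p = 0] (f x).
    have : [set` kA] x by [].
    by rewrite -kAE /= => xp; rewrite -homMn xp hom0.
  by rewrite kBE.
exists t => f; have [g gt [_ fg]] := tP f I; exists g => //.
have [|i|h [hE _]] := @lift_mul (f - g) (fun i => xget 0 [set b | (f - g) (a i) = b *+ p]).
- move=> x xp; have xk : x \in kA by have : [set x : A | x *+ p = 0] x by []; rewrite kAE.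
  have := fg (true, x); rewrite /d /= => e.
  rewrite -[LHS]/(f x - g x) e ?subrr// mem_cat; apply/orP; left; exact: map_f.
- case: xgetP => [b _ -> //|/(_ ((xget 0 [set y | f (a i) = y *+ p + c (f (a i))]) - (xget 0 [set y | g (a i) = y *+ p + c (g (a i))])))] h.
  exfalso; apply: h => /=.
  have e : c (f (a i)) = c (g (a i)).
    by apply: (fg (false, a i)); rewrite mem_cat; apply/orP; right; apply: map_f; rewrite mem_enum.
  rewrite -[LHS]/(f (a i) - g (a i)).
  have [_ [yf yfE]] := cP (f (a i)); have [_ [yg ygE]] := cP (g (a i)).
  rewrite mulrnBl.
  case: xgetP => [y _ /= h1|/(_ yf)//]; case: xgetP => [z _ /= h2|/(_ yg)//].
  by rewrite {1}h1 {1}h2 e opprD addrACA subrr addr0.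
by exists h; rewrite hE subrK.
Qed.

End MulHom.

Lemma hom_mulprimes (A B : topologicalZmodType) : LCA A -> LCA B -> mulprimes A -> mulprimes B ->
  mulprimes (chom A B).
Proof.
move=> lA lB mA mB p pp; have mAp := mA p pp; have mBp := mB p pp.
have [_ _ sA] := mAp; have [r [a [ga ia]]] := basis_mod pp sA.
by split; [exact: hom_mul_open ga ia|exact: hom_mul_kernel|exact: hom_mul_cokernel ga ia].
Qed.

(** * Real lines in the group of homomorphisms *)

Lemma compact_equicontinuous (A B : topologicalZmodType) (P : set (chom A B)) (V : set B) :
  LCA A -> compact P -> nbhs 0 V -> nbhs 0 [set a | forall f, P f -> V (f a)].
Proof.
move=> lA cP V0; move/compact_near_coveringP : cP.
move=> /(_ A (nbhs 0) (fun a f => V (f a)) _) H.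
suff : nbhs (0 : A) [set a | P `<=` [set f : chom A B | V (f a)]] by exact.
apply: H => f Pf.
have [|[Q S] /= [Qf S0] QS] := @eval_nbhs A B f 0 V lA; first by rewrite hom0.
by exists (Q, S) => //= -[g a] /= [Qg Sa]; exact: (QS (g, a)).
Qed.

Section EvalHom.
Variables (A B : topologicalZmodType) (a : A).

Lemma eval_continuous : continuous (fun f : chom A B => f a).
Proof.
apply: additive_continuous => [|V V0]; first exact: eval_morph.
by apply: filterS (nbhs_polar (@compact_set1 _ a) V0) => f /(_ a erefl).
Qed.

Definition evalhom : chom (chom A B) B := mkhom (@eval_morph A B a) eval_continuous.

End EvalHom.

Section HomFromReal.
Variables (R : realType) (A B : topologicalZmodType).
Hypotheses (lA : LCA A) (lB : LCA B).
Variables (sA : seq A) (sB : seq (pdual R B)).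
Hypothesis sepA : forall f : chom A R, (forall a, a \in sA -> f a = 0) -> f = 0.
Hypothesis sepB : forall f : chom (pdual R B) R, (forall chi, chi \in sB -> f chi = 0) -> f = 0.

(** A real line [phi] has a slope at each pair of a point of [A] and a
    character of [B]. The slope is additive and continuous in each variable,
    so it vanishes if it does so at the finitely many pairs that detect real
    homomorphisms on both sides. *)
Lemma homfrom_hom_finite : finite_dim (homfrom R (chom A B)).
Proof.
have [L LP] : {L : A * pdual R B -> homfrom R (chom A B) -> R | forall (z : A * pdual R B) (phi : chom R (chom A B)) t,
    z.2 ((phi t) z.1) = cpi R (L z phi * t)}.
  have ex (zp : (A * pdual R B) * homfrom R (chom A B)) : exists r, forall t,
      zp.1.2 ((zp.2 t) zp.1.1) = cpi R (r * t).
    exact: (char_real (comphom zp.1.2 (comphom (evalhom B zp.1.1) zp.2))).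
  have [L LP] := choice ex.
  by exists (fun z phi => L (z, phi)) => z phi t; exact: (LP (z, phi)).
have LE (a : A) (chi : pdual R B) (phi : homfrom R (chom A B)) r :
    (forall t, chi ((phi t) a) = cpi R (r * t)) -> L (a, chi) phi = r.
  by move=> h; apply: cpi_mul_inj => t; rewrite -(LP (a, chi)) -h.
apply: (@finite_sep_dims R (homfrom R (chom A B)) _ [seq (a, chi) | a <- sA, chi <- sB] L).
  move=> [a chi] c u v; apply: LE => t.
  have -> : (c *: u + v : homfrom R (chom A B)) t = u (c * t) + v t by [].
  rewrite -[(u (c * t) + v t) a]/(u (c * t) a + v t a) homD (LP (a, chi) u) (LP (a, chi) v) -homD.
  by congr (cpi R _); rewrite mulrDl mulrCA mulrA.
move=> phi phi0.
have P1c : compact (phi @` [set t | -1 <= t <= 1]).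
  apply: continuous_compact; first by apply: continuous_subspaceT; exact: hom_continuous.
  by have := @segment_compact R (-1) 1; rewrite set_itvE.
have cb : nbhs (0 : circle R) (cball 4^-1) by apply: cball_nbhs; rewrite invr_gt0.
have q0 : (0 : R) <= 4^-1 by rewrite invr_ge0.
have q2 : (4^-1 : R) < 2^-1 by lra.
have slopeA (chi : pdual R B) : chi \in sB -> forall a, L (a, chi) phi = 0.
  move=> chis; pose h a := L (a, chi) phi.
  have hB : zmod_morphism h.
    move=> a b; apply: LE => t; rewrite homB homB (LP (a, chi)) (LP (b, chi)) -homB.
    by rewrite -mulrBl.
  have hC : continuous h.
    apply: (@real_hom_continuous _ _ h 4^-1) => //.
    have := compact_equicontinuous lA P1c (hom_nbhs0 chi cb).
    apply: filterS => a aP; apply: small_slope => // t t1; rewrite mulrC -(LP (a, chi)).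
    by apply: aP; exists t => //=; rewrite -ler_norml.
  have h0 : mkhom hB hC = 0.
    by apply: sepA => a sa; apply: phi0; apply/allpairsP; exists (a, chi).
  by move=> a; rewrite -[LHS]/(mkhom hB hC a) h0.
have slopeB a (chi : pdual R B) : L (a, chi) phi = 0.
  pose h (chi : pdual R B) := L (a, chi) phi.
  have hB : zmod_morphism h.
    move=> c d; apply: LE => t; rewrite -[LHS]/(c (phi t a) - d (phi t a)).
    by rewrite (LP (a, c)) (LP (a, d)) -homB -mulrBl.
  have hC : continuous h.
    apply: (@real_hom_continuous _ _ h 4^-1) => //.
    have c2 : compact (evalhom B a @` (phi @` [set t | -1 <= t <= 1])).
      by apply: continuous_compact => //; apply: continuous_subspaceT; exact: hom_continuous.
    apply: filterS (nbhs_polar c2 cb) => c cP; apply: small_slope => // t t1.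
    rewrite mulrC -(LP (a, c)); apply: cP; exists (phi t) => //.
    by exists t => //=; rewrite -ler_norml.
  have h0 : mkhom hB hC = 0 by apply: sepB => c sc; exact: slopeA.
  by rewrite -[LHS]/(mkhom hB hC chi) h0.
apply: homP => t; apply: homP => a; apply: (enough_chars2 (R := R) lB) => chi.
by rewrite (LP (a, chi)) slopeB mul0r !hom0.
Qed.

End HomFromReal.

(** * Real homomorphisms on the group of homomorphisms *)

Lemma pigeonhole (T : eqType) (s : seq T) (g : nat -> T) : (forall q, g q \in s) ->
  exists q q', [/\ (q < q' <= size s)%N & g q = g q'].
Proof.
move=> gs.
have /(uniqPn (g 0%N))[i [j [ij js gij]]] : ~~ uniq (map g (iota 0 (size s).+1)).
  apply/negP => u; have : {subset map g (iota 0 (size s).+1) <= s} by move=> _ /mapP[q _ ->].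
  by move=> /(uniq_leq_size u); rewrite size_map size_iota ltnn.
rewrite size_map size_iota in js; exists i, j; split; first by rewrite ij -ltnS.
by move: gij; rewrite !(nth_map 0%N) ?size_iota ?(ltn_trans ij)// !nth_iota ?(ltn_trans ij).
Qed.

Lemma real_hom_zero (R : realType) (g : chom R R) : g 1 = 0 -> forall t, g t = 0.
Proof.
move=> g1 t; have cI : compact [set t : R | -1 <= t <= 1].
  by have := @segment_compact R (-1) 1; rewrite set_itvE.
have [M MP] := compact_bound g cI.
apply: (@bounded_multiples0 _ _ M) => n; rewrite -homMn.
have -> : g (t *+ n) = g (t *+ n - (Num.floor (t *+ n))%:~R).
  by rewrite homB homMz g1 mul0rz subr0.
apply: MP => /=; have /andP[h1 h2] := floor_itv (t *+ n); rewrite intrD in h2.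
by apply/andP; split; lra.
Qed.

(** The multiples of [x] also lie in [G], so all multiples of [h x] are within
    1/4 of zero. *)
Lemma small_zero (R : realType) (A : zmodType) (P : set A) (G : zmodClosed A) k (e : 'I_k -> A)
    (h : A -> circle R) : zmod_morphism h ->
  (forall x, x \in G -> exists c z, P c /\ x = c + \sum_i e i *~ z i) ->
  (forall i, h (e i) = 0) -> (forall c, P c -> cball 4^-1 (h c)) ->
  forall x, x \in G -> h x = 0.
Proof.
move=> hB GC he hP x xG; apply: cball_subgroup => j; rewrite -(zmorphMn hB).
have [c [z [Pc ->]]] := GC _ (rpredMn j xG).
have hl : h (\sum_i e i *~ z i) = 0.
  apply: (big_ind (fun y => h y = 0)) => [|y y' hy hy'|i _]; first exact: zmorph0.
    by rewrite (zmorphD hB) hy hy' addr0.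
  case: (z i) => m; rewrite ?NegzE ?mulrNz -?pmulrn ?(zmorphN hB) ?(zmorphMn hB) he mul0rn ?oppr0//.
by rewrite (zmorphD hB) hl addr0; exact: hP.
Qed.

Section HomToReal.
Variables (R : realType) (A B : topologicalZmodType).
Hypotheses (lB : LCA B) (mA : mulprimes A) (mB : mulprimes B).
Variables (C : set A) (G : zmodClosed A) (D : set (pdual R B)) (H : zmodClosed (pdual R B)).
Hypotheses (tA : torsion_mod C G) (tB : torsion_mod D H).
Variables (k : nat) (e : 'I_k -> A) (rho : 'I_k -> chom A R) (n : nat).
Hypotheses (eG : forall i, e i \in G) (rhoe : forall i j, rho i (e j) = (i == j)%:R).
Hypothesis GC : forall x, x \in G -> exists c z, sumset n C c /\ x = c + \sum_i e i *~ z i.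
Variables (l : nat) (w : 'I_l -> pdual R B) (sig : 'I_l -> chom (pdual R B) R) (m : nat).
Hypothesis (sigw : forall i j, sig i (w j) = (i == j)%:R).
Hypothesis HC : forall x, x \in H -> exists c z, sumset m D c /\ x = c + \sum_i w i *~ z i.
Local Notation X := (chom A B).

Let q0 : (0 : R) < 4^-1. Proof. by rewrite invr_gt0. Qed.

Let CG c : C c -> c \in G.
Proof. by move=> Cc; have [_ GP _] := tA; apply/GP; exists 1%N; exact: sumset1. Qed.

Let DH c : D c -> c \in H.
Proof. by move=> Dc; have [_ HP _] := tB; apply/HP; exists 1%N; exact: sumset1. Qed.

(** On an open subgroup of [G] that contains the lattice, hence has finite
    index, [b] pairs trivially with [H]. So a multiple of [b] pairs trivially
    with [H] on all of [G]. The multiples of that one lie in the compact set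
    [smallhoms], on which [f] is bounded. *)
Lemma lattice_trivial_zero (f : chom X R) (b : X) :
  (forall i chi, chi \in H -> chi (b (e i)) = 0) ->
  (forall j a, a \in G -> w j (b a) = 0) -> f b = 0.
Proof.
move=> be bw; have [[cC C0 CN] GP _] := tA; have [[cD D0 DN] HP _] := tB.
pose K a := forall chi, chi \in H -> chi (b a) = 0.
have KB x y : K x -> K y -> K (x - y).
  by move=> Kx Ky chi chiH; rewrite !homB Kx// Ky// subrr.
have KO : nbhs 0 [set a | a \in G /\ K a].
  have G0 : nbhs 0 (fun a => a \in G) by exact: filterS C0.
  have := compact_equicontinuous lB (compact_sumset (n := m) cD) (cball_nbhs q0).
  move=> /(hom_nbhs0 b) h; apply: filterS (filterI G0 h) => a [aG ha]; split=> // chi chiH.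
  apply: (@small_zero R _ (sumset m D) H l w (fun chi : pdual R B => chi (b a))) chi chiH => //.
  by move=> j; exact: bw.
have [|s [_ sP]] := @compact_cover_seq _ (sumset n C) (fun y => [set x | K (x - y)]) (compact_sumset cC).
  move=> x _; rewrite -nbhs_shift0; apply: filterS KO => z [_ Kz].
  by rewrite /= addrAC subrr add0r.
(* Two of the multiples [a *+ q] with [q <= size s] agree modulo the subgroup
   [K], so the order of [a] modulo [K] divides the factorial. *)
have KM a : a \in G -> K (a *+ (size s)`!).
  move=> aG.
  have ex q : exists y, y \in s /\ K (a *+ q - y).
    have [c [z [cC' aE]]] := GC (rpredMn q aG); have [y ys Kcy] := sP c cC'.
    exists y; split=> //; rewrite aE addrAC -[\sum_i _]opprK; apply: KB => // chi chiH.
    rewrite homN homN !hom_sum big1 ?oppr0// => i _.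
    by rewrite !homMz be// mul0rz.
  have [y yP] := choice ex.
  have [|q [q' [/andP[qq' q's] yqq]]] := @pigeonhole _ s y; first by move=> q; have [] := yP q.
  have Kd : K (a *+ (q' - q)).
    rewrite mulrnBr ?(ltnW qq')//.
    have [_ h1] := yP q'; have [_ h2] := yP q; have := KB _ _ h1 h2.
    by rewrite yqq opprB addrA subrK.
  have /dvdnP[t ->] : (q' - q %| (size s)`!)%N by apply: dvdn_fact; rewrite subn_gt0 qq' (leq_trans (leq_subr _ _) q's).
  by move=> chi chiH; rewrite mulnC mulrnA homMn homMn Kd// mul0rn.
have cW := smallhoms_compact lB mA mB tA tB.
have [M MP] := compact_bound f cW.
have : f (b *+ (size s)`!) = 0.
  apply: (@bounded_multiples0 _ _ M) => j; rewrite -homMn; apply: MP => c Cc chi Dchi.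
  have -> : (b *+ (size s)`! *+ j) c = b (c *+ (size s)`!) *+ j.
    by rewrite !(zmorphMn (@eval_morph A B c)) homMn.
  by rewrite homMn (KM c (CG Cc) chi (DH Dchi)) mul0rn; apply: cball0; rewrite invr_ge0.
rewrite homMn => /eqP; rewrite mulrn_eq0 => /orP[|/eqP//].
by rewrite eqn0Ngt fact_gt0.
Qed.

Definition slopeline (j : 'I_l) : chom R B := comphom (alpha_inv R lB) (realline (sig j)).

Lemma slopelineE j (chi : pdual R B) t : chi (slopeline j t) = cpi R (t * sig j chi).
Proof. by rewrite alpha_invE. Qed.

(** The pairing [(a, chi) |-> t * rho i a * sig j chi] modulo integers. These
    homomorphisms span a [k * l]-dimensional real space. *)
Definition rankone i j (t : R) : X := comphom (slopeline j) (comphom (scalehom t) (rho i)).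

Lemma rankoneB i j : zmod_morphism (rankone i j).
Proof.
move=> s t; apply: homP => a.
transitivity (slopeline j (s * rho i a) - slopeline j (t * rho i a)); last by [].
by rewrite -homB -mulrBl.
Qed.

Lemma rankone_continuous i j : continuous (rankone i j).
Proof.
apply: continuous_curry => t a U Uta.
have : nbhs (t * rho i a) (slopeline j @^-1` U) by exact: hom_nbhs.
have c2 : {for (t, a), continuous (fun z : R * A => rho i z.2)}.
  by apply: (@continuous_comp _ _ _ snd (rho i)); [exact: cvg_snd|exact: hom_continuous].
have rc : (fun z : R * A => z.1 * rho i z.2) @ (t, a) --> t * rho i a.
  by apply: cvgM; [exact: cvg_fst|exact: c2].
by move=> /rc.
Qed.

Definition rankoneline i j : chom R X := mkhom (@rankoneB i j) (@rankone_continuous i j).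

Definition kills (f : chom X R) := forall i j, f (rankone i j 1) = 0.

Lemma kills_rankone f i j t : kills f -> f (rankone i j t) = 0.
Proof.
move=> kf; exact: (@real_hom_zero R (comphom f (rankoneline i j)) (kf i j)).
Qed.

Lemma rankone_sumE (c : 'I_k -> 'I_l -> R) a (chi : pdual R B) :
  chi ((\sum_i \sum_j rankone i j (c i j) : X) a) =
  cpi R (\sum_i \sum_j c i j * rho i a * sig j chi).
Proof.
have sE (I : Type) (s : seq I) (F : I -> X) : (\sum_(i <- s) F i : X) a = \sum_(i <- s) F i a.
  by apply: (big_morph (fun h : X => h a)).
rewrite sE !hom_sum; apply: eq_bigr => i _; rewrite sE !hom_sum; apply: eq_bigr => j _.
exact: slopelineE.
Qed.

(** Let [c i j] be the small representatives of the values of [b] at pairs of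
    lattice generators, and subtract from [b] the corresponding combination of
    rank-one homomorphisms, on which [f] vanishes. The difference vanishes at
    pairs of lattice points and is still small where one argument is in the
    lattice generators and the other in the compact part; so it is trivial
    there by [small_zero], and [lattice_trivial_zero] applies. *)
Lemma kills_small : exists (VB : set B) (VA : set (pdual R A)), [/\ nbhs 0 VB, nbhs 0 VA &
  forall f (b : X), kills f -> (forall i, VB (b (e i))) -> (forall j, VA (comphom (w j) b)) -> f b = 0].
Proof.
have [[cC C0 CN] GP _] := tA; have [[cD D0 DN] HP _] := tB.
have [M MP] : exists M, 0 <= M /\ forall i c, sumset n C c -> `|rho i c| <= M.
  have [M MP] := choice (fun i => compact_bound (rho i) (compact_sumset (n := n) cC)).
  exists (\sum_i `|M i|); split=> [|i c /MP h]; first exact: sumr_ge0.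
  apply: le_trans (h i) _; apply: le_trans (ler_norm _) _.
  by rewrite (bigD1 i)//= lerDl sumr_ge0.
have [M' MP'] : exists M, 0 <= M /\ forall i c, sumset m D c -> `|sig i c| <= M.
  have [M' MP'] := choice (fun i => compact_bound (sig i) (compact_sumset (n := m) cD)).
  exists (\sum_i `|M' i|); split=> [|i c /MP' h]; first exact: sumr_ge0.
  apply: le_trans (h i) _; apply: le_trans (ler_norm _) _.
  by rewrite (bigD1 i)//= lerDl sumr_ge0.
case: MP => M0 MP; case: MP' => M'0 MP'.
have [N NP] : exists N, forall i, sumset N C (e i).
  have [N NP] := choice (fun i => (GP (e i)).1 (eG i)).
  exists (\sum_i N i)%N => i; apply: (@sumset_le _ (N i)) (NP i); first exact: nbhs_singleton.
  by rewrite (bigD1 i)//= leq_addr.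
(* The estimates at the end of the proof are sums of terms of [S], times [d];
   they have to stay within 1/4. *)
pose S : R := 1 + n%:R + m%:R + N%:R * (l%:R * M') + N%:R * (k%:R * M).
have S1 : 1 <= S by rewrite /S -!addrA lerDl !addr_ge0 ?mulr_ge0.
have S0 : 0 < S by exact: lt_le_trans S1.
pose d := 4^-1 / S.
have d0 : 0 < d by rewrite divr_gt0.
have dS s : s <= S -> s * d <= 4^-1.
  by move=> sS; rewrite /d mulrCA ger_pMr// ler_pdivrMr// mul1r.
exists (polar D d), [set chi : chom A (circle R) | forall c, C c -> cball d (chi c)]; split.
- exact: polar_nbhs.
- by apply: nbhs_polar => //; exact: cball_nbhs.
move=> f b kf bD bC.
have ex (ij : 'I_k * 'I_l) : exists c, `|c| <= N%:R * d /\ cpi R c = w ij.2 (b (e ij.1)).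
  have := @sumset_morph A (circle R) (comphom (w ij.2) b) N C (cball d) (e ij.1)
    (homB (comphom (w ij.2) b)) (bC ij.2) (NP ij.1).
  by move=> /cball_sumset[c cb cE]; exists c.
have [c0 c0P] := choice ex; pose c i j := c0 (i, j).
have cb i j : `|c i j| <= N%:R * d by have [] := c0P (i, j).
have cE i j : cpi R (c i j) = w j (b (e i)) by have [] := c0P (i, j).
pose b' : X := b - \sum_i \sum_j rankone i j (c i j).
have b'E a (chi : pdual R B) : chi (b' a) = chi (b a) - cpi R (\sum_i \sum_j c i j * rho i a * sig j chi).
  rewrite -rankone_sumE -homB; by [].
have -> : f b = f b' + f (\sum_i \sum_j rankone i j (c i j)) by rewrite -homD subrK.
have -> : f (\sum_i \sum_j rankone i j (c i j)) = 0.
  rewrite hom_sum big1// => i _; rewrite hom_sum big1// => j _; exact: kills_rankone.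
rewrite addr0; apply: lattice_trivial_zero => [i chi chiH|j a aG].
  have sE chi' : \sum_i0 \sum_j c i0 j * rho i0 (e i) * sig j chi' = \sum_j c i j * sig j chi'.
    rewrite (bigD1 i)//= [X in _ + X]big1 ?addr0.
      by apply: eq_bigr => j _; rewrite rhoe eqxx mulr1.
    by move=> i' i'i; rewrite big1// => j _; rewrite rhoe (negPf i'i) mulr0 mul0r.
  apply: (@small_zero R _ (sumset m D) H l w (fun chi : pdual R B => chi (b' (e i)))) chi chiH => //.
    move=> j; rewrite b'E sE (bigD1 j)//= sigw eqxx mulr1 big1 ?addr0 ?cE ?subrr//.
    by move=> j' j'j; rewrite sigw (negPf j'j) mulr0.
  move=> chi chiD; rewrite b'E sE.
  have h1 : cball (m%:R * d) (chi (b (e i))).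
    exact: (cball_sumset (sumset_morph (f := fun chi : pdual R B => chi (b (e i))) (@eval_morph B _ (b (e i))) (bD i) chiD)).
  have h2 : cball (N%:R * d * (l%:R * M')) (cpi R (\sum_j c i j * sig j chi)).
    apply: cball_cpi; apply: le_trans (ler_norm_sum _ _ _) _.
    apply: (@le_trans _ _ (\sum_(j < l) N%:R * d * M')).
      by apply: ler_sum => j _; rewrite normrM ler_pM ?MP'.
    by rewrite sumr_const card_ord -[X in X <= _]mulr_natl mulrCA.
  apply: (cball_le _ (cballD h1 (cballN h2))).
  rewrite mulrAC -mulrDl; apply: dS; rewrite /S.
  have := ler0n R n; have : 0 <= N%:R * (k%:R * M) by rewrite !mulr_ge0.
  by lra.
have sE a' : \sum_i \sum_j0 c i j0 * rho i a' * sig j0 (w j) = \sum_i c i j * rho i a'.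
  apply: eq_bigr => i _; rewrite (bigD1 j)//= sigw eqxx mulr1 big1 ?addr0//.
  by move=> j' j'j; rewrite sigw (negPf j'j) mulr0.
apply: (@small_zero R _ (sumset n C) G k e (comphom (w j) b')) a aG => //; first exact: homB.
  move=> i; rewrite /= b'E sE (bigD1 i)//= rhoe eqxx mulr1 big1 ?addr0 ?cE ?subrr//.
  by move=> i' i'i; rewrite rhoe (negPf i'i) mulr0.
move=> a aC; rewrite /= b'E sE.
have h1 : cball (n%:R * d) (w j (b a)).
  exact: (cball_sumset (sumset_morph (homB (comphom (w j) b)) (bC j) aC)).
have h2 : cball (N%:R * d * (k%:R * M)) (cpi R (\sum_i c i j * rho i a)).
  apply: cball_cpi; apply: le_trans (ler_norm_sum _ _ _) _.
  apply: (@le_trans _ _ (\sum_(j < k) N%:R * d * M)).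
    by apply: ler_sum => i _; rewrite normrM ler_pM ?MP.
  by rewrite sumr_const card_ord -[X in X <= _]mulr_natl mulrCA.
apply: (cball_le _ (cballD h1 (cballN h2))).
rewrite mulrAC -mulrDl; apply: dS; rewrite /S.
have := ler0n R m; have : 0 <= N%:R * (l%:R * M') by rewrite !mulr_ge0.
by lra.
Qed.

End HomToReal.

(** * Finite ranks of the group of homomorphisms *)

(** For a group that is torsion modulo a compactly generated subgroup,
    compactness up to multiples only has to be tested by finitely many real
    coordinates, those of [lattice_LCA]. *)
Lemma bounded_compact (R : realType) (Z : topologicalZmodType) : LCA Z ->
  (exists s : seq Z, forall f : chom Z R, (forall a, a \in s -> f a = 0) -> f = 0) ->
  exists (G : zmodClosed Z) d (rho : 'I_d -> chom Z R),
  (forall P : set Z, compact P -> exists2 M, (0 < M)%N & forall y, P y -> y *+ M \in G) /\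
  forall b : R, exists2 K : set Z, compact K &
    forall x, x \in G -> (forall i, `|rho i x| <= b) -> K x.
Proof.
move=> lZ /(torsion_mod_ex lZ)[C [G tG]]; have [[cC C0 CN] GP _] := tG.
have [k [e [rho [n [eG rhoe GC]]]]] := lattice_LCA R cC C0 CN GP.
exists G, k, rho; split=> [P cP|b].
  have [M M0 [m mP]] := torsion_mod_compact tG cP.
  by exists M => // y /mP h; apply/GP; exists m.
have [m mP] := lattice_bounded cC C0 CN GP eG rhoe GC b.
by exists (sumset m C); [exact: compact_sumset|exact: mP].
Qed.

(** The sequence converges along the ultrafilter. *)
Lemma recurrence (Z : topologicalZmodType) (v : set_system nat) (u : nat -> Z) (K V : set Z) :
  UltraFilter v -> compact K -> (forall t, K (u t)) -> nbhs 0 V ->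
  exists2 E, v E & forall t t', E t -> E t' -> V (u t - u t').
Proof.
move=> uv; rewrite compact_ultra => cK Ku V0.
have [] := cK _ (ultra_fmap u uv).
  have Fv : Filter v by apply: filter_filter.
  exact: (@filterS _ v Fv setT _ (fun t _ => Ku t) (@filterT _ v Fv)).
move=> z [_ uz]; have [W [W0 WN WV]] := nbhs0_halve V0.
have Wz : nbhs z (fun y => W (y - z)).
  by rewrite -nbhs_shift0; apply: filterS W0 => y Wy; rewrite addrAC subrr add0r.
exists (fun t => W (u t - z)); first exact: (uz _ Wz).
move=> t t' /= h h'; have := WV _ _ h (WN _ h').
by rewrite opprB addrA subrK.
Qed.

Lemma kernel_vector (R : realType) (I : finType) r (L : I -> 'I_r -> R) : (#|I| < r)%N ->
  exists v : 'I_r -> R, (exists s, v s = 1) /\ forall q, \sum_s v s * L q s = 0.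
Proof.
move=> Ir; pose M : 'M[R]_(r, #|I|) := \matrix_(s, q) L (enum_val q) s.
have k0 : kermx M != 0.
  rewrite -mxrank_eq0 mxrank_ker subn_eq0 -ltnNge.
  exact: leq_ltn_trans (rank_leq_col M) Ir.
pose v0 := nz_row (kermx M).
have vn0 : v0 != 0 by rewrite nz_row_eq0.
have vM : v0 *m M = 0 by apply/sub_kermxP; exact: nz_row_sub.
have /rV0Pn[s vs] := vn0.
exists (fun s' => v0 0 s' / v0 0 s); split; first by exists s; rewrite divff.
move=> q; have := congr1 (fun N : 'rV[R]_#|I| => N 0 (enum_rank q)) vM; rewrite !mxE => h.
rewrite -[RHS](mul0r (v0 0 s)^-1) -[X in X / _]h mulr_suml; apply: eq_bigr => s' _.
by rewrite !mxE enum_rankK mulrAC.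
Qed.

(** If the images of any [d] elements under [F] satisfy a common integral
    relation, there is a maximal independent family with fewer than [d]
    members, and every other element has a multiple in its span. *)
Lemma finite_rank_sep (R : realType) (X : topologicalZmodType) (F : set (chom X R)) :
  (exists d, forall x : 'I_d -> X, exists2 n : 'I_d -> int, (exists i, n i != 0) &
    forall f, F f -> f (\sum_i x i *~ n i) = 0) ->
  exists s : seq X, forall f, F f -> (forall x, x \in s -> f x = 0) -> forall x, f x = 0.
Proof.
move=> [d]; elim: d => [|d IHd] rel.
  by have [n [[]//]] := rel (fun=> 0).
have [/IHd//|/existsNP[x nx]] := pselect (forall x : 'I_d -> X,
  exists2 n : 'I_d -> int, (exists i, n i != 0) & forall f, F f -> f (\sum_i x i *~ n i) = 0).
exists [seq x i | i <- enum 'I_d] => f Ff fs y.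
have [n [i ni] nP] := rel (fun i => oapp x y (unlift ord0 i)).
have sE : \sum_i oapp x y (unlift ord0 i) *~ n i = y *~ n ord0 + \sum_i x i *~ n (lift ord0 i).
  by rewrite big_ord_recl unlift_none /=; congr (_ + _); apply: eq_bigr => j _; rewrite liftK.
have n00 : n ord0 != 0.
  apply/eqP => n0; apply: nx; exists (fun i => n (lift ord0 i)).
    case: (unliftP ord0 i) => [j ij|ij]; first by exists j; rewrite -ij.
    by rewrite ij n0 eqxx in ni.
  by move=> g /nP; rewrite sE n0 mulr0z add0r.
have := nP f Ff; rewrite sE homD hom_sum big1 ?addr0.
  by rewrite homMz => /eqP; rewrite mulrz_eq0 (negPf n00) => /eqP.
by move=> j _; rewrite homMz fs ?mul0rz//; apply: map_f; rewrite mem_enum.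
Qed.

Section HomToRealFinite.
Variables (R : realType) (A B : topologicalZmodType).
Hypotheses (lA : LCA A) (lB : LCA B) (mA : mulprimes A) (mB : mulprimes B).
Hypothesis sepA : exists s : seq A, forall f : chom A R, (forall a, a \in s -> f a = 0) -> f = 0.
Hypothesis sepB : exists s : seq B, forall f : chom B R, (forall a, a \in s -> f a = 0) -> f = 0.
Hypothesis sepA' : exists s : seq (pdual R A), forall f : chom (pdual R A) R,
  (forall a, a \in s -> f a = 0) -> f = 0.
Hypothesis sepB' : exists s : seq (pdual R B), forall f : chom (pdual R B) R,
  (forall a, a \in s -> f a = 0) -> f = 0.
Local Notation X := (chom A B).

Lemma comphomBl (w : pdual R B) : zmod_morphism (fun b : X => comphom w b : pdual R A).
Proof. by move=> x y; apply: homP => a; exact: homB. Qed.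

(** Take one more element [x s] than there are slopes [L q], and a real vector
    [v] such that all slopes of [x] combined with coefficients [v] vanish. The
    integral combinations [b t] with coefficients [floor (t * v)] have bounded
    slopes, so multiples of their values lie in compact sets. By recurrence
    two of them, [b t0] and [b t1], differ by an element that, up to a
    multiple, is small in the sense of [VB] and [VA], so that [F] kills it.
    The relation is nontrivial because [v] has a coefficient 1. *)
Lemma relations k l (e : 'I_k -> A) (w : 'I_l -> pdual R B) (F : set (chom X R))
    (VB : set B) (VA : set (pdual R A)) : nbhs 0 VB -> nbhs 0 VA ->
  (forall f (b : X), F f -> (forall i, VB (b (e i))) -> (forall j, VA (comphom (w j) b)) -> f b = 0) ->
  exists d, forall x : 'I_d -> X, exists2 n : 'I_d -> int, (exists i, n i != 0) &
    forall f, F f -> f (\sum_i x i *~ n i) = 0.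
Proof.
move=> VB0 VA0 FV.
have [GB [dB [rB [tB KB]]]] := bounded_compact lB sepB.
have [GA [dA [rA [tA KA]]]] := bounded_compact (pdual_LCA R lA) sepA'.
pose I : finType := (('I_k * 'I_dB) + ('I_l * 'I_dA))%type.
pose L (q : I) (b : X) : R := match q with
  | inl iq => rB iq.2 (b (e iq.1)) | inr jq => rA jq.2 (comphom (w jq.1) b) end.
have LB q : zmod_morphism (L q).
  case: q => -[i q] b b' /=; first by rewrite -homB.
  by rewrite comphomBl homB.
exists #|I|.+1 => x.
have [v [[s0 vs0] vL]] := kernel_vector (fun q s => L q (x s)) (ltnSn #|I|).
pose nn (t : nat) s : int := Num.floor (t%:R * v s).
pose b t := \sum_s x s *~ nn t s.
have Lsum q (n : 'I_#|I|.+1 -> int) : L q (\sum_s x s *~ n s) = \sum_s (n s)%:~R * L q (x s).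
  elim/big_rec2: _ => [|i y z _ <-]; first exact: (zmorph0 (LB q)).
  rewrite (zmorphD (LB q)); congr (_ + _); rewrite mulrzl.
  by case: (n i) => j; rewrite ?NegzE ?mulrNz -?pmulrn ?(zmorphN (LB q)) (zmorphMn (LB q)).
pose bd := \sum_q \sum_s `|L q (x s)|.
have bdP q t : `|L q (b t)| <= bd.
  have -> : L q (b t) = \sum_s ((nn t s)%:~R - t%:R * v s) * L q (x s).
    have h0 : \sum_s t%:R * v s * L q (x s) = 0.
      transitivity (t%:R * \sum_s v s * L q (x s)); last by rewrite vL mulr0.
      by rewrite mulr_sumr; apply: eq_bigr => s _; rewrite mulrA.
    by under [RHS]eq_bigr do rewrite mulrBl; rewrite sumrB h0 subr0 Lsum.
  apply: le_trans (ler_norm_sum _ _ _) _; apply: (@le_trans _ _ (\sum_s `|L q (x s)|)).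
    apply: ler_sum => s _; rewrite normrM -[leRHS]mul1r ler_wpM2r//.
    have /andP[h1 h2] := floor_itv (t%:R * v s); rewrite intrD in h2.
    by rewrite ler_norml; apply/andP; split; rewrite /nn; lra.
  rewrite /bd (bigD1 q)//= lerDl; apply: sumr_ge0 => q' _; exact: sumr_ge0.
have [MB MB0 MBP] : exists2 M, (0 < M)%N & forall i t, b t (e i) *+ M \in GB.
  have cP : compact [set z | exists s i, z = x s (e i)].
    rewrite (_ : [set z | _] = (fun si : 'I_#|I|.+1 * 'I_k => x si.1 (e si.2)) @` setT).
      by apply: finite_compact; apply: finite_image; exact: finite_finset.
    by apply/seteqP; split=> [z [s [i ->]]|_ [[s i] _ <-]]; [exists (s, i)|exists s, i].
  have [M M0 MP] := tB _ cP; exists M => // i t.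
  have -> : b t (e i) *+ M = \sum_s (x s (e i) *+ M) *~ nn t s.
    rewrite -[b t (e i)]/(evalhom B (e i) (b t)) hom_sum -sumrMnl; apply: eq_bigr => s _.
    by rewrite homMz !pmulrn -!mulrzA mulrC.
  by apply: rpred_sum => s _; apply: rpredMz; apply: MP; exists s, i.
have [MA MA0 MAP] : exists2 M, (0 < M)%N & forall j t, (comphom (w j) (b t) : pdual R A) *+ M \in GA.
  have cP : compact [set z : pdual R A | exists s j, z = comphom (w j) (x s)].
    rewrite (_ : [set z | _] = (fun si : 'I_#|I|.+1 * 'I_l => comphom (w si.2) (x si.1) : pdual R A) @` setT).
      by apply: finite_compact; apply: finite_image; exact: finite_finset.
    by apply/seteqP; split=> [z [s [i ->]]|_ [[s i] _ <-]]; [exists (s, i)|exists s, i].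
  have [M M0 MP] := tA _ cP; exists M => // j t.
  have -> : (comphom (w j) (b t) : pdual R A) *+ M = \sum_s ((comphom (w j) (x s) : pdual R A) *+ M) *~ nn t s.
    have hB := comphomBl (w j).
    have -> : (comphom (w j) (b t) : pdual R A) = \sum_s (comphom (w j) (x s) : pdual R A) *~ nn t s.
      rewrite /b; elim/big_rec2: _ => [|s y z _ <-]; first exact: (zmorph0 hB).
      rewrite (zmorphD hB); congr (_ + _).
      by case: (nn t s) => q; rewrite ?NegzE ?mulrNz -?pmulrn ?(zmorphN hB) (zmorphMn hB).
    rewrite -sumrMnl; apply: eq_bigr => s _.
    by rewrite !pmulrn -!mulrzA mulrC.
  by apply: rpred_sum => s _; apply: rpredMz; apply: MP; exists s, j.
have bM (g : R) M : `|g| <= bd -> `|g *+ M| <= bd *+ M.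
  by move=> h; rewrite normrMn lerMn2r h orbT.
have [K cK KP] := KB (bd *+ MB); have [K' cK' KP'] := KA (bd *+ MA).
have [v' [uv vge]] := nat_ultra.
have Fv : Filter v' by apply: filter_filter.
have fin (J : finType) (P : J -> set nat) : (forall j, v' (P j)) -> v' [set t | forall j, P j t].
  move=> vP; suff : forall s : seq J, v' [set t | forall j, j \in s -> P j t].
    move=> /(_ (enum J)); apply: (@filterS _ v' Fv) => t tP j; apply: tP; exact: mem_enum.
  elim=> [|j s IHs]; first by apply: (@filterS _ v' Fv setT) => //; exact: (@filterT _ v' Fv).
  apply: (@filterS _ v' Fv _ _ _ (@filterI _ v' Fv _ _ (vP j) IHs)) => t [Pj Ps] j'.
  by rewrite inE => /predU1P[->//|]; exact: Ps.
have exB i : exists E, v' E /\ forall t t', E t -> E t' -> VB ((b t (e i) *+ MB - b t' (e i) *+ MB) *+ MA).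
  have Ku t : K (b t (e i) *+ MB).
    by apply: KP => // q; rewrite homMn; apply: bM; exact: (bdP (inl (i, q)) t).
  by have [E vE EP] := recurrence uv cK Ku (hom_nbhs0 (mulnhom B MA) VB0); exists E.
have exA j : exists E, v' E /\ forall t t', E t -> E t' ->
    VA (((comphom (w j) (b t) : pdual R A) *+ MA - (comphom (w j) (b t') : pdual R A) *+ MA) *+ MB).
  have Ku t : K' ((comphom (w j) (b t) : pdual R A) *+ MA).
    by apply: KP' => // q; rewrite homMn; apply: bM; exact: (bdP (inr (j, q)) t).
  by have [E vE EP] := recurrence uv cK' Ku (hom_nbhs0 (mulnhom (pdual R A) MB) VA0); exists E.
have [EB EBP] := choice exB; have [EA EAP] := choice exA.
have vB : v' [set t | forall i, EB i t] by apply: fin => i; have [] := EBP i.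
have vA : v' [set t | forall j, EA j t] by apply: fin => j; have [] := EAP j.
have vAB := @filterI _ v' Fv _ _ vB vA.
have Pv : ProperFilter v' by apply: ultra_proper.
have [t0 [tB0 tA0]] := @filter_ex _ v' Pv _ vAB.
have [t1 [[tB1 tA1] t01]] := @filter_ex _ v' Pv _ (@filterI _ v' Fv _ _ vAB (vge t0.+1)).
exists (fun s => nn t1 s - nn t0 s).
  have fl (t : nat) : Num.floor (t%:R : R) = t%:Z by exact: (intrKfloor (t%:Z)).
  exists s0; rewrite /nn vs0 !mulr1 !fl subr_eq0.
  by apply/eqP => -[h]; rewrite /= h ltnn in t01.
move=> f Ff; have -> : \sum_s x s *~ (nn t1 s - nn t0 s) = b t1 - b t0.
  by rewrite /b -sumrB; apply: eq_bigr => s _; rewrite mulrzBr.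
have : f ((b t1 - b t0) *+ (MB * MA)) = 0.
  apply: FV => // [i|j].
    have [_ /(_ _ _ (tB1 i) (tB0 i))] := EBP i.
    by rewrite -mulrnBl -mulrnA (zmorphMn (@eval_morph A B (e i))).
  have [_ /(_ _ _ (tA1 j) (tA0 j))] := EAP j.
  by rewrite -mulrnBl -mulrnA -comphomBl mulnC -(zmorphMn (comphomBl (w j))).
rewrite homMn => /eqP; rewrite mulrn_eq0 => /orP[|/eqP//].
by rewrite muln_eq0 !eqn0Ngt MB0 MA0.
Qed.

(** The finitely many rank-one homomorphisms detect whether [f] satisfies
    [kills]. Such [f] kill the small elements by [kills_small], so by
    [relations] they have finite rank and are detected by finitely many
    further points. *)
Lemma homto_hom_finite : finite_dim (homto R X).
Proof.
have [C [G tG]] := torsion_mod_ex lA sepA.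
have [D [H tH]] := torsion_mod_ex (pdual_LCA R lB) sepB'.
have [[cC C0 CN] GP _] := tG; have [[cD D0 DN] HP _] := tH.
have [k [e [rho [n [eG rhoe GC]]]]] := lattice_LCA R cC C0 CN GP.
have [l [w [sig [m [wH sigw HC]]]]] := lattice_LCA R cD D0 DN HP.
have [VB [VA [VB0 VA0 FV]]] := kills_small lB mA mB tG tH eG rhoe GC sigw HC.
have [s sP] := finite_rank_sep (relations VB0 VA0 FV).
pose pts := s ++ [seq rankone lB rho sig i j 1 | i <- enum 'I_k, j <- enum 'I_l].
apply: (@finite_sep_dims R (homto R X) X pts (fun b f => f b)) => // f fpts.
have fs b : b \in s -> f b = 0 by move=> bs; apply: fpts; rewrite mem_cat bs.
have kf : kills lB rho sig f.
  move=> i j; apply: fpts; rewrite mem_cat; apply/orP; right.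
  by apply/allpairsP; exists (i, j); rewrite !mem_enum.
by apply: homP => b; exact: sP.
Qed.

End HomToRealFinite.

Section FLCAHom.
Variable R : realType.

Lemma FLCA_mulprimes (A : topologicalZmodType) : is_FLCA R A -> mulprimes A.
Proof. by move=> [_ [_ _ h]] p /h[st fk fc]; exact: finite_ranks_mulfin. Qed.

Theorem hom_FLCA (A B : topologicalZmodType) : is_FLCA R A -> is_FLCA R B -> is_FLCA R (chom A B).
Proof.
move=> fA fB; have mA := FLCA_mulprimes fA; have mB := FLCA_mulprimes fB.
have [lA [dA1 dA2 _]] := fA; have [lB [dB1 dB2 _]] := fB.
have sA := hom_separated dA1; have sB := hom_separated dB1.
have sA' := hom_dual_separated lA dA2; have sB' := hom_dual_separated lB dB2.
have lX : LCA (chom A B).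
  have [C [G tG]] := torsion_mod_ex lA sA.
  have [D [H tH]] := torsion_mod_ex (pdual_LCA R lB) sB'.
  exact (hom_LCA lB mA mB tG tH).
split=> //; split.
- exact: homto_hom_finite.
- have [s sP] := sA; have [s' sP'] := sB'; exact (homfrom_hom_finite lA lB sP sP').
by move=> p pp; apply: mulfin_finite_ranks; exact: hom_mulprimes.
Qed.

Lemma circle_FLCA : is_FLCA R (circle R).
Proof.
split; first exact: circle_LCA.
split.
- exists 0%N, (fun=> 0) => f; exists (fun=> 0); rewrite big_ord0.
  have [M MP] := compact_bound f (@circle_compact R).
  apply: homP => x; apply: (@bounded_multiples0 _ _ M) => n.
  by rewrite -homMn; exact: MP.
- exists 1%N, (fun=> cpi R : homfrom R (circle R)) => phi.
  have [r rP] := char_real phi; exists (fun=> r); rewrite big_ord1.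
  by apply: homP => t; rewrite rP.
move=> p pp; apply: mulfin_finite_ranks; have p0 := prime_gt0 pp.
have p0' : (0 : R) < p%:R by rewrite ltr0n.
split.
- move=> U /cball_basis[d d0 dU]; apply: filterS (cball_nbhs d0) => _ [r rd <-].
  exists (cpi R (r / p%:R)); last by rewrite -homMn -(mulr_natr (r / p%:R) p) divfK// gt_eqF.
  apply: dU; apply: cball_cpi; apply: le_trans rd.
  by rewrite normrM normfV (gtr0_norm p0') ler_pdivrMr// ler_peMr// ler1n.
- pose s := [seq cpi R ((i%:R - p%:R) / p%:R) | i <- iota 0 (2 * p).+1].
  suff sP x : x *+ p = 0 -> x \in s by apply: sub_finite_set sP _; exact: finite_seq.
  move=> xp; have [r r2 rx] := cpi_surj x.
  have : cpi R (r *+ p) = 0 by rewrite homMn rx.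
  move=> /cpi_eq0 /intrP[z zE].
  have rE : r = z%:~R / p%:R by rewrite -zE -(mulr_natr r p) mulfK// gt_eqF.
  have zb : (`|z| <= p%:Z)%R.
    rewrite -(ler_int R) intr_norm -zE normrMn -(mulr_natr `|r| p).
    by rewrite ger_pMl//; apply: le_trans r2 _; rewrite invf_le1// ler1n.
  apply/mapP; exists `|(z + p%:Z)%R|%N; first by rewrite mem_iota; lia.
  rewrite -rx rE; congr (cpi R (_ / _)).
  by rewrite natr_absz ger0_norm; [rewrite intrD addrK|lia].
exists [:: 0] => x; exists 0; first exact: mem_head.
have [y yE] := divisible_circle x p.-1; exists y.
by rewrite addr0 -yE prednK.
Qed.

End FLCAHom.

(** * Pure tensors *)

Section TensorProduct.
Variable R : realType.
Local Notation T := (circle R).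
Local Notation "A ⊗ B" := (tensor R A B) (at level 40, left associativity).

Lemma comphomE (A B C : topologicalZmodType) (g : chom B C) (f : chom A B) x :
  comphom g f x = g (f x).
Proof. by []. Qed.

Definition pure (A B : topologicalZmodType) (a : A) (b : B) : A ⊗ B :=
  comphom (evalhom T b) (evalhom (chom B T) a).

Lemma pureE (A B : topologicalZmodType) (a : A) (b : B) (phi : chom A (pdual R B)) :
  pure a b phi = phi a b.
Proof. by []. Qed.

Lemma pureBl (A B : topologicalZmodType) (b : B) : zmod_morphism (fun a : A => pure a b).
Proof.
move=> x y; apply: homP => phi; rewrite pureE homB.
by rewrite -[RHS]/(pure x b phi - pure y b phi) !pureE.
Qed.

Lemma pureBr (A B : topologicalZmodType) (a : A) : zmod_morphism (fun b : B => pure a b).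
Proof.
move=> x y; apply: homP => phi; rewrite pureE homB.
by rewrite -[RHS]/(pure a x phi - pure a y phi) !pureE.
Qed.

Lemma tensormap_pure (A A' B B' : topologicalZmodType) (f : chom A A') (g : chom B B') a b :
  tensormap R f g (pure a b) = pure (f a) (g b).
Proof. by apply: homP. Qed.

Lemma pure_continuous (A B : topologicalZmodType) : LCA A -> LCA B ->
  continuous (fun z : A * B => pure z.1 z.2).
Proof.
move=> lA lB; apply: continuous_curry => -[a b] phi U Uab.
have [[P Q] /= [Pphi Qb] PQ] := @eval_nbhs _ _ (phi a) b U lB Uab; have [[S S'] /= [Sphi Sa] SS] := eval_nbhs lA Pphi.
exists (S' `*` Q, S); first by split=> //; exists (S', Q).
move=> [[a' b'] phi'] /= [[Sa' Qb'] Sphi'].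
by apply: (PQ (phi' a', b')); split=> //; exact: (SS (phi', a')).
Qed.

Lemma pure_nbhs (A B : topologicalZmodType) (a : A) (b : B) U : LCA A -> LCA B ->
  nbhs (pure a b) U -> nbhs (a, b) [set z : A * B | U (pure z.1 z.2)].
Proof. by move=> lA lB; exact: (pure_continuous lA lB (x := (a, b))). Qed.

Section Pure.
Variables (A B : topologicalZmodType).
Hypotheses (lA : LCA A) (lB : LCA B).

Lemma pure_continuousl (b : B) : continuous (fun a : A => pure a b).
Proof.
move=> a U /(pure_nbhs lA lB)[[P Q] /= [Pa Qb] PQ]; apply: filterS Pa => a' Pa'.
by apply: (PQ (a', b)); split=> //=; exact: nbhs_singleton.
Qed.

Lemma pure_continuousr (a : A) : continuous (fun b : B => pure a b).
Proof.
move=> b U /(pure_nbhs lA lB)[[P Q] /= [Pa Qb] PQ]; apply: filterS Qb => b' Qb'.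
by apply: (PQ (a, b')); split=> //=; exact: nbhs_singleton.
Qed.

Definition purel (b : B) : chom A (A ⊗ B) := mkhom (@pureBl A B b) (@pure_continuousl b).
Definition purer (a : A) : chom B (A ⊗ B) := mkhom (@pureBr A B a) (@pure_continuousr a).

Lemma purerB : zmod_morphism purer.
Proof. by move=> x y; apply: homP => b; exact: pureBl. Qed.

Lemma purer_continuous : continuous purer.
Proof. by apply: continuous_curry => a b U; exact: pure_nbhs. Qed.

Definition purehom : chom A (chom B (A ⊗ B)) := mkhom purerB purer_continuous.

(** By duality, the composite of [f] with a character is evaluation at some
    [phi], whose values [phi a b] are those of the composite at pure tensors.
    *)
Lemma pure_ext (D : topologicalZmodType) (f g : chom (A ⊗ B) D) : LCA D ->
  LCA (chom A (pdual R B)) -> (forall a b, f (pure a b) = g (pure a b)) -> f = g.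
Proof.
move=> lD lX fg; apply: homP => z; apply: (enough_chars2 (R := R) lD) => chi.
have E (h : chom (A ⊗ B) D) : comphom chi h = alpha_fun R (alpha_inv R lX (comphom chi h)) :> pdual R (pdual R (chom A (pdual R B))).
  by rewrite -[LHS](alpha_invK lX); exact: homP.
suff e : alpha_inv R lX (comphom chi f) = alpha_inv R lX (comphom chi g).
  by rewrite -[LHS]/(comphom chi f z) -[RHS]/(comphom chi g z) E e -E.
apply: homP => a; apply: homP => b.
by rewrite -!(pureE a b) !alpha_invE !comphomE fg.
Qed.

(** The transpose of [chi |-> chi \o psi], a homomorphism from the dual of [C]
    to [Hom(A, B^)], followed by the identification of the bidual of [C] with
    [C]. *)
Lemma tlift_ex (C : topologicalZmodType) (psi : chom A (chom B C)) : LCA C ->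
  exists f : chom (A ⊗ B) C, forall a b, f (pure a b) = psi a b.
Proof.
move=> lC.
pose m0 (chi : pdual R C) : chom A (pdual R B) := comphom (hommap (idhom B) chi) psi.
have m0E chi a b : m0 chi a b = chi (psi a b) by [].
have m0B : zmod_morphism m0 by move=> x y; apply: homP => a; apply: homP => b.
have m0C : continuous m0.
  apply: continuous_curry => chi a.
  have h : continuous (fun z : pdual R C * A => m0 z.1 z.2 : chom B T).
    apply: continuous_curry => -[chi' a'] b U Uab.
    have [[P Q] /= [Pchi Qp] PQ] := @eval_nbhs _ _ chi' (psi a' b) U lC Uab; have [[S S'] /= [Sp Sb] SS] := eval_nbhs lB Qp.
    exists (P `*` (psi @^-1` S), S').
      by split=> //; exists (P, psi @^-1` S) => //; split=> //; exact: hom_nbhs.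
    move=> [[chi'' a''] b''] /= [[Pc Sa] Sb''].
    by apply: (PQ (chi'', psi a'' b'')); split=> //; exact: (SS (psi a'', b'')).
  by move=> U; exact: (h (chi, a)).
exists (comphom (alpha_inv R lC) (dualmap R (mkhom m0B m0C))) => a b.
apply: (enough_chars2 (R := R) lC) => chi; rewrite comphomE alpha_invE.
by rewrite -[LHS]/(pure a b (m0 chi)) pureE.
Qed.

Definition tlift (C : topologicalZmodType) (lC : LCA C) (psi : chom A (chom B C)) : chom (A ⊗ B) C :=
  projT1 (cid (tlift_ex psi lC)).

Lemma tliftE (C : topologicalZmodType) (lC : LCA C) (psi : chom A (chom B C)) a b :
  tlift lC psi (pure a b) = psi a b.
Proof. by rewrite /tlift; case: cid. Qed.

Definition tcurry (C : topologicalZmodType) (f : chom (A ⊗ B) C) : chom A (chom B C) :=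
  comphom (hommap (idhom B) f) purehom.

Lemma tcurryE (C : topologicalZmodType) (f : chom (A ⊗ B) C) a b : tcurry f a b = f (pure a b).
Proof. by []. Qed.

End Pure.
End TensorProduct.

(** * The closed symmetric monoidal structure *)

Section Category.
Variable R : realType.
Local Notation T := (circle R).
Implicit Types (A B C D X Y Z W : FLCA R).

Lemma lca A : LCA A. Proof. by have [] := flcaP A. Qed.

Lemma chomFLCA A B : is_FLCA R (chom A B).
Proof. by apply: hom_FLCA; exact: flcaP. Qed.

Lemma dualFLCA A : is_FLCA R (pdual R A).
Proof. by apply: hom_FLCA; [exact: flcaP|exact: circle_FLCA]. Qed.

Lemma tensFLCA A B : is_FLCA R (tensor R A B).
Proof.
apply: hom_FLCA; last exact: circle_FLCA.
by apply: hom_FLCA; [exact: flcaP|exact: dualFLCA].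
Qed.

Definition ihom A B : FLCA R := MkFLCA (chomFLCA A B).
Definition tens A B : FLCA R := MkFLCA (tensFLCA A B).
(** The endomorphisms of the circle, which are the integers by [circle_endo].
    In this form the unit has finite ranks by [hom_FLCA]. *)
Definition unitF : FLCA R := MkFLCA (hom_FLCA (@circle_FLCA R) (@circle_FLCA R)).

Local Notation "A ⊗ B" := (tens A B) (at level 40, left associativity).

Definition tpure A B (a : A) (b : B) : A ⊗ B := @pure R A B a b.

Definition tpurel A B (b : B) : chom A (A ⊗ B) := purel R (lca A) (lca B) b.
Definition tpurer A B (a : A) : chom B (A ⊗ B) := purer R (lca A) (lca B) a.
Arguments tpurel : clear implicits.
Arguments tpurer : clear implicits.

Lemma tpurelE A B (a : A) (b : B) : tpurel A B b a = tpure a b. Proof. by []. Qed.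
Lemma tpurerE A B (a : A) (b : B) : tpurer A B a b = tpure a b. Proof. by []. Qed.

Lemma tpure_ext A B D (f g : chom (A ⊗ B) D) :
  (forall a b, f (tpure a b) = g (tpure a b)) -> f = g.
Proof.
apply: pure_ext; try exact: lca.
exact: (hom_FLCA (flcaP A) (dualFLCA B)).1.
Qed.

Lemma tpure_ext3 A B C D (f g : chom (A ⊗ B ⊗ C) D) :
  (forall a b c, f (tpure (tpure a b) c) = g (tpure (tpure a b) c)) -> f = g.
Proof.
move=> fg; apply: tpure_ext => ab c.
have e : comphom f (tpurel (A ⊗ B) C c) = comphom g (tpurel (A ⊗ B) C c).
  by apply: tpure_ext => a b; rewrite !comphomE !tpurelE fg.
by rewrite -[tpure ab c]tpurelE -[LHS]comphomE e comphomE.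
Qed.

Lemma tpure_ext3r A B C D (f g : chom (A ⊗ (B ⊗ C)) D) :
  (forall a b c, f (tpure a (tpure b c)) = g (tpure a (tpure b c))) -> f = g.
Proof.
move=> fg; apply: tpure_ext => a bc.
have e : comphom f (tpurer A (B ⊗ C) a) = comphom g (tpurer A (B ⊗ C) a).
  by apply: tpure_ext => b c; rewrite !comphomE !tpurerE fg.
by rewrite -[tpure a bc]tpurerE -[LHS]comphomE e comphomE.
Qed.

Lemma tpure_ext4 A B C D W (f g : chom (A ⊗ B ⊗ C ⊗ D) W) :
  (forall a b c d, f (tpure (tpure (tpure a b) c) d) = g (tpure (tpure (tpure a b) c) d)) -> f = g.
Proof.
move=> fg; apply: tpure_ext => abc d.
have e : comphom f (tpurel (A ⊗ B ⊗ C) D d) = comphom g (tpurel (A ⊗ B ⊗ C) D d).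
  by apply: tpure_ext3 => a b c; rewrite !comphomE !tpurelE fg.
by rewrite -[tpure abc d]tpurelE -[LHS]comphomE e comphomE.
Qed.

Definition tmap A A' B B' (f : chom A A') (g : chom B B') : chom (A ⊗ B) (A' ⊗ B') :=
  tensormap R f g.

Lemma tmapE A A' B B' (f : chom A A') (g : chom B B') a b :
  tmap f g (tpure a b) = tpure (f a) (g b).
Proof. exact: tensormap_pure. Qed.

Lemma braid_ex A B : exists f : chom (A ⊗ B) (B ⊗ A), forall a b, f (tpure a b) = tpure b a.
Proof.
have psiC : continuous (fun a : A => tpurel B A a : chom B (tensor R B A)).
  apply: continuous_curry => a b U /(pure_nbhs (lca B) (lca A))[[P Q] /= [Pb Qa] PQ].
  by exists (Q, P) => //= -[a' b'] /= [Qa' Pb']; exact: (PQ (b', a')).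
have psiB : zmod_morphism (fun a : A => tpurel B A a : chom B (tensor R B A)).
  by move=> x y; apply: homP => b; exact: pureBr.
have [f fP] := tlift_ex R (lca B) (mkhom psiB psiC) (lca (B ⊗ A)).
by exists f.
Qed.

Definition braid A B : chom (A ⊗ B) (B ⊗ A) := projT1 (cid (braid_ex A B)).

Lemma braidE A B (a : A) (b : B) : braid A B (tpure a b) = tpure b a.
Proof. by rewrite /braid; case: cid. Qed.

Lemma braidK A B : comphom (braid B A) (braid A B) = idhom (A ⊗ B).
Proof. by apply: tpure_ext => a b; rewrite comphomE !braidE. Qed.

(** The universal property is applied twice to [a |-> b |-> c |-> tpure a
    (tpure b c)]. *)
Lemma assoc_ex A B C : exists f : chom (A ⊗ B ⊗ C) (A ⊗ (B ⊗ C)),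
  forall a b c, f (tpure (tpure a b) c) = tpure a (tpure b c).
Proof.
pose E := A ⊗ (B ⊗ C).
pose psi2 (a : A) (b : B) : chom C E := comphom (tpurer A (B ⊗ C) a) (tpurer B C b).
have psi2C : continuous (fun z : A * B => psi2 z.1 z.2).
  apply: continuous_curry => -[a b] c U /= /(pure_nbhs (lca A) (lca (B ⊗ C)))[[P Q] /= [Pa Qbc] PQ].
  have [[S S'] /= [Sb Sc] SS] := pure_nbhs (lca B) (lca C) Qbc.
  exists (P `*` S, S'); first by split=> //; exists (P, S).
  move=> [[a' b'] c'] /= [[Pa' Sb'] Sc'].
  by apply: (PQ (a', tpure b' c')); split=> //; exact: (SS (b', c')).
have psi1B a : zmod_morphism (psi2 a).
  move=> x y; apply: homP => c; rewrite /psi2 !comphomE.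
  rewrite -[RHS]/(tpurer A (B ⊗ C) a (tpure x c) - tpurer A (B ⊗ C) a (tpure y c)) -homB.
  by congr (tpurer _ _ _ _); exact: (homB (tpurel B C c)).
have psi1C a : continuous (psi2 a).
  move=> b U /(psi2C (a, b))[[P Q] /= [Pa Qb] PQ]; apply: filterS Qb => b' Qb'.
  by apply: (PQ (a, b')); split=> //=; exact: nbhs_singleton.
pose psi1 a : chom B (chom C E) := mkhom (psi1B a) (psi1C a).
have psi0B : zmod_morphism psi1.
  by move=> x y; apply: homP => b; apply: homP => c; exact: pureBl.
have psi0C : continuous psi1.
  by apply: continuous_curry => a b U; exact: (psi2C (a, b)).
have [g gP] := tlift_ex R (lca B) (mkhom psi0B psi0C) (lca (ihom C E)).
have [f fP] := tlift_ex R (lca C) g (lca E).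
exists f => a b c; by rewrite fP gP.
Qed.

Definition assoc A B C : chom (A ⊗ B ⊗ C) (A ⊗ (B ⊗ C)) := projT1 (cid (assoc_ex A B C)).

Lemma assocE A B C (a : A) (b : B) (c : C) :
  assoc A B C (tpure (tpure a b) c) = tpure a (tpure b c).
Proof. by rewrite /assoc; case: cid. Qed.

(** Up to the symmetry, the associator for the reversed order of the factors
    is the inverse of the associator. *)
Definition assoc_inv A B C : chom (A ⊗ (B ⊗ C)) (A ⊗ B ⊗ C) :=
  comphom (braid C (A ⊗ B)) (comphom (tmap (idhom C) (braid B A)) (comphom (assoc C B A)
    (comphom (tmap (braid B C) (idhom A)) (braid A (B ⊗ C))))).

Lemma assoc_invE A B C (a : A) (b : B) (c : C) :
  assoc_inv A B C (tpure a (tpure b c)) = tpure (tpure a b) c.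
Proof. by rewrite /assoc_inv !comphomE braidE tmapE braidE assocE tmapE braidE braidE. Qed.

Definition one : unitF := idhom T.

Lemma circle_endo (f : chom T T) : exists n : int, f = idhom T *~ n.
Proof.
have [r rP] := char_real (comphom f (cpi R)).
have /intrP[n nE] : r \is a Num.int.
  apply/cpi_eq0; rewrite -[r]mulr1 -rP comphomE.
  by rewrite (_ : cpi R 1 = 0) ?hom0//; apply/cpi_eq0; exact: int_num1.
exists n; apply: homP => x; have [t _ <-] := cpi_surj x.
rewrite -[LHS]/(comphom f (cpi R) t) rP nE mulrzl homMz.
have -> : (idhom T *~ n) (cpi R t) = evalhom T (cpi R t) (idhom T *~ n) by [].
by rewrite homMz.
Qed.

Lemma tpure_mulz A B (a : A) (b : B) (n : int) : tpure (a *~ n) b = tpure a b *~ n.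
Proof. exact: (homMz (tpurel A B b)). Qed.

Lemma tpure_mulzr A B (a : A) (b : B) (n : int) : tpure a (b *~ n) = tpure a b *~ n.
Proof. exact: (homMz (tpurer A B a)). Qed.

Lemma tpure_ext_unit A D (f g : chom (unitF ⊗ A) D) :
  (forall a, f (tpure one a) = g (tpure one a)) -> f = g.
Proof.
move=> fg; apply: tpure_ext => i a; have [n ->] := circle_endo i.
by rewrite (@tpure_mulz unitF A one a n) !homMz fg.
Qed.

Lemma tpure_ext_unitr A D (f g : chom (A ⊗ unitF) D) :
  (forall a, f (tpure a one) = g (tpure a one)) -> f = g.
Proof.
move=> fg; apply: tpure_ext => a i; have [n ->] := circle_endo i.
by rewrite (@tpure_mulzr A unitF a one n) !homMz fg.
Qed.

(** The transpose of [chi |-> (i |-> i \o chi)]. *)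
Lemma lunit_ex A : exists f : chom (unitF ⊗ A) A, forall a, f (tpure one a) = a.
Proof.
pose m0 (chi : pdual R A) : chom unitF (pdual R A) := hommap chi (idhom T).
have m0E chi i a : m0 chi i a = i (chi a) by [].
have m0B : zmod_morphism m0.
  by move=> x y; apply: homP => i; apply: homP => a; exact: (homB i).
have m0C : continuous m0.
  apply: continuous_curry => chi i.
  have h : continuous (fun z : pdual R A * unitF => m0 z.1 z.2 : chom A T).
    apply: continuous_curry => -[chi' i'] a U Uab.
    have [[P Q] /= [Pi Qp] PQ] := @eval_nbhs _ _ i' (chi' a) U (@circle_LCA R) Uab; have [[S S'] /= [Sc Sa] SS] := eval_nbhs (lca A) Qp.
    exists (S `*` P, S'); first by split=> //; exists (S, P).
    move=> [[chi'' i''] a''] /= [[Sc'' Pi''] Sa''].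
    by apply: (PQ (i'', chi'' a'')); split=> //; exact: (SS (chi'', a'')).
  by move=> U; exact: (h (chi, i)).
exists (comphom (alpha_inv R (lca A)) (dualmap R (mkhom m0B m0C))) => a.
by apply: (enough_chars2 (R := R) (lca A)) => chi; rewrite comphomE alpha_invE.
Qed.

Definition lunit A : chom (unitF ⊗ A) A := projT1 (cid (lunit_ex A)).

Lemma lunitE A (a : A) : lunit A (tpure one a) = a.
Proof. by rewrite /lunit; case: cid. Qed.

Definition runit A : chom (A ⊗ unitF) A := comphom (lunit A) (braid A unitF).

Lemma runitE A (a : A) : runit A (tpure a one) = a.
Proof. by rewrite /runit comphomE braidE lunitE. Qed.

Definition lunit_inv A : chom A (unitF ⊗ A) := tpurer unitF A one.
Definition runit_inv A : chom A (A ⊗ unitF) := tpurel A unitF one.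

Local Notation CT := (@FLCAb R).

Lemma assocK A B C : comphom (assoc_inv A B C) (assoc A B C) = idhom (A ⊗ B ⊗ C).
Proof. by apply: tpure_ext3 => a b c; rewrite comphomE assocE assoc_invE. Qed.

Lemma assoc_invK A B C : comphom (assoc A B C) (assoc_inv A B C) = idhom (A ⊗ (B ⊗ C)).
Proof. by apply: tpure_ext3r => a b c; rewrite comphomE assoc_invE assocE. Qed.

Lemma lunitK A : comphom (lunit_inv A) (lunit A) = idhom (unitF ⊗ A).
Proof. by apply: tpure_ext_unit => a; rewrite comphomE lunitE. Qed.

Lemma lunit_invK A : comphom (lunit A) (lunit_inv A) = idhom A.
Proof. by apply: homP => a; rewrite comphomE -[lunit_inv A a]/(tpure one a) lunitE. Qed.

Lemma runitK A : comphom (runit_inv A) (runit A) = idhom (A ⊗ unitF).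
Proof. by apply: tpure_ext_unitr => a; rewrite comphomE runitE. Qed.

Lemma runit_invK A : comphom (runit A) (runit_inv A) = idhom A.
Proof. by apply: homP => a; rewrite comphomE -[runit_inv A a]/(tpure a one) runitE. Qed.

Local Notation TF := (tensorfunctor tensFLCA).
Local Notation HF := (homfunctor chomFLCA).

Definition iso_assoc A B C : @isomorphism CT (TF (TF A B) C) (TF A (TF B C)) :=
  @Isomorphism CT (A ⊗ B ⊗ C) (A ⊗ (B ⊗ C)) (assoc A B C) (assoc_inv A B C)
    (assocK A B C) (assoc_invK A B C).
Definition iso_lunit A : @isomorphism CT (TF unitF A) A :=
  @Isomorphism CT (unitF ⊗ A) A (lunit A) (lunit_inv A) (lunitK A) (lunit_invK A).
Definition iso_runit A : @isomorphism CT (TF A unitF) A :=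
  @Isomorphism CT (A ⊗ unitF) A (runit A) (runit_inv A) (runitK A) (runit_invK A).
Definition iso_braid A B : @isomorphism CT (TF A B) (TF B A) :=
  @Isomorphism CT (A ⊗ B) (B ⊗ A) (braid A B) (braid B A) (braidK A B) (braidK B A).

Lemma assoc_nat A A' B B' C C' (f : chom A A') (g : chom B B') (h : chom C C') :
  comphom (assoc A' B' C') (tmap (tmap f g) h) = comphom (tmap f (tmap g h)) (assoc A B C).
Proof. by apply: tpure_ext3 => a b c; rewrite !comphomE assocE !tmapE assocE. Qed.

Lemma lunit_nat A A' (f : chom A A') :
  comphom (lunit A') (tmap (idhom unitF) f) = comphom f (lunit A).
Proof. by apply: tpure_ext_unit => a; rewrite !comphomE lunitE tmapE lunitE. Qed.

Lemma runit_nat A A' (f : chom A A') :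
  comphom (runit A') (tmap f (idhom unitF)) = comphom f (runit A).
Proof. by apply: tpure_ext_unitr => a; rewrite [LHS]comphomE [RHS]comphomE runitE tmapE; exact: runitE. Qed.

Lemma braid_nat A A' B B' (f : chom A A') (g : chom B B') :
  comphom (braid A' B') (tmap f g) = comphom (tmap g f) (braid A B).
Proof. by apply: tpure_ext => a b; rewrite !comphomE braidE !tmapE braidE. Qed.

Lemma pentagon A B C D :
  comphom (assoc A B (C ⊗ D)) (assoc (A ⊗ B) C D) =
  comphom (comphom (tmap (idhom A) (assoc B C D)) (assoc A (B ⊗ C) D))
    (tmap (assoc A B C) (idhom D)).
Proof.
by apply: tpure_ext4 => a b c d; rewrite !comphomE !assocE tmapE !assocE tmapE assocE.
Qed.

Lemma triangle A B :
  comphom (tmap (idhom A) (lunit B)) (assoc A unitF B) = tmap (runit A) (idhom B).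
Proof.
apply: tpure_ext => ai b.
have := @tpure_ext_unitr A (A ⊗ B)
  (comphom (comphom (tmap (idhom A) (lunit B)) (assoc A unitF B)) (tpurel (A ⊗ unitF) B b))
  (comphom (tmap (runit A) (idhom B)) (tpurel (A ⊗ unitF) B b)).
move=> h; apply: (congr1 (fun h : chom (A ⊗ unitF) (A ⊗ B) => h ai) (h _)) => a.
rewrite !comphomE -[tpurel _ B b _]/(tpure (tpure a one) b).
by rewrite assocE !tmapE lunitE runitE.
Qed.

Lemma hexagon A B C :
  comphom (comphom (assoc B C A) (braid A (B ⊗ C))) (assoc A B C) =
  comphom (comphom (tmap (idhom B) (braid A C)) (assoc B A C)) (tmap (braid A B) (idhom C)).
Proof.
apply: tpure_ext3 => a b c.
by rewrite !comphomE assocE braidE assocE tmapE braidE assocE tmapE braidE.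
Qed.

Definition FLCAb_monoidal : symmetric_monoidal TF :=
  @SymMonoidal CT TF unitF iso_assoc iso_lunit iso_runit iso_braid
    (fun X X' Y Y' Z Z' f g h => assoc_nat f g h) (fun X X' f => lunit_nat f)
    (fun X X' f => runit_nat f) (fun X X' Y Y' f g => braid_nat f g)
    pentagon triangle hexagon braidK.

Definition curryF A B C (f : chom (A ⊗ B) C) : chom A (chom B C) := tcurry (lca A) (lca B) f.

Lemma curryF_bij A B C : bijective (@curryF A B C).
Proof.
exists (fun psi : chom A (chom B C) => tlift R (lca B) (lca C) psi : chom (A ⊗ B) C) => [f|psi].
  by apply: tpure_ext => a b; exact: tliftE.
by apply: homP => a; apply: homP => b; rewrite tcurryE tliftE.
Qed.

Lemma curryF_nat A A' B B' C C' (f : chom A' A) (g : chom B' B) (h : chom C C') (k : chom (A ⊗ B) C) :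
  curryF (comphom (comphom h k) (tmap f g)) = comphom (comphom (hommap g h) (curryF k)) f.
Proof.
apply: homP => a; apply: homP => b; by rewrite -[LHS]/(h (k (tmap f g (tpure a b)))) tmapE.
Qed.

Definition FLCAb_closed : closed_structure TF HF :=
  @ClosedStructure CT TF HF (fun A B C => @curryF A B C) curryF_bij
    (fun X X' Y Y' Z Z' f g h k => curryF_nat f g h k).

End Category.

Theorem proposition3p14 (R : realType) :
  exists (homFLCA : forall A B : FLCA R, is_FLCA R (chom A B))
    (tensorFLCA : forall A B : FLCA R, is_FLCA R (tensor R A B)),
    inhabited (closed_symmetric_monoidal
      (tensorfunctor tensorFLCA) (homfunctor homFLCA)).
Proof.
exists (@chomFLCA R), (@tensFLCA R).
by constructor; split; [exact: FLCAb_monoidal|exact: FLCAb_closed].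
Qed.
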